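(* Let $\alpha$ be an Einstein metric with Ricci constant $\mu$ on an $n$-dimensional manifold and let $\beta$ be a Killing form of $\alpha$. Let $\bar\alpha=e^{\rho(b^2)}\sqrt{\alpha^2-\kappa(b^2)\beta^2}$ and $\Delta:=1-b^2\kappa$. Then $\bar\alpha$ is an Einstein metric with Ricci constant $\bar\mu$ if and only if $$E_1\alpha^2+E_2\beta^2+E_3s_0^2+E_4t_{00}+E_5\beta t_0+E_6s_{0|0}=0,$$ where $$E_1=2\rho' t^i{}_i+2\Big\{\frac{\Delta'}{\Delta}\rho'+2(n-2)\rho'^2+2\rho''\Big\}t+(n-1)\mu(1+2b^2\rho')-(n-1)\bar\mu e^{2\rho},$$ $$\begin{aligned}E_2=&-\frac{1}{b^4}\big\{\Delta^2-1-b^2\Delta'-(\Delta-1)(1+2b^2\rho')\big\}t^i{}_i+\frac{1}{b^6\Delta}\big\{2\Delta(\Delta^2-1)-b^2(5\Delta-1)\Delta'-b^4\Delta'^2+2b^4\Delta\Delta''\\&-2(n-2)b^2\Delta(\Delta-1)\rho'+2b^4[(n-1)\Delta-1]\Delta'\rho'+4(n-2)b^4\Delta(\Delta-1)\rho'^2+4b^4\Delta(\Delta-1)\rho''\big\}t\\&+\frac{n-1}{b^2}\mu\big\{b^2\Delta'+(\Delta-1)(1+2b^2\rho')\big\}-\frac{n-1}{b^2}\bar\mu(\Delta-1)e^{2\rho},\end{aligned}$$ $$E_3=\frac{2}{b^4}(\Delta-1)-\frac{2\Delta'}{b^2\Delta}+\frac{\Delta'^2}{\Delta^2}-\frac{2}{\Delta}\Delta''+4(n-2)(\rho'^2-\rho''),\qquad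 E_4=\frac{2}{b^2}(\Delta-1),$$ $$E_5=-\frac{4}{b^4}(\Delta-1)+\frac{2}{b^2\Delta}(3\Delta-1)\Delta'+\frac{4}{b^2}(n-2)(\Delta-1)\rho',\qquad E_6=-\frac{\Delta'}{\Delta}-2(n-2)\rho'.$$
   Context: Setting: $M$ is a smooth connected $n$-manifold, $\alpha=\sqrt{a_{ij}(x)y^iy^j}$ is a Riemannian metric on $M$ (viewed as a function of tangent vectors $y$), $\beta=b_i(x)y^i$ is a 1-form, $b:=\|\beta\|_\alpha$. A bar ''$|$'' denotes covariant derivative with respect to the Levi-Civita connection of $\alpha$; indices are raised and lowered with $a_{ij}$. A 1-form is a Killing form if its dual vector field is Killing, i.e. $b_{i|j}+b_{j|i}=0$. Put $s_{ij}:=\frac12(b_{i|j}-b_{j|i})$, $s_i:=b^ms_{mi}$, $s_0:=s_iy^i$, $s_{0|0}:=s_{i|j}y^iy^j$, $t_{ij}:=s_{im}s^m{}_j$, $t_{00}:=t_{ij}y^iy^j$, $t_0:=b^it_{ij}y^j$, $t:=t_{ij}b^ib^j$, $t^i{}_i:=a^{ij}t_{ij}$. Deformation: $\rho,\kappa$ are smooth functions of the single variable $b^2$, a prime denotes $d/d(b^2)$, and $\Delta=1-b^2\kappa$ is assumed positive (so that $\bar\alpha$ is a Riemannian metric). The formulas with $b$ in the denominator are read where $\beta\neq0$. A Riemannian metric $\alpha$ in dimension $n$ is Einstein with Ricci constant $\mu$ if its Ricci tensor satisfies $Ric_{ij}y^iy^j=(n-1)\mu\alpha^2$ with $\mu$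 constant. *)

(* Defs.v *)
From HB Require Import structures.
From mathcomp Require Import all_boot all_order all_algebra.
From mathcomp Require Import all_classical all_reals all_analysis.
From mathcomp Require Import ring.
Import Order.TTheory GRing.Theory Num.Theory.
Import numFieldNormedType.Exports.

Set Implicit Arguments.
Unset Strict Implicit.
Unset Printing Implicit Defensive.

Local Open Scope ring_scope.
Local Open Scope classical_set_scope.

Definition partial (R : realType) (n : nat) (i : 'I_n) (f : 'rV[R]_n -> R)
  (x : 'rV[R]_n) : R := 'D_(delta_mx 0 i) f x.

(** [U] is meant to be open; only the values of [f] on [U] matter. *)
Fixpoint Ck (R : realType) (n k : nat) (U : set 'rV[R]_n)
    (f : 'rV[R]_n -> R) : Prop :=
  if k is k'.+1 then
    (forall x, U x -> differentiable f x) /\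
    (forall i, Ck k' U (partial i f))
  else forall x, U x -> {for x, continuous f}.

Definition smooth_on (R : realType) (n : nat) (U : set 'rV[R]_n)
  (f : 'rV[R]_n -> R) : Prop := forall k, Ck k U f.

Definition smooth1_on (R : realType) (I : set R) (f : R -> R) : Prop :=
  forall k u, I u -> derivable (derive1n k f) u 1.

Record smooth_manifold (R : realType) (n : nat) := SmoothManifold {
  carrier :> topologicalType ;
  chart : Type ;
  chart_dom : chart -> set carrier ;
  chart_coord : chart -> carrier -> 'rV[R]_n ;
  chart_inv : chart -> 'rV[R]_n -> carrier ;
  carrier_hausdorff : hausdorff_space carrier ;
  carrier_second_countable : @second_countable carrier ;
  dom_cover : forall p, exists c, chart_dom c p ;
  dom_open : forall c, open (chart_dom c) ;
  image_open : forall c, open (chart_coord c @` chart_dom c) ;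
  coordK : forall c p, chart_dom c p -> chart_inv c (chart_coord c p) = p ;
  chart_coord_continuous : forall c, {within chart_dom c, continuous (chart_coord c)} ;
  chart_inv_continuous : forall c, {within chart_coord c @` chart_dom c, continuous (chart_inv c)} ;
  transition_smooth : forall c d (j : 'I_n),
    smooth_on (chart_coord c @` (chart_dom c `&` chart_dom d))
      (fun x => chart_coord d (chart_inv c x) 0 j)
}.

Definition chart_image (R : realType) (n : nat) (M : smooth_manifold R n)
  (c : chart M) : set 'rV[R]_n := chart_coord c @` chart_dom c.

Definition overlap (R : realType) (n : nat) (M : smooth_manifold R n)
  (c d : chart M) : set 'rV[R]_n := chart_coord c @` (chart_dom c `&` chart_dom d).

Definition transition (R : realType) (n : nat) (M : smooth_manifold R n)
  (c d : chart M) (x : 'rV[R]_n) : 'rV[R]_n := chart_coord d (chart_inv c x).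

(** Covariant tensor fields are given by their components in every chart, as
    functions of the coordinates; values outside [chart_image c] are irrelevant.
    Tangent vectors are row vectors, so the differential of a change of
    coordinates [f] at [x] is [v |-> v *m 'J f x]. *)
Definition form1 (R : realType) (n : nat) (M : smooth_manifold R n) :=
  chart M -> 'rV[R]_n -> 'rV[R]_n.

Definition form2 (R : realType) (n : nat) (M : smooth_manifold R n) :=
  chart M -> 'rV[R]_n -> 'M[R]_n.

Definition is_one_form (R : realType) (n : nat) (M : smooth_manifold R n)
    (b : form1 M) : Prop :=
  (forall c i, smooth_on (chart_image c) (fun x => b c x 0 i)) /\
  (forall c d x, overlap c d x ->
     b c x = b d (transition c d x) *m ('J (transition c d) x)^T).

Definition quad (R : realType) (n : nat) (g : 'M[R]_n) (y : 'rV[R]_n) : R :=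
  \sum_i \sum_j g i j * y 0 i * y 0 j.

Definition is_riemannian (R : realType) (n : nat) (M : smooth_manifold R n)
    (a : form2 M) : Prop :=
  [/\ forall c i j, smooth_on (chart_image c) (fun x => a c x i j),
      forall c d x, overlap c d x ->
        a c x = 'J (transition c d) x *m a d (transition c d x)
                  *m ('J (transition c d) x)^T,
      forall c x, chart_image c x -> (a c x)^T = a c x
    & forall c x y, chart_image c x -> y != 0 -> 0 < quad (a c x) y].

(** From here on, [g] and [w] are the components of a metric and of a 1-form in one
    chart, and [x] is a point of its image. *)

Definition ginv (R : realType) (n : nat) (g : 'rV[R]_n -> 'M[R]_n)
  (x : 'rV[R]_n) : 'M[R]_n := invmx (g x).

(** [christoffel g k i j] is Gamma^k_{ij}. *)
Definition christoffel (R : realType) (n : nat) (g : 'rV[R]_n -> 'M[R]_n)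
    (k i j : 'I_n) (x : 'rV[R]_n) : R :=
  2^-1 * \sum_l ginv g x k l *
    (partial i (fun z => g z l j) x + partial j (fun z => g z l i) x
     - partial l (fun z => g z i j) x).

(** [covd g w i j] is w_{i|j}, the last index being that of differentiation. *)
Definition covd (R : realType) (n : nat) (g : 'rV[R]_n -> 'M[R]_n)
    (w : 'rV[R]_n -> 'rV[R]_n) (i j : 'I_n) (x : 'rV[R]_n) : R :=
  partial j (fun z => w z 0 i) x - \sum_k christoffel g k i j x * w x 0 k.

(** [riemann g k i l j] is R^k_{i l j} = dx^k(R(d_l, d_j) d_i), with
    R(X, Y) = [nabla_X, nabla_Y] - nabla_[X, Y]; with this sign the unit
    sphere has Ricci constant 1. *)
Definition riemann (R : realType) (n : nat) (g : 'rV[R]_n -> 'M[R]_n)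
    (k i l j : 'I_n) (x : 'rV[R]_n) : R :=
  partial l (christoffel g k i j) x - partial j (christoffel g k i l) x
  + \sum_m (christoffel g k l m x * christoffel g m i j x
            - christoffel g k j m x * christoffel g m i l x).

Definition ricci (R : realType) (n : nat) (g : 'rV[R]_n -> 'M[R]_n)
    (x : 'rV[R]_n) : 'M[R]_n :=
  \matrix_(i, j) \sum_k riemann g k i k j x.

Definition is_einstein (R : realType) (n : nat) (M : smooth_manifold R n)
    (mu : R) (a : form2 M) : Prop :=
  is_riemannian a /\
  (forall c x y, chart_image c x ->
     quad (ricci (a c) x) y = (n%:R - 1) * mu * quad (a c x) y).

Definition is_killing (R : realType) (n : nat) (M : smooth_manifold R n)
    (a : form2 M) (b : form1 M) : Prop :=
  forall c x i j, chart_image c x ->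
    covd (a c) (b c) i j x + covd (a c) (b c) j i x = 0.

Definition alpha (R : realType) (n : nat) (g : 'rV[R]_n -> 'M[R]_n)
  (x y : 'rV[R]_n) : R := Num.sqrt (quad (g x) y).

Definition beta (R : realType) (n : nat) (w : 'rV[R]_n -> 'rV[R]_n)
  (x y : 'rV[R]_n) : R := \sum_i w x 0 i * y 0 i.

Definition up (R : realType) (n : nat) (g : 'rV[R]_n -> 'M[R]_n)
  (w : 'rV[R]_n -> 'rV[R]_n) (x : 'rV[R]_n) (i : 'I_n) : R :=
  \sum_j ginv g x i j * w x 0 j.

(** b^2, the squared norm of beta with respect to alpha. *)
Definition normb2 (R : realType) (n : nat) (g : 'rV[R]_n -> 'M[R]_n)
  (w : 'rV[R]_n -> 'rV[R]_n) (x : 'rV[R]_n) : R :=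
  \sum_i up g w x i * w x 0 i.

(** Lower-index components s_{ij}, s_i and t_{ij} are [s_lower], [sform] and
    [t_lower]; [s00], [tbb] and [ttr] are s_{0|0}, t = t_{ij}b^ib^j and t^i_i. *)
Definition s_lower (R : realType) (n : nat) (g : 'rV[R]_n -> 'M[R]_n)
  (w : 'rV[R]_n -> 'rV[R]_n) (i j : 'I_n) (x : 'rV[R]_n) : R :=
  2^-1 * (covd g w i j x - covd g w j i x).

Definition sform (R : realType) (n : nat) (g : 'rV[R]_n -> 'M[R]_n)
  (w : 'rV[R]_n -> 'rV[R]_n) (x : 'rV[R]_n) : 'rV[R]_n :=
  \row_i \sum_m up g w x m * s_lower g w m i x.

Definition s0 (R : realType) (n : nat) (g : 'rV[R]_n -> 'M[R]_n)
  (w : 'rV[R]_n -> 'rV[R]_n) (x y : 'rV[R]_n) : R :=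
  \sum_i sform g w x 0 i * y 0 i.

Definition s00 (R : realType) (n : nat) (g : 'rV[R]_n -> 'M[R]_n)
  (w : 'rV[R]_n -> 'rV[R]_n) (x y : 'rV[R]_n) : R :=
  \sum_i \sum_j covd g (sform g w) i j x * y 0 i * y 0 j.

Definition t_lower (R : realType) (n : nat) (g : 'rV[R]_n -> 'M[R]_n)
  (w : 'rV[R]_n -> 'rV[R]_n) (i j : 'I_n) (x : 'rV[R]_n) : R :=
  \sum_m s_lower g w i m x * (\sum_l ginv g x m l * s_lower g w l j x).

Definition t00 (R : realType) (n : nat) (g : 'rV[R]_n -> 'M[R]_n)
  (w : 'rV[R]_n -> 'rV[R]_n) (x y : 'rV[R]_n) : R :=
  \sum_i \sum_j t_lower g w i j x * y 0 i * y 0 j.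

Definition t0 (R : realType) (n : nat) (g : 'rV[R]_n -> 'M[R]_n)
  (w : 'rV[R]_n -> 'rV[R]_n) (x y : 'rV[R]_n) : R :=
  \sum_i \sum_j up g w x i * t_lower g w i j x * y 0 j.

Definition tbb (R : realType) (n : nat) (g : 'rV[R]_n -> 'M[R]_n)
  (w : 'rV[R]_n -> 'rV[R]_n) (x : 'rV[R]_n) : R :=
  \sum_i \sum_j t_lower g w i j x * up g w x i * up g w x j.

Definition ttr (R : realType) (n : nat) (g : 'rV[R]_n -> 'M[R]_n)
  (w : 'rV[R]_n -> 'rV[R]_n) (x : 'rV[R]_n) : R :=
  \sum_i \sum_j ginv g x i j * t_lower g w i j x.

Definition Delta (R : realType) (kappa : R -> R) (u : R) : R :=
  1 - u * kappa u.

(** The components of the quadratic form bar(alpha)^2; see [alpha_deform]. *)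
Definition deform (R : realType) (n : nat) (M : smooth_manifold R n)
    (rho kappa : R -> R) (a : form2 M) (b : form1 M) : form2 M :=
  fun c x =>
    let u := normb2 (a c) (b c) x in
    \matrix_(i, j) (expR (rho u) ^+ 2 *
                    (a c x i j - kappa u * b c x 0 i * b c x 0 j)).

Lemma alpha_deform (R : realType) (n : nat) (M : smooth_manifold R n)
    (rho kappa : R -> R) (a : form2 M) (b : form1 M) (c : chart M)
    (x y : 'rV[R]_n) :
  is_riemannian a -> chart_image c x ->
  alpha (deform rho kappa a b c) x y =
  let u := normb2 (a c) (b c) x in
  expR (rho u) *
    Num.sqrt (alpha (a c) x y ^+ 2 - kappa u * beta (b c) x y ^+ 2).
Proof.
move=> [_ _ _ pos] px /=; set u := normb2 _ _ _.
have q0 : 0 <= quad (a c x) y.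
  have [->|y0] := eqVneq y 0; last exact/ltW/pos.
  rewrite /quad big1 // => i _; rewrite big1 // => j _.
  by rewrite !mxE !mulr0.
rewrite /alpha sqr_sqrtr //.
have -> : quad (deform rho kappa a b c x) y =
    expR (rho u) ^+ 2 * (quad (a c x) y - kappa u * beta (b c) x y ^+ 2).
  rewrite /quad /beta; set e := expR _ ^+ 2; set k := kappa u.
  rewrite expr2 mulr_suml mulr_sumr -sumrB mulr_sumr; apply: eq_bigr => i _.
  rewrite !mulr_sumr -sumrB mulr_sumr; apply: eq_bigr => j _.
  by rewrite mxE -/u -/e -/k; ring.
by rewrite sqrtrM ?sqr_ge0 // sqrtr_sqr ger0_norm // expR_ge0.
Qed.

(** In E1, ..., E6, [u] stands for b^2, [tr] for t^i_i and [t] for t_lower{ij}b^ib^j; derivatives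
    of [rho], [kappa] and [Delta kappa] are with respect to b^2. *)

Definition E1 (R : realType) (n : nat) (mu mubar : R) (rho kappa : R -> R)
    (u tr t : R) : R :=
  let D := Delta kappa u in let D' := derive1 (Delta kappa) u in
  let r' := derive1 rho u in let r'' := derive1n 2 rho u in
  2 * r' * tr
  + 2 * (D' / D * r' + 2 * (n%:R - 2) * r' ^+ 2 + 2 * r'') * t
  + (n%:R - 1) * mu * (1 + 2 * u * r')
  - (n%:R - 1) * mubar * expR (2 * rho u).

Definition E2 (R : realType) (n : nat) (mu mubar : R) (rho kappa : R -> R)
    (u tr t : R) : R :=
  let D := Delta kappa u in let D' := derive1 (Delta kappa) u in
  let D'' := derive1n 2 (Delta kappa) u in
  let r' := derive1 rho u in let r'' := derive1n 2 rho u in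
  - (1 / u ^+ 2)
    * (D ^+ 2 - 1 - u * D' - (D - 1) * (1 + 2 * u * r')) * tr
  + 1 / (u ^+ 3 * D)
    * (2 * D * (D ^+ 2 - 1) - u * (5 * D - 1) * D' - u ^+ 2 * D' ^+ 2
       + 2 * u ^+ 2 * D * D'' - 2 * (n%:R - 2) * u * D * (D - 1) * r'
       + 2 * u ^+ 2 * ((n%:R - 1) * D - 1) * D' * r'
       + 4 * (n%:R - 2) * u ^+ 2 * D * (D - 1) * r' ^+ 2
       + 4 * u ^+ 2 * D * (D - 1) * r'') * t
  + (n%:R - 1) / u * mu * (u * D' + (D - 1) * (1 + 2 * u * r'))
  - (n%:R - 1) / u * mubar * (D - 1) * expR (2 * rho u).

Definition E3 (R : realType) (n : nat) (rho kappa : R -> R) (u : R) : R :=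
  let D := Delta kappa u in let D' := derive1 (Delta kappa) u in
  let D'' := derive1n 2 (Delta kappa) u in
  let r' := derive1 rho u in let r'' := derive1n 2 rho u in
  2 / u ^+ 2 * (D - 1) - 2 * D' / (u * D) + D' ^+ 2 / D ^+ 2 - 2 / D * D''
  + 4 * (n%:R - 2) * (r' ^+ 2 - r'').

Definition E4 (R : realType) (kappa : R -> R) (u : R) : R :=
  2 / u * (Delta kappa u - 1).

Definition E5 (R : realType) (n : nat) (rho kappa : R -> R) (u : R) : R :=
  let D := Delta kappa u in let D' := derive1 (Delta kappa) u in
  let r' := derive1 rho u in
  - (4 / u ^+ 2) * (D - 1) + 2 / (u * D) * (3 * D - 1) * D'
  + 4 / u * (n%:R - 2) * (D - 1) * r'.

Definition E6 (R : realType) (n : nat) (rho kappa : R -> R) (u : R) : R :=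
  - (derive1 (Delta kappa) u / Delta kappa u) - 2 * (n%:R - 2) * derive1 rho u.

(* Main.v *)
(* Since beta is Killing, the gradient of b^2 is 2 s_i, and the Levi-Civita connections of
   bar(alpha) and alpha differ by a tensor P that is an explicit combination of a_ij, b_i,
   s_i and s_ij with coefficients depending on b^2. Contracted twice with y, the Ricci tensor
   changes by div(P(y, y)) - y(tr P(y)) + tr P(P(y, y)) - tr(P(y) P(y)), where y is extended
   parallel at the given point. The divergences reduce to that of s^i_j, which by the
   commutation of covariant derivatives is the Ricci tensor applied to beta and is therefore
   known when alpha is Einstein. Collecting terms, wherever beta <> 0,
   bar(Ric)(y, y) - (n-1) bar(mu) bar(alpha)^2 is exactly the expression in E_1, ..., E_6.

   The points with beta = 0 follow by continuity once these are known to have empty interior.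
   Along a segment, a Killing form and its first partial derivatives solve a linear first-order
   system, so by Gronwall the form vanishes near any point where it vanishes to first order;
   hence the interior of its zero set is closed, and empty by connectedness. *)

Require Import Defs.
From HB Require Import structures.
From mathcomp Require Import all_boot all_order all_algebra.
From mathcomp Require Import all_classical all_reals all_analysis.
From mathcomp Require Import ring lra.
Import Order.TTheory GRing.Theory Num.Theory.
Import numFieldNormedType.Exports.

Local Open Scope ring_scope.
Local Open Scope classical_set_scope.

Set Implicit Arguments.
Unset Strict Implicit.
Unset Printing Implicit Defensive.

(** * Smooth functions *)

(** Neither the Christoffel symbols nor the inverse matrix of the deformed metric are ever written
    out. The difference tensor is an ansatz, [shift_mx], with four unknown functions of b^2: it is
    symmetric for any choice of them, compatibility with the deformed metric fixes them, and
    uniqueness of the Levi-Civita connection does the rest. The coefficients remain arbitrary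
    functions while the Ricci tensor is expanded; [rho] and [kappa] enter the expansion only in the
    final scalar identity. Forms are rows and vectors are columns, so that contractions are matrix
    products. The Einstein condition prescribes only a quadratic form, whereas the divergence of
    s^i_j contracts the Ricci tensor with two different vectors. Hence symmetry of the Ricci tensor
    has to be proved as well. The E_i contain powers of 1/b^2, and since division by zero yields 0
    their values at zeros of beta carry no information. What is continued to these zeros is the
    Einstein defect of the deformed metric, which is smooth there. *)

Lemma near0_differentiable (R : realType) (V W : normedModType R) (f : V -> W)
    (x : V) :
  (\forall z \near x, f z = 0) -> differentiable f x.
Proof.
move=> f0; have e : f \o shift x = cst (f x) + \0 +o_ 0 id.
  apply/eqaddoP => _/posnumP[eps]; rewrite (nbhs_singleton f0).
  have fx0 : \forall z \near 0, f (z + x) = 0.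
    by move: f0; rewrite (near_shift 0 x); apply: filter_app; near=> z; rewrite /= subr0.
  move: fx0; apply: filter_app; near=> z => /= fz.
  rewrite (_ : (_ - _) z = f (z + x) - (0 + 0)) //.
  by rewrite fz addr0 subrr normr0 mulr_ge0.
have c0 : continuous (\0 : {linear V -> W}) by move=> z; exact: cst_continuous.
by apply/diff_locallyP; rewrite (diff_unique c0 e).
Unshelve. all: by end_near. Qed.

Section Calculus.
Context {R : realType} {n : nat}.
Local Notation V := 'rV[R]_n.
Implicit Types (f g : V -> R) (U : set V) (x : V).

Lemma nbhs_eq_on U f g x : open U -> {in U, f =1 g} -> U x ->
  \forall z \near x, f z = g z.
Proof.
move=> oU fg Ux; have := open_nbhs_nbhs (conj oU Ux).
by apply: filter_app; near=> z => Uz; apply: fg; rewrite inE.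
Unshelve. all: by end_near. Qed.

Lemma partial_near i f g x : (\forall z \near x, f z = g z) ->
  partial i f x = partial i g x.
Proof.
(* [near_eq_derive] asks for a nonzero direction; in the zero direction both derivatives are 0. *)
move=> fg; rewrite /partial; have [->|v0] := eqVneq (delta_mx 0 i : V) 0.
  by rewrite !derive0.
exact: near_eq_derive.
Qed.

Lemma partial_ext i f g x : f =1 g -> partial i f x = partial i g x.
Proof. by move=> /funext ->. Qed.

Lemma partial_eq_on i U f g x : open U -> {in U, f =1 g} -> U x ->
  partial i f x = partial i g x.
Proof. by move=> oU fg Ux; exact/partial_near/(nbhs_eq_on oU). Qed.

Lemma near_differentiable f g x : (\forall z \near x, f z = g z) ->
  differentiable f x -> differentiable g x.
Proof.
move=> fg df; rewrite (_ : g = f + (g - f)); last by rewrite addrC subrK.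
apply: differentiableD => //; apply: near0_differentiable.
by move: fg; apply: filter_app; near=> z => fz; rewrite !fctE fz subrr.
Unshelve. all: by end_near. Qed.

(** [Ck] speaks of functions on the whole space; it is openness of [U] that makes it depend on the
    values on [U] alone. The closure lemmas below know their derivative formulas only on [U] and
    transfer them through this lemma. *)
Lemma Ck_eq U : open U -> forall k f g, {in U, f =1 g} ->
  Ck k U f -> Ck k U g.
Proof.
move=> oU; elim=> [|k IH] f g fg /=.
  move=> fc x Ux; have fgx := nbhs_eq_on oU fg Ux.
  have := fc x Ux; rewrite /prop_for /continuous_at -(nbhs_singleton fgx) => h.
  move=> A /h fA; change (\forall z \near x, A (g z)).
  have fA' : \forall z \near x, A (f z) by exact: fA.
  by move: fA' fgx; apply: filter_app2; near=> z => + <-.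
move=> [df pf]; split=> [x Ux|i].
  exact: near_differentiable (nbhs_eq_on oU fg Ux) (df x Ux).
apply: (IH (partial i f)) => // x; rewrite inE => Ux.
exact: partial_eq_on Ux.
Unshelve. all: by end_near. Qed.

Lemma CkW U k f : Ck k.+1 U f -> Ck k U f.
Proof.
elim: k f => [|k IH] f [df pf].
  by move=> x Ux; exact/differentiable_continuous/df.
by split=> // i; exact/IH/pf.
Qed.

Lemma partial_cst i (a : R) x : partial i (fun=> a) x = 0.
Proof. exact: derive_cst. Qed.

Lemma Ck_cst U (a : R) k : Ck k U (fun=> a).
Proof.
elim: k a => [|k IH] a /=; first by move=> x _; exact: cst_continuous.
split=> [x _|i]; first exact: differentiable_cst.
rewrite (_ : partial i _ = fun=> 0) //; apply/funext => x; exact: partial_cst.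
Qed.

Lemma partialD i f g x : differentiable f x -> differentiable g x ->
  partial i (fun z => f z + g z) x = partial i f x + partial i g x.
Proof. by move=> df dg; apply: deriveD; exact: diff_derivable. Qed.

Lemma partialM i f g x : differentiable f x -> differentiable g x ->
  partial i (fun z => f z * g z) x = partial i f x * g x + f x * partial i g x.
Proof.
move=> df dg; rewrite /partial.
have -> : (fun z => f z * g z) = f * g by [].
rewrite deriveM; [|exact: diff_derivable..].
by rewrite [LHS]addrC; congr (_ + _); exact: mulrC.
Qed.

Lemma partialV i f x : differentiable f x -> f x != 0 ->
  partial i (fun z => (f z)^-1) x = - (f x)^-1 * (f x)^-1 * partial i f x.
Proof.
move=> df f0; rewrite /partial (deriveV f0); last exact: diff_derivable.
by rewrite expr2 invfM mulNr.
Qed.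

Lemma CkD U k f g : open U -> Ck k U f -> Ck k U g ->
  Ck k U (fun z => f z + g z).
Proof.
move=> oU; elim: k f g => [|k IH] f g /=.
  by move=> cf cg x Ux; exact: (continuousD (cf x Ux) (cg x Ux)).
move=> [df pf] [dg pg]; split=> [x Ux|i].
  by apply: differentiableD; [exact: df|exact: dg].
apply: (Ck_eq oU _ (IH _ _ (pf i) (pg i))) => x; rewrite inE => Ux.
by rewrite partialD//; [exact: df|exact: dg].
Qed.

(** In the product rule each derivative meets an underived factor, whose order is one too high for
    the induction hypothesis; [CkW] lowers it. *)
Lemma CkM U k f g : open U -> Ck k U f -> Ck k U g ->
  Ck k U (fun z => f z * g z).
Proof.
move=> oU; elim: k f g => [|k IH] f g.
  by move=> cf cg x Ux; exact: (continuousM (cf x Ux) (cg x Ux)).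
move=> Cf Cg; have [df pf] := Cf; have [dg pg] := Cg; split=> [x Ux|i].
  by apply: differentiableM; [exact: df|exact: dg].
have := CkD oU (IH _ _ (pf i) (CkW Cg)) (IH _ _ (CkW Cf) (pg i)).
apply: Ck_eq => // x; rewrite inE => Ux.
by rewrite partialM//; [exact: df|exact: dg].
Qed.

Lemma CkV U k f : open U -> (forall x, U x -> f x != 0) -> Ck k U f ->
  Ck k U (fun z => (f z)^-1).
Proof.
move=> oU f0; elim: k => [|k IH].
  by move=> cf x Ux; exact: (continuousV (f0 x Ux) (cf x Ux)).
move=> Cf; have [df pf] := Cf; split=> [x Ux|i].
  by apply: differentiableV; [exact: df|exact: f0].
have CV := IH (CkW Cf).
have := CkM oU (CkM oU (CkM oU (Ck_cst U (-1) k) CV) CV) (pf i).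
apply: Ck_eq => // x; rewrite inE => Ux.
by rewrite partialV ?mulN1r//; [exact: df|exact: f0].
Qed.

Lemma smooth_eq U f g : open U -> {in U, f =1 g} -> smooth_on U f -> smooth_on U g.
Proof. by move=> oU fg sf k; exact: Ck_eq (sf k). Qed.

Lemma smooth_diff U f x : smooth_on U f -> U x -> differentiable f x.
Proof. by move=> sf Ux; have [df _] := sf 1%N; exact: df. Qed.

Lemma smooth_partial U f i : smooth_on U f -> smooth_on U (partial i f).
Proof. by move=> sf k; have [_] := sf k.+1; exact. Qed.

Lemma smooth_cst U (a : R) : smooth_on U (fun=> a).
Proof. by move=> k; exact: Ck_cst. Qed.

Lemma smoothD U f g : open U -> smooth_on U f -> smooth_on U g ->
  smooth_on U (fun z => f z + g z).
Proof. by move=> oU sf sg k; exact: CkD. Qed.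

Lemma smoothM U f g : open U -> smooth_on U f -> smooth_on U g ->
  smooth_on U (fun z => f z * g z).
Proof. by move=> oU sf sg k; exact: CkM. Qed.

Lemma smoothN U f : open U -> smooth_on U f -> smooth_on U (fun z => - f z).
Proof.
move=> oU sf; have := smoothM oU (smooth_cst U (-1)) sf.
by apply: smooth_eq => // x _; rewrite mulN1r.
Qed.

Lemma smoothB U f g : open U -> smooth_on U f -> smooth_on U g ->
  smooth_on U (fun z => f z - g z).
Proof. by move=> oU sf sg; apply: smoothD => //; exact: smoothN. Qed.

Lemma smoothV U f : open U -> (forall x, U x -> f x != 0) -> smooth_on U f ->
  smooth_on U (fun z => (f z)^-1).
Proof. by move=> oU f0 sf k; exact: CkV. Qed.

Lemma smoothX U f m : open U -> smooth_on U f -> smooth_on U (fun z => f z ^+ m).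
Proof.
move=> oU sf; elim: m => [|m IH]; first exact: smooth_cst.
by apply: smooth_eq (smoothM oU sf IH) => // x _; rewrite exprS.
Qed.

Lemma smooth_sum U (J : Type) (r : seq J) (P : pred J) (F : J -> V -> R) :
  open U -> (forall j, smooth_on U (F j)) ->
  smooth_on U (fun z => \sum_(j <- r | P j) F j z).
Proof.
move=> oU sF; elim: r => [|j r IH].
  by apply: smooth_eq (smooth_cst U 0) => // x _; rewrite big_nil.
case: (boolP (P j)) => Pj; last first.
  by apply: smooth_eq IH => // x _; rewrite big_cons (negbTE Pj).
by apply: smooth_eq (smoothD oU (sF j) IH) => // x _; rewrite big_cons Pj.
Qed.

Lemma smooth_prod U (J : Type) (r : seq J) (P : pred J) (F : J -> V -> R) :
  open U -> (forall j, smooth_on U (F j)) ->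
  smooth_on U (fun z => \prod_(j <- r | P j) F j z).
Proof.
move=> oU sF; elim: r => [|j r IH].
  by apply: smooth_eq (smooth_cst U 1) => // x _; rewrite big_nil.
case: (boolP (P j)) => Pj; last first.
  by apply: smooth_eq IH => // x _; rewrite big_cons (negbTE Pj).
by apply: smooth_eq (smoothM oU (sF j) IH) => // x _; rewrite big_cons Pj.
Qed.

Lemma partial_sum i (J : Type) (r : seq J) (P : pred J) (F : J -> V -> R) x :
  (forall j, differentiable (F j) x) ->
  partial i (fun z => \sum_(j <- r | P j) F j z) x =
  \sum_(j <- r | P j) partial i (F j) x.
Proof.
move=> dF.
suff [] : partial i (fun z => \sum_(j <- r | P j) F j z) x =
  \sum_(j <- r | P j) partial i (F j) x /\
  differentiable (fun z => \sum_(j <- r | P j) F j z) x by [].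
elim: r => [|j r [IH1 IH2]].
  rewrite big_nil -[RHS](partial_cst i 0 x).
  rewrite (_ : (fun z => _) = fun=> 0); last first.
    by apply/funext => z; rewrite big_nil.
  by split=> //; exact: differentiable_cst.
case: (boolP (P j)) => Pj; last first.
  rewrite big_cons (negbTE Pj).
  rewrite (_ : (fun z => _) = fun z => \sum_(j <- r | P j) F j z) //.
  by apply/funext => z; rewrite big_cons (negbTE Pj).
rewrite big_cons Pj.
rewrite (_ : (fun z => _) = fun z => F j z + \sum_(j <- r | P j) F j z); last first.
  by apply/funext => z; rewrite big_cons Pj.
by rewrite partialD// IH1; split=> //; exact: differentiableD.
Qed.

Lemma partialN i f x : differentiable f x ->
  partial i (fun z => - f z) x = - partial i f x.
Proof. by move=> df; apply: deriveN; exact: diff_derivable. Qed.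

Lemma partialB i f g x : differentiable f x -> differentiable g x ->
  partial i (fun z => f z - g z) x = partial i f x - partial i g x.
Proof. by move=> df dg; apply: deriveB; exact: diff_derivable. Qed.

Lemma coord_differentiable (j : 'I_n) x :
  differentiable (fun z : V => z 0 j) x.
Proof. exact: differentiable_coord. Qed.

Lemma partial_coord i (j : 'I_n) x :
  partial i (fun z : V => z 0 j) x = (j == i)%:R.
Proof.
have di : derivable (id : V -> V) x (delta_mx 0 i) by exact: derivable_id.
have := derive_mx di.
move=> /matrixP/(_ 0 j); rewrite derive_id !mxE eqxx /= => ->.
by [].
Qed.

Lemma smooth_coord U (j : 'I_n) : smooth_on U (fun z : V => z 0 j).
Proof.
case=> [|k] /=; first by move=> x _; exact: coord_continuous.
split=> [x _|i]; first exact: coord_differentiable.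
rewrite (_ : partial i _ = fun=> (j == i)%:R); first exact: Ck_cst.
by apply/funext => x; exact: partial_coord.
Qed.

Lemma partial_comp i (phi : R -> R) f x : derivable phi (f x) 1 ->
  differentiable f x ->
  partial i (fun z => phi (f z)) x = derive1 phi (f x) * partial i f x.
Proof.
move=> dphi df; rewrite /partial !deriveE //; last first.
  by apply: differentiable_comp => //; exact/derivable1_diffP.
have dphi' : differentiable phi (f x) by exact/derivable1_diffP.
have -> : (fun z => phi (f z)) = phi \o f by [].
by rewrite (diff_comp df dphi') /= (deriv1E dphi); exact: mulrC.
Qed.

(** The induction on the order runs over all [phi] at once: a partial derivative of the composite is
    phi'(f) times one of [f], and phi' is again smooth on [D]. *)
Lemma smooth_comp U (D : set R) (phi : R -> R) f : open U -> open D ->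
  smooth1_on D phi -> (forall x, U x -> D (f x)) -> smooth_on U f ->
  smooth_on U (fun z => phi (f z)).
Proof.
move=> oU oD + fD sf k; elim: k phi => [|k IH] phi sphi.
  move=> x Ux; apply: continuous_comp; first exact/differentiable_continuous/(smooth_diff sf).
  apply: differentiable_continuous; apply/derivable1_diffP.
  by apply: (sphi 0%N); exact: fD.
have dphi x : U x -> derivable phi (f x) 1.
  by move=> Ux; apply: (sphi 0%N); exact: fD.
split=> [x Ux|i].
  apply: differentiable_comp; first exact: smooth_diff Ux.
  exact/derivable1_diffP/dphi.
have sphi' : smooth1_on D (derive1 phi).
  by move=> l u Du; rewrite -derive1Sn; exact: sphi.
have [_ pf] := sf k.+1.
apply: (Ck_eq oU _ (CkM oU (IH _ sphi') (pf i))) => x; rewrite inE => Ux.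
by rewrite partial_comp//; [exact: dphi|exact: smooth_diff Ux].
Qed.

End Calculus.

(** * Symmetry of second partial derivatives *)

Section Schwarz.
Context {R : realType} {n : nat}.
Local Notation V := 'rV[R]_n.
Implicit Types (f g : V -> R) (U : set V) (x : V).

Lemma is_derive_line f (p v : V) (s : R) : derivable f (p + s *: v) v ->
  is_derive s (1 : R) (fun r : R => f (p + r *: v)) ('D_v f (p + s *: v)).
Proof.
have E : (fun h : R => h^-1 *: (((fun r : R => f (p + r *: v)) \o shift s) (h *: 1)
      - f (p + s *: v))) =
    (fun h : R => h^-1 *: ((f \o shift (p + s *: v)) (h *: v) - f (p + s *: v))).
  apply/funext => h /=; congr (_ *: (f _ - _)).
  by rewrite [h *: 1]mulr1 scalerDl addrCA.
move=> d; have d1 : derivable (fun r : R => f (p + r *: v)) s 1.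
  by rewrite /derivable E; exact: d.
by apply: DeriveDef => //; rewrite /derive E.
Qed.

Lemma line_mean f (p v : V) (h : R) : 0 < h ->
  (forall s, 0 <= s <= h -> differentiable f (p + s *: v)) ->
  exists2 s, 0 < s < h & f (p + h *: v) - f p = 'D_v f (p + s *: v) * h.
Proof.
move=> h0 df; pose g s := f (p + s *: v).
have dg s : 0 <= s <= h -> is_derive s (1 : R) g ('D_v f (p + s *: v)).
  by move=> sh; apply: is_derive_line; apply: diff_derivable; exact: df.
have [|||s] := @MVT R g (fun s => 'D_v f (p + s *: v)) 0 h.
- exact: h0.
- move=> s; rewrite in_itv /= => /andP[s0 sh]; apply: dg.
  by rewrite !ltW.
- apply: derivable_within_continuous => s; rewrite in_itv /= => sh.
  by have [] := dg s sh.
rewrite in_itv /= => sh; rewrite /g scale0r addr0 subr0 => e.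
by exists s.
Qed.

(** The second difference over a square of side [h] is the increment along e_i of [phi], the first
    difference along e_j. Two applications of the mean value theorem turn it into a mixed partial
    derivative at some point of the square; the order of the two partials reflects the order of the
    two applications. *)
Lemma square_mean f (x : V) (i j : 'I_n) (h : R) U : 0 < h ->
  smooth_on U f ->
  (forall s t, 0 <= s <= h -> 0 <= t <= h ->
     U (x + t *: delta_mx 0 j + s *: delta_mx 0 i)) ->
  exists s t, [/\ 0 <= s <= h, 0 <= t <= h &
    f (x + h *: delta_mx 0 j + h *: delta_mx 0 i)
    - f (x + h *: delta_mx 0 j) - (f (x + h *: delta_mx 0 i) - f x) =
    partial j (partial i f) (x + t *: delta_mx 0 j + s *: delta_mx 0 i) * h * h].
Proof.
move=> h0 sf UU; pose ei : V := delta_mx 0 i; pose ej : V := delta_mx 0 j.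
pose phi z := f (z + h *: ej) - f z.
have hh : 0 <= h <= h by rewrite lexx (ltW h0).
have h00 : 0 <= (0 : R) <= h by rewrite lexx (ltW h0).
have dsh (a z : V) : U (z + a) -> differentiable (fun z => f (z + a)) z.
  move=> Uz; apply: (@differentiable_comp _ _ _ _ (fun z => z + a) f).
    by apply: differentiableD => //; exact: differentiable_cst.
  exact: (smooth_diff sf).
have psh (a z : V) k : partial k (fun z => f (z + a)) z = partial k f (z + a).
  have E : (fun h : R => h^-1 *: (((fun z => f (z + a)) \o shift z)
       (h *: delta_mx 0 k) - f (z + a))) =
     (fun h : R => h^-1 *: ((f \o shift (z + a)) (h *: delta_mx 0 k) - f (z + a))).
    by apply/funext => r /=; rewrite addrA.
  by rewrite /partial /derive E.
have [s sh es] : exists2 s, 0 < s < h &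
    phi (x + h *: ei) - phi x = partial i phi (x + s *: ei) * h.
  apply: line_mean => // s sh; apply: differentiableB.
    by apply: dsh; rewrite addrAC; exact: UU.
  by apply: (smooth_diff sf); have := UU s 0 sh h00; rewrite scale0r addr0.
have sh' : 0 <= s <= h by case/andP: sh => s0 sh; rewrite !ltW.
have [t th et] : exists2 t, 0 < t < h &
    partial i f (x + s *: ei + h *: ej) - partial i f (x + s *: ei) =
    partial j (partial i f) (x + s *: ei + t *: ej) * h.
  apply: line_mean => // t th; apply: (smooth_diff (smooth_partial i sf)).
  by rewrite addrAC; exact: UU.
have th' : 0 <= t <= h by case/andP: th => t0 th; rewrite !ltW.
exists s, t; split => //.
rewrite [x + t *: _ + _]addrAC -et.
transitivity (phi (x + h *: ei) - phi x).
  by rewrite /phi (addrAC x (h *: ei)) -/ei -/ej; ring.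
have Us : U (x + s *: ei + h *: ej) by rewrite addrAC; exact: UU.
rewrite es /phi partialB ?psh ?et //; first exact: dsh.
by apply: (smooth_diff sf); have := UU s 0 sh' h00; rewrite scale0r addr0.
Qed.

(** If the two mixed partials differ at [x], then on a small ball each stays within half the gap of
    its value at [x], so no value of one equals a value of the other. But the second difference over
    a small square, computed in both orders, equals both of them up to the same factor h^2, each at
    some point of the square. *)
Lemma partialC U f x (i j : 'I_n) : open U -> smooth_on U f -> U x ->
  partial i (partial j f) x = partial j (partial i f) x.
Proof.
move=> oU sf Ux.
have [//|ne] := eqVneq (partial i (partial j f) x) (partial j (partial i f) x).
exfalso.
have far (p q p' q' : R) : `|p - p'| < `|p - q| / 2 ->
    `|q - q'| < `|p - q| / 2 -> q' = p' -> False.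
  move=> h1 h2 e; subst q'; rewrite (distrC q p') in h2.
  have := ler_distD p' p q; apply/negP; rewrite -ltNge.
  by apply: lt_le_trans (ltrD h1 h2) _; rewrite -splitr.
pose e := `|partial i (partial j f) x - partial j (partial i f) x| / 2.
have e0 : 0 < e by rewrite divr_gt0// normr_gt0 subr_eq0.
have c k l : {for x, continuous (partial k (partial l f))}.
  apply: differentiable_continuous.
  exact: (smooth_diff (smooth_partial k (smooth_partial l sf)) Ux).
have near_e k l : \forall z \near x,
    `|partial k (partial l f) x - partial k (partial l f) z| < e.
  by have /cvgr_dist_lt := c k l; apply.
have : \forall z \near x, [/\ U z,
   `|partial i (partial j f) x - partial i (partial j f) z| < e &
   `|partial j (partial i f) x - partial j (partial i f) z| < e].
  have Ux' := open_nbhs_nbhs (conj oU Ux).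
  by move: Ux' (near_e i j) (near_e j i); apply: filter_app3; near=> z.
move=> /nbhs_ballP[r /= r0 rb].
pose ei : V := delta_mx 0 i; pose ej : V := delta_mx 0 j.
(* The choice of [h] gives [h * N = r / 2], which puts the whole square inside the ball; the summand
   1 makes [N] positive without evaluating the norms. *)
pose N := `|ei| + `|ej| + 1.
have N0 : 0 < N by rewrite ltr_wpDl // addr_ge0.
pose h := r / N / 2.
have h0 : 0 < h by rewrite !divr_gt0.
have inb a b s t : (a = i /\ b = j) \/ (a = j /\ b = i) ->
    0 <= s <= h -> 0 <= t <= h ->
    ball x r (x + t *: (delta_mx 0 b : V) + s *: (delta_mx 0 a : V)).
  move=> ab /andP[s0 sh] /andP[t0 th].
  rewrite -ball_normE /= opprD opprD !addrA subrr sub0r -opprD normrN.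
  apply: le_lt_trans (ler_normD _ _) _; rewrite !normrZ !ger0_norm//.
  apply: (@le_lt_trans _ _ (h * N)).
    have le1 d s' : 0 <= s' <= h -> s' * `|delta_mx 0 d : V| <= h * `|delta_mx 0 d : V|.
      by move=> /andP[_ sh']; apply: ler_wpM2r.
    apply: (@le_trans _ _ (h * (`|delta_mx 0 b : V| + `|delta_mx 0 a : V|))).
      by rewrite mulrDr lerD// le1 // ?s0 ?t0.
    rewrite ler_pM2l// /N /ei /ej; case: ab => -[-> ->].
      by rewrite [X in X <= _]addrC lerDl.
    by rewrite lerDl.
  have -> : h * N = r / 2 by rewrite /h; field; rewrite gt_eqF.
  by rewrite ltr_pdivrMr// ltr_pMr// ltr1n.
have UU a b : (a = i /\ b = j) \/ (a = j /\ b = i) -> forall s t,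
    0 <= s <= h -> 0 <= t <= h -> U (x + t *: delta_mx 0 b + s *: delta_mx 0 a).
  by move=> ab s t sh th; have [] := rb _ (inb a b s t ab sh th).
have [s [t [sh th E1]]] := square_mean h0 sf (UU i j (or_introl (conj erefl erefl))).
have [s' [t' [sh' th' E2]]] :=
  square_mean h0 sf (UU j i (or_intror (conj erefl erefl))).
have [_ _ A1] := rb _ (inb i j _ _ (or_introl (conj erefl erefl)) sh th).
have [_ A2 _] := rb _ (inb j i _ _ (or_intror (conj erefl erefl)) sh' th').
have E : partial j (partial i f) (x + t *: delta_mx 0 j + s *: delta_mx 0 i) =
   partial i (partial j f) (x + t' *: delta_mx 0 i + s' *: delta_mx 0 j).
  have hn : h * h != 0 by rewrite mulf_neq0 // gt_eqF.
  apply: (mulIf hn); rewrite [LHS]mulrA [RHS]mulrA.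
  apply: etrans (esym E1) _; apply: etrans _ E2.
  have exch (p q u v : R) : p - q - (u - v) = p - u - (q - v) by ring.
  by rewrite (addrAC x (h *: delta_mx 0 j)); exact: exch.
exact: (far _ _ _ _ A2 A1 E).
Unshelve. all: by end_near. Qed.

End Schwarz.

(** * Matrix-valued fields *)

(** Locked, like the other differential operators below, so that rewriting sees only the product
    rule and its companions and never the entrywise partial derivatives. *)
HB.lock Definition dmx (R : realType) (n p q : nat) (l : 'I_n)
    (A : 'rV[R]_n -> 'M[R]_(p, q)) (x : 'rV[R]_n) : 'M[R]_(p, q) :=
  \matrix_(i, j) partial l (fun z => A z i j) x.
Arguments dmx {R n p q} l A x.

HB.lock Definition grad (R : realType) (n : nat) (f : 'rV[R]_n -> R)
    (x : 'rV[R]_n) : 'rV[R]_n := \row_k partial k f x.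
Arguments grad {R n} f x.

Section MatrixFields.
Context {R : realType} {n : nat}.
Local Notation V := 'rV[R]_n.
Variable U : set V.
Hypothesis oU : open U.

Definition smooth_mx p q (A : V -> 'M[R]_(p, q)) : Prop :=
  forall i j, smooth_on U (fun x => A x i j).

Lemma dmxE p q l (A : V -> 'M[R]_(p, q)) x i j :
  dmx l A x i j = partial l (fun z => A z i j) x.
Proof. by rewrite dmx.unlock mxE. Qed.

Lemma gradE (f : V -> R) x k : grad f x 0 k = partial k f x.
Proof. by rewrite grad.unlock mxE. Qed.

Lemma grad_entry p q (A : V -> 'M[R]_(p, q)) i j x k :
  grad (fun z => A z i j) x 0 k = dmx k A x i j.
Proof. by rewrite gradE dmxE. Qed.

Lemma smooth_mx_eq p q (A B : V -> 'M[R]_(p, q)) :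
  {in U, A =1 B} -> smooth_mx A -> smooth_mx B.
Proof. by move=> AB sA i j; apply: smooth_eq (sA i j) => // x /AB ->. Qed.

Lemma smooth_mxM p q r (A : V -> 'M[R]_(p, q)) (B : V -> 'M[R]_(q, r)) :
  smooth_mx A -> smooth_mx B -> smooth_mx (fun x => A x *m B x).
Proof.
move=> sA sB i j; have := smooth_sum (index_enum 'I_q) xpredT oU
  (fun k => smoothM oU (sA i k) (sB k j)).
by apply: smooth_eq => // x _; rewrite mxE.
Qed.

Lemma smooth_mxD p q (A B : V -> 'M[R]_(p, q)) :
  smooth_mx A -> smooth_mx B -> smooth_mx (fun x => A x + B x).
Proof.
move=> sA sB i j; have := smoothD oU (sA i j) (sB i j).
by apply: smooth_eq => // x _; rewrite mxE.
Qed.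

Lemma smooth_mxN p q (A : V -> 'M[R]_(p, q)) :
  smooth_mx A -> smooth_mx (fun x => - A x).
Proof.
move=> sA i j; have := smoothN oU (sA i j).
by apply: smooth_eq => // x _; rewrite mxE.
Qed.

Lemma smooth_mxB p q (A B : V -> 'M[R]_(p, q)) :
  smooth_mx A -> smooth_mx B -> smooth_mx (fun x => A x - B x).
Proof. by move=> sA sB; apply: smooth_mxD => //; exact: smooth_mxN. Qed.

Lemma smooth_mxZ p q (f : V -> R) (A : V -> 'M[R]_(p, q)) :
  smooth_on U f -> smooth_mx A -> smooth_mx (fun x => f x *: A x).
Proof.
move=> sf sA i j; have := smoothM oU sf (sA i j).
by apply: smooth_eq => // x _; rewrite mxE.
Qed.

Lemma smooth_mx_cst p q (A : 'M[R]_(p, q)) : smooth_mx (fun=> A).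
Proof. by move=> i j; exact: smooth_cst. Qed.

Lemma smooth_mx_tr p q (A : V -> 'M[R]_(p, q)) :
  smooth_mx A -> smooth_mx (fun x => (A x)^T).
Proof.
by move=> sA i j; apply: smooth_eq (sA j i) => // x _; rewrite mxE.
Qed.

Lemma smooth_mx_sum p q (F : 'I_n -> V -> 'M[R]_(p, q)) :
  (forall k, smooth_mx (F k)) -> smooth_mx (fun x => \sum_k F k x).
Proof.
move=> sF i j; have := smooth_sum (index_enum 'I_n) xpredT oU (fun k => sF k i j).
by apply: smooth_eq => // x _; rewrite summxE.
Qed.

Lemma smooth_col p q (A : V -> 'M[R]_(p, q)) k :
  smooth_mx A -> smooth_mx (fun x => col k (A x)).
Proof.
by move=> sA i j; apply: smooth_eq (sA i k) => // x _; rewrite mxE.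
Qed.

Lemma smooth_dmx p q l (A : V -> 'M[R]_(p, q)) :
  smooth_mx A -> smooth_mx (dmx l A).
Proof.
move=> sA i j; apply: smooth_eq (smooth_partial l (sA i j)) => // x _.
by rewrite dmxE.
Qed.

Lemma smooth_det m (A : V -> 'M[R]_m) :
  (forall i j, smooth_on U (fun x => A x i j)) -> smooth_on U (fun x => \det (A x)).
Proof.
move=> sA; rewrite /determinant; apply: smooth_sum => // s.
by apply: smoothM => //; [exact: smooth_cst|exact: smooth_prod].
Qed.

Lemma smooth_invmx m (A : V -> 'M[R]_m) : smooth_mx A ->
  (forall x, U x -> A x \in unitmx) -> smooth_mx (fun x => invmx (A x)).
Proof.
move=> sA uA i j.
have sdet : smooth_on U (fun x => (\det (A x))^-1).
  apply: smoothV => //; last exact: smooth_det.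
  by move=> x /uA; rewrite unitmxE unitfE.
have sadj : smooth_on U (fun x => \adj (A x) i j).
  have sminor : smooth_on U (fun x => \det (row' j (col' i (A x)))).
    apply: smooth_det => k l; apply: smooth_eq (sA (lift j k) (lift i l)) => // x _.
    by rewrite !mxE.
  apply: smooth_eq (smoothM oU (smooth_cst U ((-1) ^+ (j + i))) sminor) => // x _.
  by rewrite mxE.
apply: smooth_eq (smoothM oU sdet sadj) => // x; rewrite inE => /uA uAx.
by rewrite /invmx uAx [RHS]mxE.
Qed.

Section Derivation.
Variables (l : 'I_n) (x : V).
Hypothesis Ux : U x.

Lemma dmx_eq p q (A B : V -> 'M[R]_(p, q)) : {in U, A =1 B} ->
  dmx l A x = dmx l B x.
Proof.
move=> AB; apply/matrixP => i j; rewrite !dmxE.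
by apply: (partial_eq_on _ oU) => // z /AB ->.
Qed.

Lemma dmxM p q r (A : V -> 'M[R]_(p, q)) (B : V -> 'M[R]_(q, r)) :
  smooth_mx A -> smooth_mx B ->
  dmx l (fun z => A z *m B z) x = dmx l A x *m B x + A x *m dmx l B x.
Proof.
move=> sA sB; have dA i j := smooth_diff (sA i j) Ux.
have dB i j := smooth_diff (sB i j) Ux.
apply/matrixP => i j; rewrite dmxE 3!mxE -big_split /=.
transitivity (partial l (fun z => \sum_k A z i k * B z k j) x).
  by apply: partial_ext => z; rewrite mxE.
rewrite partial_sum => [|k]; last exact: differentiableM.
by apply: eq_bigr => k _; rewrite partialM// !dmxE.
Qed.

Lemma dmxD p q (A B : V -> 'M[R]_(p, q)) : smooth_mx A -> smooth_mx B ->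
  dmx l (fun z => A z + B z) x = dmx l A x + dmx l B x.
Proof.
move=> sA sB; apply/matrixP => i j; rewrite mxE !dmxE -partialD.
- by apply: partial_ext => z; rewrite mxE.
- exact: smooth_diff (sA i j) Ux.
- exact: smooth_diff (sB i j) Ux.
Qed.

Lemma dmxN p q (A : V -> 'M[R]_(p, q)) : smooth_mx A ->
  dmx l (fun z => - A z) x = - dmx l A x.
Proof.
move=> sA; apply/matrixP => i j; rewrite mxE !dmxE -partialN.
- by apply: partial_ext => z; rewrite mxE.
- exact: smooth_diff (sA i j) Ux.
Qed.

Lemma dmxB p q (A B : V -> 'M[R]_(p, q)) : smooth_mx A -> smooth_mx B ->
  dmx l (fun z => A z - B z) x = dmx l A x - dmx l B x.
Proof. by move=> sA sB; rewrite dmxD ?dmxN//; exact: smooth_mxN. Qed.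

Lemma dmxZ p q (f : V -> R) (A : V -> 'M[R]_(p, q)) :
  smooth_on U f -> smooth_mx A ->
  dmx l (fun z => f z *: A z) x = grad f x 0 l *: A x + f x *: dmx l A x.
Proof.
move=> sf sA; apply/matrixP => i j; rewrite 3!mxE !dmxE gradE -partialM.
- by apply: partial_ext => z; rewrite mxE.
- exact: smooth_diff sf Ux.
- exact: smooth_diff (sA i j) Ux.
Qed.

Lemma dmx_cst p q (A : 'M[R]_(p, q)) : dmx l (fun=> A) x = 0.
Proof. by apply/matrixP => i j; rewrite dmxE partial_cst mxE. Qed.

Lemma dmx_tr p q (A : V -> 'M[R]_(p, q)) :
  dmx l (fun z => (A z)^T) x = (dmx l A x)^T.
Proof.
apply/matrixP => i j; rewrite mxE !dmxE.
by apply: partial_ext => z; rewrite mxE.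
Qed.

Lemma dmx_sum p q (F : 'I_n -> V -> 'M[R]_(p, q)) :
  (forall k, smooth_mx (F k)) ->
  dmx l (fun z => \sum_k F k z) x = \sum_k dmx l (F k) x.
Proof.
move=> sF; apply/matrixP => i j; rewrite dmxE summxE.
transitivity (partial l (fun z => \sum_k F k z i j) x).
  by apply: partial_ext => z; rewrite summxE.
rewrite partial_sum => [|k]; last exact: smooth_diff (sF k i j) Ux.
by apply: eq_bigr => k _; rewrite dmxE.
Qed.

Lemma dmxC p q (A : V -> 'M[R]_(p, q)) m : smooth_mx A ->
  dmx l (dmx m A) x = dmx m (dmx l A) x.
Proof.
move=> sA; apply/matrixP => i j.
have E k k' : dmx k (dmx k' A) x i j = partial k (partial k' (fun z => A z i j)) x.
  by rewrite dmxE; apply: partial_ext => z; rewrite dmxE.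
refine (etrans (E l m) (etrans _ (esym (E m l)))).
exact: partialC l m oU (sA i j) Ux.
Qed.

(** The product rule applied to [invmx A] times [A], which is constant on [U]. *)
Lemma dmx_invmx m (A : V -> 'M[R]_m) : smooth_mx A ->
  (forall z, U z -> A z \in unitmx) ->
  dmx l (fun z => invmx (A z)) x = - (invmx (A x) *m dmx l A x *m invmx (A x)).
Proof.
move=> sA uA; have sI := smooth_invmx sA uA.
have : dmx l (fun z => invmx (A z) *m A z) x = 0.
  rewrite -(dmx_cst (1%:M : 'M[R]_m)); apply: dmx_eq => z; rewrite inE => /uA Az.
  by rewrite mulVmx.
rewrite dmxM// => /(congr1 (mulmx^~ (invmx (A x)))).
rewrite mulmxDl mul0mx mulmxK ?uA// => /eqP.
by rewrite addr_eq0 => /eqP.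
Qed.

End Derivation.

Section Gradient.
Variable x : V.
Hypothesis Ux : U x.

Lemma grad_eq (f h : V -> R) : {in U, f =1 h} -> grad f x = grad h x.
Proof.
by move=> fh; apply/rowP => k; rewrite !gradE; exact: (partial_eq_on _ oU fh Ux).
Qed.

Lemma grad_cst (a : R) : grad (fun=> a) x = 0.
Proof. by apply/rowP => k; rewrite gradE partial_cst mxE. Qed.

Lemma gradD (f h : V -> R) : smooth_on U f -> smooth_on U h ->
  grad (fun z => f z + h z) x = grad f x + grad h x.
Proof.
move=> sf sh; apply/rowP => k; rewrite mxE !gradE partialD//.
  exact: smooth_diff sf Ux.
exact: smooth_diff sh Ux.
Qed.

Lemma gradB (f h : V -> R) : smooth_on U f -> smooth_on U h ->
  grad (fun z => f z - h z) x = grad f x - grad h x.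
Proof.
move=> sf sh; apply/rowP => k; rewrite mxE [X in _ + X]mxE !gradE partialB//.
  exact: smooth_diff sf Ux.
exact: smooth_diff sh Ux.
Qed.

Lemma gradM (f h : V -> R) : smooth_on U f -> smooth_on U h ->
  grad (fun z => f z * h z) x = h x *: grad f x + f x *: grad h x.
Proof.
move=> sf sh; apply/rowP => k; rewrite 3!mxE !gradE partialM; first by rewrite mulrC.
  exact: smooth_diff sf Ux.
exact: smooth_diff sh Ux.
Qed.

Lemma grad_comp (phi : R -> R) (f : V -> R) : derivable phi (f x) 1 ->
  smooth_on U f ->
  grad (fun z => phi (f z)) x = derive1 phi (f x) *: grad f x.
Proof.
move=> dphi sf; apply/rowP => k; rewrite mxE !gradE partial_comp//.
exact: smooth_diff sf Ux.
Qed.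

End Gradient.
End MatrixFields.

(** * Levi-Civita connection and Ricci tensor *)

(** The connection matrix in direction [l]: the covariant derivative is [dmx l Z + chr g l *m Z] on
    columns and [dmx l v - v *m chr g l] on rows. *)
HB.lock Definition chr (R : realType) (n : nat) (g : 'rV[R]_n -> 'M[R]_n)
    (l : 'I_n) (x : 'rV[R]_n) : 'M[R]_n :=
  \matrix_(k, m) christoffel g k l m x.
Arguments chr {R n} g l x.

Section Metric.
Context {R : realType} {n : nat}.
Local Notation V := 'rV[R]_n.
Variables (U : set V) (g : V -> 'M[R]_n).
Local Notation chr := (chr g).
Hypotheses (oU : open U) (sg : smooth_mx U g).
Hypothesis g_sym : forall x, U x -> (g x)^T = g x.
Hypothesis g_unit : forall x, U x -> g x \in unitmx.

Lemma chrE l x k m : chr l x k m = christoffel g k l m x.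
Proof. by rewrite chr.unlock mxE. Qed.

Lemma smooth_ginv : smooth_mx U (ginv g).
Proof. exact: smooth_invmx. Qed.

Lemma ginv_sym x : U x -> (ginv g x)^T = ginv g x.
Proof. by move=> Ux; rewrite /ginv trmx_inv g_sym. Qed.

Lemma partial_metricC l i j x : U x ->
  partial l (fun z => g z i j) x = partial l (fun z => g z j i) x.
Proof.
move=> Ux; apply: (partial_eq_on _ oU) => // z; rewrite inE => Uz.
by rewrite -{1}(g_sym Uz) mxE.
Qed.

(** Christoffel symbols of the first kind, the index [i] being the lowered one. *)
Definition koszul (l : 'I_n) (x : V) : 'M[R]_n :=
  \matrix_(i, j) (2^-1 * (partial l (fun z => g z i j) x
    + partial j (fun z => g z i l) x - partial i (fun z => g z l j) x)).

Lemma chr_koszul l x : chr l x = ginv g x *m koszul l x.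
Proof.
apply/matrixP => k m; rewrite chrE mxE /christoffel mulr_sumr.
by apply: eq_bigr => a _; rewrite mxE mulrCA.
Qed.

Lemma smooth_chr l : smooth_mx U (chr l).
Proof.
apply: (smooth_mx_eq oU (A := fun x => ginv g x *m koszul l x)).
  by move=> x _; rewrite chr_koszul.
apply: smooth_mxM => //; first exact: smooth_ginv.
move=> i j; apply: (smooth_eq (f := fun x => 2^-1 *
  (partial l (fun z => g z i j) x
    + partial j (fun z => g z i l) x - partial i (fun z => g z l j) x)) oU).
  by move=> x _; rewrite mxE.
apply: smoothM => //; first exact: smooth_cst.
apply: smoothB => //; first apply: smoothD => //; exact: smooth_partial.
Qed.

Lemma chrC l k m x : U x -> chr l x k m = chr m x k l.
Proof.
move=> Ux; rewrite !chrE /christoffel; congr (_ * _); apply: eq_bigr => a _.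
by congr (_ * _); rewrite (partial_metricC a l m Ux) [X in X - _]addrC.
Qed.

Lemma metric_chr l x : U x -> g x *m chr l x = koszul l x.
Proof. by move=> Ux; rewrite chr_koszul mulKVmx// g_unit. Qed.

Lemma dmx_metric l x : U x ->
  dmx l g x = g x *m chr l x + (g x *m chr l x)^T.
Proof.
move=> Ux; rewrite metric_chr//; apply/matrixP => i j; rewrite dmxE !mxE.
rewrite (partial_metricC l j i Ux) (partial_metricC i j l Ux).
by rewrite (partial_metricC j l i Ux); field.
Qed.

(** Koszul's argument at a single point: with the upper index lowered, the three cyclic instances of
    the compatibility equation, together with symmetry, determine [C]. A connection can therefore be
    guessed and then checked. *)
Lemma chr_unique (C : 'I_n -> 'M[R]_n) x : U x ->
  (forall l k m, C l k m = C m k l) ->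
  (forall l, dmx l g x = g x *m C l + (g x *m C l)^T) ->
  forall l, chr l x = C l.
Proof.
move=> Ux Csym Cg l.
have cs i j k : (g x *m C i) j k = (g x *m C k) j i.
  by rewrite !mxE; apply: eq_bigr => a _; rewrite Csym.
have dg i j k : partial i (fun z => g z j k) x =
    (g x *m C i) j k + (g x *m C i) k j.
  by move/matrixP: (Cg i) => /(_ j k); rewrite dmxE => ->; rewrite mxE [X in _ + X]mxE.
suff -> : C l = ginv g x *m koszul l x by exact: chr_koszul.
rewrite -[LHS](mulKmx (g_unit Ux)); congr mulmx.
apply/matrixP => i j; rewrite [RHS]mxE !dg.
by rewrite (cs j i l) (cs l j i) (cs j l i); field.
Qed.

(** The curvature operator R(d_k, d_j) as an endomorphism of column vectors. *)
Definition curv (k j : 'I_n) (x : V) : 'M[R]_n :=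
  dmx k (chr j) x - dmx j (chr k) x + chr k x *m chr j x - chr j x *m chr k x.

Lemma dchrC a b c k x : U x -> dmx a (chr b) x k c = dmx a (chr c) x k b.
Proof.
move=> Ux.
refine (etrans (dmxE _ _ _ _ _) (etrans _ (esym (dmxE _ _ _ _ _)))).
refine (partial_eq_on _ oU _ Ux).
move=> z /set_mem Uz.
exact: (chrC b k c Uz).
Qed.

Lemma curvE k j x a b : curv k j x a b =
  dmx k (chr j) x a b - dmx j (chr k) x a b
  + ((chr k x *m chr j x) a b - (chr j x *m chr k x) a b).
Proof.
have gen (A B C D : 'M[R]_n) : (A - B + C - D) a b =
  A a b - B a b + (C a b - D a b) by rewrite !mxE addrA.
exact: gen.
Qed.

Lemma ricciE x i j : U x -> ricci g x i j = \sum_k curv k j x k i.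
Proof.
move=> Ux; rewrite mxE; apply: eq_bigr => k _; rewrite curvE.
have pc a b c : partial a (christoffel g k b c) x = dmx a (chr c) x k b.
  refine (etrans _ (dchrC a b c k Ux)).
  refine (etrans _ (esym (dmxE _ _ _ _ _))).
  by apply: partial_ext => z; rewrite chrE.
have mc a b c : \sum_m christoffel g k a m x * christoffel g m b c x =
    (chr a x *m chr c x) k b.
  by rewrite mxE; apply: eq_bigr => m _; rewrite (chrC c m b Ux) !chrE.
refine (congr2 +%R (congr2 (fun p q => p - q) (pc k i j) (pc j i k)) _).
by rewrite sumrB (mc k i j) (mc j i k).
Qed.

Lemma smooth_ricci : smooth_mx U (ricci g).
Proof.
have sc k j : smooth_mx U (curv k j).
  have sC := smooth_chr.
  apply: smooth_mxB => //; last exact: smooth_mxM.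
  apply: smooth_mxD => //; last exact: smooth_mxM.
  by apply: smooth_mxB => //; exact: smooth_dmx.
move=> i j; apply: (smooth_eq (f := fun x => \sum_k curv k j x k i) oU).
  by move=> x /set_mem Ux; rewrite ricciE.
by apply: smooth_sum => // k; exact: sc.
Qed.

Lemma partial_tr l m (A : V -> 'M[R]_m) x : U x -> smooth_mx U A ->
  partial l (fun z => \tr (A z)) x = \tr (dmx l A x).
Proof.
move=> Ux sA; rewrite /mxtrace partial_sum => [|k].
  by apply: eq_bigr => k _; rewrite dmxE.
exact: smooth_diff (sA k k) Ux.
Qed.

(** The trace is the derivative of log sqrt(det g), in the shape given by Jacobi's formula. One
    further derivative of this shape is visibly symmetric up to [dmxC] and cyclicity of the
    trace. *)
Lemma tr_chr l x : U x -> \tr (chr l x) = 2^-1 * \tr (ginv g x *m dmx l g x).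
Proof.
move=> Ux; rewrite dmx_metric// mulmxDr mxtraceD mulKmx ?g_unit//.
rewrite trmx_mul g_sym// mxtrace_mulC -mulmxA mulmxV ?g_unit// mulmx1.
by rewrite mxtrace_tr; field.
Qed.

(** Of the four terms of the contracted curvature, three are symmetric because the Christoffel
    symbols are or because the trace is cyclic. The remaining one, d_j of the trace of the
    connection matrix, is a second derivative of log sqrt(det g). *)
Lemma ricci_sym x i j : U x -> ricci g x i j = ricci g x j i.
Proof.
move=> Ux.
have tr_dchr a b : \tr (dmx a (chr b) x) = \tr (dmx b (chr a) x).
  have E c d : \tr (dmx c (chr d) x) =
      2^-1 * (- \tr (ginv g x *m dmx c g x *m (ginv g x *m dmx d g x))
        + \tr (ginv g x *m dmx c (dmx d g) x)).
    have sD := smooth_dmx oU d sg; have sG := smooth_ginv.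
    rewrite -partial_tr//; last exact: smooth_chr.
    transitivity (partial c (fun z => 2^-1 * \tr (ginv g z *m dmx d g z)) x).
      by apply: (partial_eq_on _ oU) => // z /set_mem Uz; rewrite tr_chr.
    rewrite partialM; last 2 first.
    - exact: differentiable_cst.
    - apply: (smooth_diff (smooth_sum (index_enum 'I_n) xpredT oU _) Ux) => k.
      exact: (smooth_mxM oU sG sD).
    rewrite partial_cst mul0r add0r; congr (_ * _).
    rewrite partial_tr//; last exact: smooth_mxM.
    rewrite (dmxM c Ux sG sD) mxtraceD (dmx_invmx oU c Ux sg g_unit).
    by rewrite mulNmx raddfN -!mulmxA.
  rewrite (E a b) (E b a) (dmxC oU a Ux b sg).
  by rewrite (mxtrace_mulC (ginv g x *m dmx a g x)).
rewrite (ricciE i j Ux) (ricciE j i Ux).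
have E a b : \sum_k curv k b x k a = \sum_k dmx k (chr b) x k a
    - \tr (dmx b (chr a) x) + \sum_m \tr (chr m x) * chr b x m a
    - \tr (chr b x *m chr a x).
  have tr2 : \tr (dmx b (chr a) x) = \sum_k dmx b (chr k) x k a.
    by apply: eq_bigr => k _; exact: dchrC.
  have tr3 : \tr (chr b x *m chr a x) = \sum_k (chr b x *m chr k x) k a.
    apply: eq_bigr => k _; rewrite 2!mxE; apply: eq_bigr => m _.
    by rewrite (chrC a _ _ Ux).
  have tr4 : \sum_m \tr (chr m x) * chr b x m a = \sum_k (chr k x *m chr b x) k a.
    under [RHS]eq_bigr do rewrite mxE.
    rewrite exchange_big; apply: eq_bigr => m _; rewrite /mxtrace mulr_suml.
    by apply: eq_bigr => k _; rewrite (chrC k _ _ Ux).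
  rewrite tr2 tr3 tr4 -!sumrB -big_split -sumrB; apply: eq_bigr => k _.
  by rewrite curvE addrA.
rewrite (E i j) (E j i) (tr_dchr i j) (mxtrace_mulC (chr i x)); congr (_ - _ + _ - _).
  by apply: eq_bigr => k _; exact: dchrC.
by apply: eq_bigr => k _; rewrite (chrC i _ _ Ux).
Qed.

End Metric.

(** * Killing forms *)

HB.lock Definition nabla (R : realType) (n : nat) (g : 'rV[R]_n -> 'M[R]_n)
    (v : 'rV[R]_n -> 'rV[R]_n) (x : 'rV[R]_n) : 'M[R]_n :=
  \matrix_(i, j) covd g v i j x.
Arguments nabla {R n} g v x.

HB.lock Definition dual_vec (R : realType) (n : nat) (g : 'rV[R]_n -> 'M[R]_n)
    (w : 'rV[R]_n -> 'rV[R]_n) (x : 'rV[R]_n) : 'cV[R]_n :=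
  ginv g x *m (w x)^T.
Arguments dual_vec {R n} g w x.

HB.lock Definition div (R : realType) (n : nat) (g : 'rV[R]_n -> 'M[R]_n)
    (Z : 'rV[R]_n -> 'cV[R]_n) (x : 'rV[R]_n) : R :=
  \sum_k (dmx k Z x + chr g k x *m Z x) k 0.
Arguments div {R n} g Z x.

Section Killing.
Context {R : realType} {n : nat}.
Local Notation V := 'rV[R]_n.
Variables (U : set V) (g : V -> 'M[R]_n) (w : V -> 'rV[R]_n).
Hypotheses (oU : open U) (sg : smooth_mx U g).
Hypothesis g_sym : forall x, U x -> (g x)^T = g x.
Hypothesis g_unit : forall x, U x -> g x \in unitmx.
Hypothesis sw : smooth_mx U w.

Local Notation chr := (chr g).
Local Notation nabla := (nabla g).
Local Notation X := (dual_vec g w).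
Local Notation S := (nabla w).
Local Notation G := (ginv g).
Local Notation sf := (sform g w).
Let sG : smooth_mx U G := smooth_ginv oU sg g_unit.
Let sC l : smooth_mx U (chr l) := smooth_chr oU sg g_unit l.

Lemma nablaE (v : V -> 'rV[R]_n) x i j : nabla v x i j = covd g v i j x.
Proof. by rewrite nabla.unlock mxE. Qed.

Lemma dmx_form (v : V -> 'rV[R]_n) l x : U x ->
  dmx l v x = (col l (nabla v x))^T + v x *m chr l x.
Proof.
move=> Ux; apply/rowP => i; rewrite dmxE 4!mxE nablaE /covd.
rewrite -[LHS](subrK (\sum_k christoffel g k i l x * v x 0 k)); congr (_ + _).
by apply: eq_bigr => k _; rewrite (chrC oU g_sym l k i Ux) chrE mulrC.
Qed.

Lemma smooth_nabla (v : V -> 'rV[R]_n) : smooth_mx U v -> smooth_mx U (nabla v).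
Proof.
move=> sv i j; apply: (smooth_eq (f := fun x => dmx j v x 0 i
    - \sum_k chr i x k j * v x 0 k) oU).
  move=> x /set_mem Ux; rewrite nablaE /covd dmxE; congr (_ - _).
  by apply: eq_bigr => k _; rewrite chrE.
apply: smoothB => //; first exact: smooth_dmx.
apply: smooth_sum => // k; apply: smoothM => //; first exact: sC.
Qed.

Lemma smooth_vec : smooth_mx U X.
Proof.
rewrite (_ : X = fun x => G x *m (w x)^T).
  by apply: smooth_mxM => //; exact: smooth_mx_tr.
by apply/funext => x; rewrite dual_vec.unlock.
Qed.

Lemma metric_vec x : U x -> g x *m X x = (w x)^T.
Proof. by move=> Ux; rewrite dual_vec.unlock mulKVmx// g_unit. Qed.

(** The metric is parallel, so raising the index commutes with covariant differentiation; this comes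
    from differentiating [metric_vec]. *)
Lemma cov_vec l x : U x -> dmx l X x + chr l x *m X x = G x *m col l (S x).
Proof.
move=> Ux; have sX := smooth_vec.
have := dmx_eq oU l Ux (A := fun z => g z *m X z) (B := fun z => (w z)^T).
move=> /(_ (fun z Uz => metric_vec (set_mem Uz))).
rewrite (dmxM l Ux sg sX) (dmx_tr l) (dmx_form w l Ux) (dmx_metric oU g_sym g_unit l Ux).
rewrite raddfD /= trmxK (trmx_mul (w x)) -metric_vec// mulmxDl.
rewrite (trmx_mul (g x)) g_sym// -!mulmxA.
rewrite addrAC => /addIr; rewrite -mulmxDr addrC => <-.
by rewrite mulKmx// g_unit.
Qed.

Lemma upE x i : up g w x i = X x i 0.
Proof. by rewrite dual_vec.unlock mxE; apply: eq_bigr => j _; rewrite mxE. Qed.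

Lemma normb2E x : normb2 g w x = (w x *m X x) 0 0.
Proof. by rewrite mxE; apply: eq_bigr => i _; rewrite upE mulrC. Qed.

(** The Ricci identity along coordinate fields; these commute, so there is no bracket term. *)
Lemma curv_comm (Z : V -> 'cV[R]_n) k j x : U x -> smooth_mx U Z ->
  let K j z := dmx j Z z + chr j z *m Z z in
  dmx k (K j) x + chr k x *m K j x - (dmx j (K k) x + chr j x *m K k x)
  = curv g k j x *m Z x.
Proof.
move=> Ux sZ K.
have E a b : dmx a (K b) x + chr a x *m K b x = dmx a (dmx b Z) x +
   dmx a (chr b) x *m Z x + chr b x *m dmx a Z x + chr a x *m dmx b Z x
   + chr a x *m chr b x *m Z x.
  rewrite (dmxD a Ux (smooth_dmx oU b sZ) (smooth_mxM oU (sC b) sZ)).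
  by rewrite (dmxM a Ux (sC b) sZ) mulmxDr mulmxA !addrA.
rewrite (E k j) (E j k) (dmxC oU k Ux j sZ) /curv !mulmxDl !mulNmx.
set A := dmx j _ x; set B := _ *m Z x; set C := chr j x *m _.
set D := chr k x *m _; set E1 := _ *m Z x; set F := _ *m Z x; set H := _ *m Z x.
have gen (a b c d e f h : 'cV[R]_n) : a + b + c + d + e - (a + f + d + c + h)
   = b - f + e - h.
  by apply/colP => i; rewrite !mxE; ring.
exact: gen.
Qed.

Hypothesis killing : forall x i j, U x -> covd g w i j x + covd g w j i x = 0.

Lemma nabla_tr x : U x -> (S x)^T = - S x.
Proof.
move=> Ux; apply/matrixP => i j; rewrite [LHS]mxE [RHS]mxE !nablaE.
by apply/eqP; rewrite -addr_eq0 killing.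
Qed.

(** The covariant derivative of a Killing form is already skew, so [S] serves as s_ij from here
    on. *)
Lemma s_lowerE x i j : U x -> s_lower g w i j x = S x i j.
Proof.
move=> Ux; rewrite /s_lower -!nablaE.
have := nabla_tr Ux => /matrixP/(_ i j); rewrite [LHS]mxE [RHS]mxE => ->.
by field.
Qed.

Lemma sformE x : U x -> sf x = (X x)^T *m S x.
Proof.
move=> Ux; apply/rowP => i; rewrite 2!mxE; apply: eq_bigr => m _.
by rewrite upE s_lowerE// mxE.
Qed.

(** A symmetric matrix contracted with a skew one. Geometrically, a Killing field is divergence
    free. *)
Lemma tr_skew x : U x -> \tr (G x *m S x) = 0.
Proof.
move=> Ux; have : \tr (G x *m S x) = - \tr (G x *m S x).
  rewrite -{1}mxtrace_tr trmx_mul nabla_tr// (ginv_sym g_sym)// mxtrace_mulC.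
  by rewrite mulmxN raddfN.
by move=> /eqP; rewrite -subr_eq0 opprK -mulr2n mulrn_eq0 => /eqP.
Qed.

Lemma smooth_sform : smooth_mx U sf.
Proof.
apply: (smooth_mx_eq oU (A := fun x => (X x)^T *m S x)).
  by move=> x /set_mem Ux; rewrite sformE.
apply: smooth_mxM => //; last exact: smooth_nabla.
exact: smooth_mx_tr smooth_vec.
Qed.

Lemma vec_skew x : U x -> S x *m X x = - (sf x)^T.
Proof.
by move=> Ux; rewrite sformE// trmx_mul trmxK nabla_tr// mulNmx opprK.
Qed.

Lemma sform_vec x : U x -> sf x *m X x = 0.
Proof.
move=> Ux; have : (sf x *m X x)^T = - (sf x *m X x).
  by rewrite trmx_mul {2}sformE// -mulmxA vec_skew// mulmxN opprK.
move=> /matrixP/(_ 0 0); rewrite [LHS]mxE [RHS]mxE => /eqP.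
rewrite -subr_eq0 opprK -mulr2n mulrn_eq0 /= => /eqP e.
by apply/matrixP => i j; rewrite !ord1 e mxE.
Qed.

Lemma smooth_normb2 : smooth_on U (normb2 g w).
Proof.
apply: (smooth_eq (f := fun x => (w x *m X x) 0 0) oU).
  by move=> x _; rewrite normb2E.
exact: (smooth_mxM oU sw smooth_vec).
Qed.

Lemma grad_normb2 x : U x -> grad (normb2 g w) x = 2 *: sf x.
Proof.
move=> Ux; rewrite (_ : normb2 g w = fun z => (w z *m X z) 0 0); last first.
  by apply/funext => z; rewrite normb2E.
apply/rowP => l; rewrite grad_entry (dmxM l Ux sw smooth_vec) (dmx_form w l Ux).
rewrite mulmxDl -addrA -mulmxA -mulmxDr [_ *m X x + _]addrC cov_vec//.
have -> : w x *m (G x *m col l (S x)) = ((col l (S x))^T *m X x)^T.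
  by rewrite -[w x]trmxK -metric_vec// !trmx_mul trmxK g_sym// -mulmxA mulKVmx// g_unit.
have E : (col l (S x))^T *m X x = (col l (sf x))^T.
  by rewrite sformE// !colE -mulmxA [RHS]trmx_mul trmxK.
by rewrite E trmxK !mxE; ring.
Qed.

(** Half the Hessian of b^2, whose gradient is [2 *: sf]; this is the source of its symmetry. *)
Definition hess x : 'M[R]_n := nabla sf x.

Lemma hess_sym x i j : U x -> hess x i j = hess x j i.
Proof.
move=> Ux; rewrite /hess !nablaE /covd; congr (_ - _); last first.
  by apply: eq_bigr => k _; rewrite -!chrE (chrC oU g_sym).
have su := smooth_normb2.
have E a b : partial b (partial a (normb2 g w)) x =
    2 * partial b (fun z => sf z 0 a) x.
  transitivity (partial b (fun z => 2 * sf z 0 a) x).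
    apply: (partial_eq_on _ oU _ Ux) => z /set_mem Uz.
    by rewrite -gradE grad_normb2// mxE.
  rewrite partialM; first by rewrite partial_cst mul0r add0r.
    exact: differentiable_cst.
  exact: smooth_diff (smooth_sform 0 a) Ux.
have n2 : (2 : R) != 0 by [].
apply: (mulfI n2); refine (etrans (esym (E i j)) (etrans _ (E j i))).
exact: partialC j i oU su Ux.
Qed.

(** Covariant derivative of the relation s_i b^i = 0. It trades a second derivative of beta
    contracted with b^i for a product of first derivatives. *)
Lemma hess_vec x l : U x ->
  (col l (hess x))^T *m X x = - (sf x *m G x *m col l (S x)).
Proof.
move=> Ux; have sX := smooth_vec; have ss := smooth_sform.
have := dmx_eq oU l Ux (A := fun z => sf z *m X z) (B := fun=> 0).
move=> /(_ (fun z Uz => sform_vec (set_mem Uz))).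
rewrite dmx_cst (dmxM l Ux ss sX) (dmx_form sf l Ux) mulmxDl -addrA -mulmxA.
rewrite -mulmxDr [_ *m X x + _]addrC cov_vec// mulmxA => /eqP.
by rewrite addr_eq0 => /eqP.
Qed.

(** The columns of [G S] are the covariant derivatives of [X], so the divergence of s^i_j is a
    contracted second derivative of [X]. Taken in the other order, the contraction is the derivative
    of the divergence of [X], which is 0; the difference of the two orders is curvature, and its
    trace is Ricci. *)
Lemma div_skew (Z : V -> 'cV[R]_n) x : U x -> smooth_mx U Z ->
  div g (fun z => G z *m S z *m Z z) x = ((X x)^T *m ricci g x *m Z x) 0 0
   + \sum_k (G x *m S x *m (dmx k Z x + chr k x *m Z x)) k 0.
Proof.
move=> Ux sZ; rewrite div.unlock; set T := fun z => G z *m S z.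
have sT : smooth_mx U T by apply: smooth_mxM => //; exact: smooth_nabla.
have sX := smooth_vec.
pose K j z := dmx j X z + chr j z *m X z.
have KT j z : U z -> K j z = col j (T z).
  by move=> Uz; rewrite /K cov_vec// !colE mulmxA.
(* The divergence of the endomorphism field [T] itself, both of its indices being corrected by the
   connection. Symmetry of the Christoffel symbols ([E1]) matches the lower correction with the
   connection term of the other order of differentiation. *)
have main j : \sum_k (dmx k T x + chr k x *m T x - T x *m chr k x) k j =
    ((X x)^T *m ricci g x) 0 j.
  transitivity (\sum_k (curv g k j x *m X x) k 0); last first.
    rewrite mxE; under eq_bigr do rewrite mxE; rewrite exchange_big /=.
    apply: eq_bigr => i _; rewrite mxE (ricciE oU g_sym i j Ux) mulr_sumr.
    by apply: eq_bigr => k _; rewrite mulrC.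
  have gen1 (A B C : 'M[R]_n) a b : (A + B - C) a b = A a b + B a b - C a b.
    by rewrite !mxE.
  have gen2 (A B C D : 'cV[R]_n) a : (A + B - (C + D)) a 0 =
     A a 0 + B a 0 - (C a 0 + D a 0) by rewrite !mxE.
  transitivity (\sum_k (dmx k T x k j + (chr k x *m T x) k j
      - (T x *m chr k x) k j)).
    by apply: eq_bigr => k _; exact: gen1.
  transitivity (\sum_k (dmx k (K j) x k 0 + (chr k x *m K j x) k 0
      - (dmx j (K k) x k 0 + (chr j x *m K k x) k 0))); last first.
    by apply: eq_bigr => k _; rewrite -(curv_comm _ _ Ux sX); exact/esym/gen2.
  rewrite !sumrB !big_split /=.
  have dK k i l : dmx k (K i) x l 0 = dmx k T x l i.
    rewrite !dmxE; apply: (partial_eq_on _ oU _ Ux) => z /set_mem Uz.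
    by rewrite KT// [LHS]mxE.
  have E1 : \sum_k (T x *m chr k x) k j = \sum_k (chr j x *m K k x) k 0.
    transitivity (\tr (T x *m chr j x)).
      apply: eq_bigr => k _; rewrite 2!mxE; apply: eq_bigr => m _.
      by rewrite (chrC oU g_sym k m j Ux).
    rewrite mxtrace_mulC; apply: eq_bigr => k _; rewrite 2!mxE.
    by apply: eq_bigr => m _; rewrite KT// [X in _ = _ * X]mxE.
  have E2 : \sum_k dmx j (K k) x k 0 = 0.
    under eq_bigr do rewrite dK.
    rewrite -[LHS]/(\tr (dmx j T x)) -(partial_tr j Ux sT).
    rewrite -[RHS](partial_cst j (0 : R) x).
    by apply: (partial_eq_on _ oU _ Ux) => z /set_mem Uz; exact: tr_skew.
  rewrite E1 E2 add0r; congr (_ + _ - _); apply: eq_bigr => k _; first by rewrite dK.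
  by rewrite KT// !colE mulmxA -colE [RHS]mxE.
transitivity (\sum_k ((dmx k T x + chr k x *m T x - T x *m chr k x) *m Z x
   + T x *m (dmx k Z x + chr k x *m Z x)) k 0).
  apply: eq_bigr => k _; apply: (congr1 (fun M : 'cV[R]_n => M k 0)).
  rewrite (dmxM k Ux sT sZ) -/(T x).
  rewrite mulmxBl mulmxDl mulmxDr !mulmxA.
  set a := _ *m Z x; set b := T x *m dmx k Z x; set c := _ *m Z x.
  set d := _ *m Z x.
  have gen (p q u v : 'cV[R]_n) : p + q + u = p + u - v + (q + v).
    by apply/colP => i; rewrite !mxE; ring.
  exact: (gen a b c d).
under eq_bigr do rewrite mxE.
rewrite big_split /=; congr (_ + _); rewrite [RHS]mxE.
under eq_bigr do rewrite mxE.
rewrite exchange_big /=; apply: eq_bigr => j _.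
by rewrite -mulr_suml main.
Qed.

End Killing.

(** * Change of the Ricci tensor under a change of connection *)

Section Parallel.
Context {R : realType} {n : nat}.
Local Notation V := 'rV[R]_n.
Variables (U : set V) (g : V -> 'M[R]_n) (x0 : V) (y : 'cV[R]_n).
Hypotheses (oU : open U) (Ux0 : U x0).

(* The linear extension of [y] that is parallel at [x0]: covariant derivatives at [x0]
   of a tensor contracted with it are plain derivatives of functions. *)
Definition parallel (x : V) : 'cV[R]_n :=
  y - \sum_l (x 0 l - x0 0 l) *: (chr g l x0 *m y).

Lemma smooth_parallel : smooth_mx U parallel.
Proof.
apply: smooth_mxB => //; first exact: smooth_mx_cst.
apply: smooth_mx_sum => // l; apply: smooth_mxZ => //; last exact: smooth_mx_cst.
by apply: smoothB => //; [exact: smooth_coord|exact: smooth_cst].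
Qed.

Lemma parallel_at : parallel x0 = y.
Proof. by rewrite /parallel big1 ?subr0// => l _; rewrite subrr scale0r. Qed.

Lemma dmx_parallel k : dmx k parallel x0 = - (chr g k x0 *m y).
Proof.
have sc l : smooth_on U (fun x : V => x 0 l - x0 0 l).
  by apply: smoothB => //; [exact: smooth_coord|exact: smooth_cst].
have sF l : smooth_mx U (fun x : V => (x 0 l - x0 0 l) *: (chr g l x0 *m y)).
  by apply: smooth_mxZ => //; exact: smooth_mx_cst.
rewrite /parallel (dmxB oU k Ux0 (smooth_mx_cst _ y) (smooth_mx_sum oU sF)).
rewrite dmx_cst sub0r (dmx_sum k Ux0 sF); congr (- _).
rewrite (bigD1 k)//= [X in _ + X]big1 => [|l lk];
  rewrite (dmxZ _ Ux0 (sc _) (smooth_mx_cst _ _)) dmx_cst scaler0 addr0 gradE;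
  rewrite partialB ?partial_coord ?partial_cst; do ?exact: coord_differentiable;
  do ?exact: differentiable_cst.
- by rewrite eqxx subr0 scale1r addr0.
- by rewrite (negbTE lk) subr0 scale0r.
Qed.

Lemma cov_parallel k : dmx k parallel x0 + chr g k x0 *m parallel x0 = 0.
Proof. by rewrite dmx_parallel parallel_at addNr. Qed.

End Parallel.

Section ConnectionShift.
Context {R : realType} {n : nat}.
Local Notation V := 'rV[R]_n.
Variables (U : set V) (g h : V -> 'M[R]_n).
Hypothesis oU : open U.
Hypothesis sg : smooth_mx U g.
Hypothesis g_sym : forall x, U x -> (g x)^T = g x.
Hypothesis h_sym : forall x, U x -> (h x)^T = h x.
Hypothesis g_unit : forall x, U x -> g x \in unitmx.
Variable P : 'I_n -> V -> 'M[R]_n.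
Hypothesis sP : forall l, smooth_mx U (P l).
Hypothesis chr_shift : forall l x, U x -> chr h l x = chr g l x + P l x.
Variables (x0 : V) (y : 'cV[R]_n).
Hypothesis Ux0 : U x0.

Local Notation Y := (parallel g x0 y).

Lemma quad_ricci (k : V -> 'M[R]_n) : (forall x, U x -> (k x)^T = k x) ->
  (y^T *m ricci k x0 *m y) 0 0 =
  \sum_(p : 'I_n * 'I_n) y p.2 0 * (curv k p.1 p.2 x0 *m y) p.1 0.
Proof.
move=> k_sym; rewrite -(pair_bigA _ (fun i j => y j 0 * (curv k i j x0 *m y) i 0)) /=.
rewrite exchange_big /= mxE.
apply: eq_bigr => j _; rewrite -mulr_sumr [LHS]mulrC; congr (_ * _).
rewrite mxE; under [RHS]eq_bigr do rewrite mxE.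
rewrite exchange_big /=; apply: eq_bigr => i _.
by rewrite mxE (ricciE oU k_sym i j Ux0) mulr_sumr; apply: eq_bigr => l _; rewrite mulrC.
Qed.

Lemma shift_sym l k m x : U x -> P l x k m = P m x k l.
Proof.
move=> Ux; have := chrC oU h_sym l k m Ux.
by rewrite !chr_shift// [LHS]mxE [RHS]mxE (chrC oU g_sym l k m Ux) => /addrI.
Qed.

(** The curvature operators differ by the antisymmetrised covariant derivative of [P] plus the
    commutator of [P k] and [P j]. Since [Y] is parallel at [x0], its derivatives provide exactly
    the Christoffel terms that turn plain derivatives of [P] into covariant ones. *)
Lemma ricci_shift :
  let N := \sum_j y j 0 *: P j x0 in
  (y^T *m ricci h x0 *m y) 0 0 = (y^T *m ricci g x0 *m y) 0 0
   + div g (fun x => \sum_j Y x j 0 *: (P j x *m Y x)) x0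
   - (grad (fun x => \sum_k (P k x *m Y x) k 0) x0 *m y) 0 0
   + \sum_k (P k x0 *m (N *m y)) k 0 - \tr (N *m N).
Proof.
move=> N; have sY : smooth_mx U Y by exact: smooth_parallel.
have sC l : smooth_mx U (chr g l) by exact: smooth_chr.
have dC k j : dmx k (chr h j) x0 = dmx k (chr g j) x0 + dmx k (P j) x0.
  rewrite -(dmxD k Ux0 (sC j) (sP j)); apply: (dmx_eq oU k Ux0) => x /set_mem Ux.
  exact: chr_shift.
pose C l := chr g l x0; pose Q l := P l x0; pose D k j := dmx k (P j) x0.
(* [F] is the contraction that turns R(d_k, d_j) y into Ric(y, y). [E1] expands the difference of
   the curvatures into eight such contractions; [E2] and [E3] absorb those containing [D] or [C],
   [E4] and [E5] those quadratic in [Q]. *)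
pose F (A : 'I_n -> 'I_n -> 'cV[R]_n) :=
  \sum_(p : 'I_n * 'I_n) y p.2 0 * A p.1 p.2 p.1 0.
have FE A : F A = \sum_k \sum_j y j 0 * A k j k 0.
  exact: esym (pair_bigA _ (fun i j => y j 0 * A i j i 0)).
have E1 : (y^T *m ricci h x0 *m y) 0 0 = (y^T *m ricci g x0 *m y) 0 0
  + F (fun k j => D k j *m y) - F (fun k j => D j k *m y)
  + F (fun k j => C k *m (Q j *m y)) + F (fun k j => Q k *m (C j *m y))
  + F (fun k j => Q k *m (Q j *m y)) - F (fun k j => C j *m (Q k *m y))
  - F (fun k j => Q j *m (C k *m y)) - F (fun k j => Q j *m (Q k *m y)).
  refine (etrans (quad_ricci h_sym) _); rewrite (quad_ricci g_sym) /F.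
  rewrite -big_split -sumrB -3!big_split -3!sumrB.
  apply: eq_bigr => -[k j] _ /=.
  have -> : curv h k j x0 = curv g k j x0 + D k j - D j k + C k *m Q j
      + Q k *m C j + Q k *m Q j - C j *m Q k - Q j *m C k - Q j *m Q k.
    rewrite /curv (chr_shift k Ux0) (chr_shift j Ux0) (dC k j) (dC j k).
    rewrite -/(C k) -/(C j) -/(Q k) -/(Q j) -/(D k j) -/(D j k) !mulmxDl !mulmxDr.
    have gen (a1 a2 a3 a4 b1 b2 b3 b4 c1 c2 c3 c4 : 'M[R]_n) :
      a1 + a2 - (a3 + a4) + (b1 + b2 + (b3 + b4)) - (c1 + c2 + (c3 + c4)) =
      a1 - a3 + b1 - c1 + a2 - a4 + b2 + b3 + b4 - c2 - c3 - c4.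
      by apply/matrixP => i m; rewrite !mxE; ring.
    exact: gen.
  rewrite !mulmxDl !mulNmx -!mulmxA.
  have gen (c : R) (a1 a2 a3 a4 a5 a6 a7 a8 a9 : 'cV[R]_n) :
    c * (a1 + a2 - a3 + a4 + a5 + a6 - a7 - a8 - a9) k 0 =
    c * a1 k 0 + c * a2 k 0 - c * a3 k 0 + c * a4 k 0 + c * a5 k 0 + c * a6 k 0
    - c * a7 k 0 - c * a8 k 0 - c * a9 k 0 by rewrite !mxE; ring.
  exact: gen.
have Y0 : Y x0 = y by exact: parallel_at.
have dY k : dmx k Y x0 = - (C k *m y) by exact: (dmx_parallel g y oU Ux0 k).
have E2 : div g (fun x => \sum_j Y x j 0 *: (P j x *m Y x)) x0 =
    - F (fun k j => C j *m (Q k *m y)) + F (fun k j => D k j *m y)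
    - F (fun k j => Q j *m (C k *m y)) + F (fun k j => C k *m (Q j *m y)).
  (* Differentiating the coefficient [Y x j 0] produces -(C_k y)^j Q_j y; symmetry of the
     Christoffel symbols brings its trace to the form of the sixth term of [E1]. *)
  have ex : F (fun k j => C j *m (Q k *m y)) =
     \sum_k \sum_j (C k *m y) j 0 * (Q j *m y) k 0.
    rewrite FE.
    transitivity (\sum_k \sum_j \sum_m y j 0 * (C j k m * (Q k *m y) m 0)).
      by apply: eq_bigr => k _; apply: eq_bigr => j _; rewrite mxE mulr_sumr.
    transitivity (\sum_k \sum_j \sum_m C k j m * y m 0 * (Q j *m y) k 0); last first.
      by apply: eq_bigr => k _; apply: eq_bigr => j _; rewrite [X in _ = X * _]mxE mulr_suml.
    rewrite [RHS]exchange_big /=; apply: eq_bigr => k _.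
    rewrite exchange_big /=; apply: eq_bigr => j _; apply: eq_bigr => m _.
    rewrite (chrC oU g_sym m k j Ux0) mulrA.
    by congr (_ * _); rewrite mulrC.
  rewrite div.unlock ex !FE -!(big_split, sumrB, sumrN) /=; apply: eq_bigr => k _.
  have sPY j : smooth_mx U (fun x => P j x *m Y x) by exact: smooth_mxM.
  rewrite (dmx_sum k Ux0 (fun j => smooth_mxZ oU (sY j 0) (sPY j))).
  rewrite Y0 mulmx_sumr -big_split /= summxE.
  rewrite -!(big_split, sumrB, sumrN) /=; apply: eq_bigr => j _.
  rewrite (dmxZ k Ux0 (sY j 0) (sPY j)) grad_entry dY (dmxM k Ux0 (sP j) sY) dY Y0.
  rewrite -/(C k) -/(Q j) -/(D k j) -scalemxAr mulmxN.
  have gen (c u : R) (p q r s : 'cV[R]_n) :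
    (c *: p + u *: (q - r) + u *: s) k 0 =
    c * p k 0 + u * q k 0 - u * r k 0 + u * s k 0 by rewrite !mxE; ring.
  by rewrite gen [X in X * _ + _]mxE mulNr.
have E3 : (grad (fun x => \sum_k (P k x *m Y x) k 0) x0 *m y) 0 0 =
    F (fun k j => D j k *m y) - F (fun k j => Q k *m (C j *m y)).
  rewrite !FE -!sumrB.
  transitivity (\sum_k \sum_j y j 0 * (dmx j (fun x => P k x *m Y x) x0) k 0).
    rewrite mxE exchange_big; apply: eq_bigr => j _; rewrite -mulr_sumr mulrC gradE.
    congr (_ * _); have sPY k : smooth_mx U (fun x => P k x *m Y x) by exact: smooth_mxM.
    rewrite partial_sum => [|k]; last exact: smooth_diff (sPY k k 0) Ux0.
    by apply: eq_bigr => k _; rewrite dmxE.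
  apply: eq_bigr => k _; rewrite -sumrB; apply: eq_bigr => j _.
  rewrite (dmxM j Ux0 (sP k) sY) dY Y0 mulmxN.
  by rewrite [X in _ * X = _]mxE [X in _ * (_ + X) = _]mxE mulrBr.
have E4 : \sum_k (Q k *m (N *m y)) k 0 = F (fun k j => Q k *m (Q j *m y)).
  rewrite FE; apply: eq_bigr => k _; rewrite mulmx_suml mulmx_sumr summxE.
  by apply: eq_bigr => j _; rewrite -scalemxAl -scalemxAr mxE.
have E5 : \tr (N *m N) = F (fun k j => Q j *m (Q k *m y)).
  rewrite FE; apply: eq_bigr => k _.
  have -> : (N *m N) k k = (N *m (Q k *m y)) k 0.
    rewrite 2!mxE; apply: eq_bigr => m _; congr (_ * _); rewrite summxE mxE.
    by apply: eq_bigr => j _; rewrite mxE mulrC (shift_sym j m k Ux0).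
  by rewrite mulmx_suml summxE; apply: eq_bigr => j _; rewrite -scalemxAl mxE.
have gen (r a1 a2 a3 a4 a5 a6 a7 a8 : R) :
  r + a1 - a2 + a3 + a4 + a5 - a6 - a7 - a8 =
  r + (- a6 + a1 - a7 + a3) - (a2 - a4) + a5 - a8 by ring.
by refine (etrans E1 _); rewrite E2 E3 E4 E5; exact: gen.
Qed.

End ConnectionShift.

(** * The difference tensor at a point *)

(** The endomorphism P(y) is a sum of four rank-one matrices, a multiple of the identity and a
    multiple of the trace-free s^i_j. With [tr_sq_rank4], the trace of its square becomes a
    polynomial in scalar products and the trace of [T *m T]. *)
Lemma tr_sq_affine (R : realType) (n : nat) (K T : 'M[R]_n) (c d : R) :
  \tr T = 0 ->
  \tr ((K + c *: 1%:M + d *: T) *m (K + c *: 1%:M + d *: T)) =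
  \tr (K *m K) + 2 * c * \tr K + 2 * d * \tr (T *m K) + c ^+ 2 * n%:R
  + d ^+ 2 * \tr (T *m T).
Proof.
move=> trT; rewrite !(mulmxDl, mulmxDr) -!scalemxAl -!scalemxAr !mul1mx !mulmx1.
rewrite !mxtraceD !mxtraceZ mxtrace1 trT (mxtrace_mulC K T).
move: (\tr _) (\tr _) (\tr _) (\tr _) => x1 x2 x3 x4; ring.
Qed.

Lemma tr_rank1 (R : realType) (n : nat) (c d : 'cV[R]_n) (v w : 'rV[R]_n) :
  \tr (c *m v *m (d *m w)) = (v *m d) 0 0 * (w *m c) 0 0.
Proof.
rewrite -mulmxA (mulmxA v) [X in c *m (X *m _)]mx11_scalar mul_scalar_mx -scalemxAr mxtraceZ.
by rewrite mxtrace_mulC [X in _ * X]big_ord1.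
Qed.

Section RankFour.
Variables (R : realType) (n : nat) (c1 c2 c3 c4 : 'cV[R]_n) (v1 v2 v3 v4 : 'rV[R]_n).
Local Notation K := (c1 *m v1 + c2 *m v2 + c3 *m v3 + c4 *m v4).
Local Notation d v c := ((v *m c) 0 0).

Lemma tr_mul_rank4 (T : 'M[R]_n) :
  \tr (T *m K) = d v1 (T *m c1) + d v2 (T *m c2) + d v3 (T *m c3) + d v4 (T *m c4).
Proof.
have tr1 (v : 'rV[R]_n) (z : 'cV[R]_n) : \tr (T *m (z *m v)) = (v *m (T *m z)) 0 0.
  by rewrite mulmxA mxtrace_mulC /mxtrace big_ord1.
by rewrite !mulmxDr !mxtraceD !tr1.
Qed.

Lemma tr_rank4 : \tr K = d v1 c1 + d v2 c2 + d v3 c3 + d v4 c4.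
Proof. by have := tr_mul_rank4 1%:M; rewrite !mul1mx. Qed.

Lemma tr_sq_rank4 :
  \tr (K *m K) = d v1 c1 ^+ 2 + d v2 c2 ^+ 2 + d v3 c3 ^+ 2 + d v4 c4 ^+ 2
  + 2 * (d v1 c2 * d v2 c1 + d v1 c3 * d v3 c1 + d v1 c4 * d v4 c1
    + d v2 c3 * d v3 c2 + d v2 c4 * d v4 c2 + d v3 c4 * d v4 c3).
Proof. rewrite !(mulmxDl, mulmxDr) !mxtraceD !tr_rank1; ring. Qed.

End RankFour.

Section PointAlgebra.
Context {R : realType} {n : nat}.
Variables (g G Sl : 'M[R]_n) (X : 'cV[R]_n) (w sg : 'rV[R]_n) (u : R).
Hypotheses (gG : g *m G = 1%:M) (g_sym : g^T = g).
Hypotheses (Sl_skew : Sl^T = - Sl) (gX : g *m X = w^T) (sgE : sg = X^T *m Sl).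
Hypothesis wX : w *m X = u%:M.
Hypothesis sgX : sg *m X = 0.

Local Notation S := (G *m Sl).
Local Notation sv := (G *m sg^T).

(* [shift_mx l] is the matrix, in [k] and [m], of
   a (s_m d^k_l + s_l d^k_m - s^k g_lm) + p b^k (s_l b_m + b_l s_m)
   + q b_l s^k b_m + r (b_l s^k_m + s^k_l b_m). *)
Definition shift_mx (a p q r : R) (l : 'I_n) : 'M[R]_n :=
  a *: (delta_mx l 0 *m sg + sg 0 l *: 1%:M - sv *m row l g)
  + p *: (X *m (sg 0 l *: w + w 0 l *: sg))
  + (q * w 0 l) *: (sv *m w) + r *: (w 0 l *: S + col l S *m w).

Lemma shift_mx_sym a p q r l k m :
  shift_mx a p q r l k m = shift_mx a p q r m k l.
Proof.
have gs i j : g j i = g i j by move/matrixP: g_sym => /(_ i j); rewrite mxE.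
rewrite /shift_mx; move: sv S => v T.
rewrite !mxE !big_ord1 !mxE !eqxx !andbT (gs m l).
ring.
Qed.

Lemma trG : G^T = G.
Proof.
have e : G^T *m g = 1%:M by rewrite -g_sym -trmx_mul gG trmx1.
by rewrite -[LHS]mulmx1 -gG mulmxA e mul1mx.
Qed.

Lemma Xg : X^T *m g = w.
Proof. by rewrite -[w]trmxK -gX trmx_mul g_sym. Qed.

Lemma w_sv : w *m sv = 0.
Proof.
rewrite mulmxA -Xg -(mulmxA X^T) gG mulmx1 -trmx_mul sgX.
by rewrite trmx0.
Qed.

Lemma w_S : w *m S = sg.
Proof. by rewrite mulmxA -Xg -(mulmxA X^T) gG mulmx1 sgE. Qed.

Lemma Sl_X : Sl *m X = - sg^T.
Proof. by rewrite sgE trmx_mul trmxK Sl_skew mulNmx opprK. Qed.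

Lemma S_X : S *m X = - sv.
Proof. by rewrite -mulmxA Sl_X mulmxN. Qed.

(** With [a] = 2 rho' and [r'] the derivative of [r] with respect to b^2, the right side is the
    covariant derivative of e^(2 rho) [B] divided by e^(2 rho). Comparing the coefficients of s_l
    b_i b_j gives the equation for [p], comparing those of b_l (s_i b_j + b_i s_j) the one for [q];
    the terms skew in i and j drop out on symmetrisation. *)
Lemma shift_compat (a p q r r' : R) l :
  p * (1 + r * u) = r' - r ^+ 2 -> q = - (r' + r * a) ->
  let B := g + r *: (w^T *m w) in
  B *m shift_mx a p q r l + (B *m shift_mx a p q r l)^T =
  (2 * a * sg 0 l) *: B + (2 * r' * sg 0 l) *: (w^T *m w)
  + r *: (col l Sl *m w + w^T *m (col l Sl)^T).
Proof.
move=> pE qE B.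
have Be : B *m delta_mx l 0 = (row l g)^T + (r * w 0 l) *: w^T.
  rewrite mulmxDl -scalemxAl -mulmxA -!colE -[in LHS]g_sym -tr_row.
  by congr (_ + _); apply/colP => i; rewrite !mxE big_ord1 !mxE; ring.
have Bsv : B *m sv = sg^T.
  by rewrite mulmxDl -scalemxAl -mulmxA w_sv mulmx0 scaler0 addr0 mulmxA gG mul1mx.
have BX : B *m X = (1 + r * u) *: w^T.
  by rewrite mulmxDl -scalemxAl -mulmxA wX gX mul_mx_scalar scalerA scalerDl scale1r.
have BS : B *m S = Sl + r *: (w^T *m sg).
  by rewrite mulmxDl -scalemxAl -mulmxA w_S mulmxA gG mul1mx.
have BSl : B *m col l S = col l Sl + (r * sg 0 l) *: w^T.
  rewrite colE mulmxA BS mulmxDl -colE -scalemxAl -mulmxA -colE.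
  congr (_ + _); apply/colP => i; rewrite !mxE big_ord1 !mxE; ring.
have -> : B *m shift_mx a p q r l =
  a *: (((row l g)^T + (r * w 0 l) *: w^T) *m sg + sg 0 l *: B - sg^T *m row l g)
  + (p * (1 + r * u)) *: (w^T *m (sg 0 l *: w + w 0 l *: sg))
  + (q * w 0 l) *: (sg^T *m w)
  + r *: (w 0 l *: (Sl + r *: (w^T *m sg)) + (col l Sl + (r * sg 0 l) *: w^T) *m w).
  rewrite /shift_mx; move: sv Bsv => v Bsv; move: S BS BSl => T BS BSl.
  rewrite !mulmxDr -!scalemxAr !mulmxDr mulmxN -!scalemxAr mulmx1 !mulmxA.
  rewrite Be Bsv BX BS BSl -!scalemxAl.
  move: (w^T *m w) (w^T *m sg) => A1 A2; move: (B) => B'.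
  apply/matrixP => i j; rewrite !mxE; ring.
rewrite pE qE.
have sk i j : Sl j i = - Sl i j.
  by move/matrixP: Sl_skew => /(_ i j); rewrite [LHS]mxE [RHS]mxE.
have gs i j : g j i = g i j.
  by move/matrixP: g_sym => /(_ i j); rewrite mxE.
apply/matrixP => i j; rewrite /B !mxE !big_ord1 !mxE.
rewrite (gs i j) (sk i j); ring.
Qed.

(** The matrix of P(y), grouped by the column factors y, s^i, b^i and s^i_j y^j into the shape that
    [tr_sq_affine] and the rank-four lemmas expect. *)
Definition shift_dir (a p q r : R) (y : 'cV[R]_n) : 'M[R]_n :=
  y *m (a *: sg) + sv *m ((q * (w *m y) 0 0) *: w - a *: (y^T *m g))
  + X *m ((p * (sg *m y) 0 0) *: w + (p * (w *m y) 0 0) *: sg)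
  + (S *m y) *m (r *: w)
  + (a * (sg *m y) 0 0) *: 1%:M + (r * (w *m y) 0 0) *: S.

Lemma shift_dirE (a p q r : R) (y : 'cV[R]_n) :
  \sum_j y j 0 *: shift_mx a p q r j = shift_dir a p q r y.
Proof.
have s1 (v : 'rV[R]_n) : \sum_j y j 0 * v 0 j = (v *m y) 0 0.
  by rewrite mxE; apply: eq_bigr => j _; rewrite mulrC.
have e1 : \sum_j y j 0 *: (delta_mx j 0 *m sg) = y *m sg.
  rewrite [in RHS](matrix_sum_delta y) mulmx_suml; apply: eq_bigr => j _.
  by rewrite big_ord1 -scalemxAl.
have e2 : \sum_j y j 0 *: (sv *m row j g) = sv *m (y^T *m g).
  rewrite mulmx_sum_row mulmx_sumr; apply: eq_bigr => j _.
  by rewrite -scalemxAr mxE.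
have e3 : \sum_j y j 0 *: (col j S *m w) = S *m y *m w.
  have -> : S *m y = \sum_j y j 0 *: col j S.
    apply/colP => i; rewrite mxE summxE; apply: eq_bigr => j _.
    by rewrite [RHS]mxE mulrC [in RHS]mxE.
  by rewrite mulmx_suml; apply: eq_bigr => j _; rewrite -scalemxAl.
rewrite /shift_mx /shift_dir; move: sv e2 => v e2; move: S e3 => T e3.
have s2 (c : 'rV[R]_n) (A : 'M[R]_n) : \sum_j (y j 0 * c 0 j) *: A = ((c *m y) 0 0) *: A.
  by rewrite -scaler_suml s1.
transitivity (a *: (y *m sg + (sg *m y) 0 0 *: 1%:M - v *m (y^T *m g))
  + p *: (X *m ((sg *m y) 0 0 *: w + (w *m y) 0 0 *: sg))
  + (q * (w *m y) 0 0) *: (v *m w) + r *: ((w *m y) 0 0 *: T + T *m y *m w)).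
  have -> : X *m ((sg *m y) 0 0 *: w + (w *m y) 0 0 *: sg) =
    \sum_j y j 0 *: (X *m (sg 0 j *: w + w 0 j *: sg)).
    rewrite mulmxDr -!scalemxAr -!s2 -big_split; apply: eq_bigr => j _ /=.
    by rewrite mulmxDr -!scalemxAr scalerDr !scalerA.
  rewrite -e1 -e2 -e3 -!s1.
  (* Linearity of the sum for arbitrary summands over a list, so that induction leaves only an
     identity between entries. *)
  have gen (A B C E : 'I_n -> 'M[R]_n) (s : seq 'I_n) :
    \sum_(j <- s) y j 0 *: (a *: (A j + sg 0 j *: 1%:M - B j)
      + p *: C j + (q * w 0 j) *: (v *m w) + r *: (w 0 j *: T + E j)) =
    a *: (\sum_(j <- s) y j 0 *: A j + (\sum_(j <- s) y j 0 * sg 0 j) *: 1%:M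
      - \sum_(j <- s) y j 0 *: B j) + p *: (\sum_(j <- s) y j 0 *: C j)
    + (q * \sum_(j <- s) y j 0 * w 0 j) *: (v *m w)
    + r *: ((\sum_(j <- s) y j 0 * w 0 j) *: T + \sum_(j <- s) y j 0 *: E j).
    elim: s => [|j s IH]; first by rewrite !big_nil; apply/matrixP => i m; rewrite !mxE; ring.
    rewrite !big_cons IH; move: (v *m w) => vw.
    by apply/matrixP => i m; rewrite !mxE; ring.
  exact: (gen (fun j => delta_mx j 0 *m sg) (fun j => v *m row j g)
    (fun j => X *m (sg 0 j *: w + w 0 j *: sg)) (fun j => col j T *m w)).
rewrite !mulmxDr !mulmxN -!scalemxAr.
move: (y *m sg) (v *m (y^T *m g)) (X *m w) (X *m sg) (v *m w) (T *m y *m w).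
move=> A1 A2 A3 A4 A5 A6; apply/matrixP => i j; rewrite !mxE; ring.
Qed.

Lemma mul_col_dot (c : 'cV[R]_n) (v : 'rV[R]_n) (z : 'cV[R]_n) :
  c *m v *m z = (v *m z) 0 0 *: c.
Proof. by rewrite -mulmxA [v *m z]mx11_scalar mul_mx_scalar !mxE mulr1n. Qed.

Lemma dotZ a (v : 'rV[R]_n) (z : 'cV[R]_n) :
  ((a *: v) *m z) 0 0 = a * (v *m z) 0 0.
Proof. by rewrite -scalemxAl mxE. Qed.

Lemma dotD (v v' : 'rV[R]_n) (z : 'cV[R]_n) :
  ((v + v') *m z) 0 0 = (v *m z) 0 0 + (v' *m z) 0 0.
Proof. by rewrite mulmxDl mxE. Qed.

Lemma dotN (v : 'rV[R]_n) (z : 'cV[R]_n) : ((- v) *m z) 0 0 = - (v *m z) 0 0.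
Proof. by rewrite mulNmx mxE. Qed.

Lemma shift_contract (a p q r : R) (y : 'cV[R]_n) :
  shift_dir a p q r y *m y =
  (2 * a * (sg *m y) 0 0) *: y
  + (q * (w *m y) 0 0 ^+ 2 - a * (y^T *m g *m y) 0 0) *: sv
  + (2 * p * (sg *m y) 0 0 * (w *m y) 0 0) *: X
  + (2 * r * (w *m y) 0 0) *: (S *m y).
Proof.
rewrite /shift_dir !mulmxDl !mul_col_dot !(dotD, dotN, dotZ) -!scalemxAl mul1mx.
move: sv (S *m y) ((sg *m y) 0 0) ((w *m y) 0 0) ((y^T *m g *m y) 0 0).
by move=> v v' c1 c2 c3; apply/colP => i; rewrite !mxE; ring.
Qed.

(** By symmetry of [P] this is the trace of P(v), hence the derivative along [v] of the logarithm of
    the ratio of the volume densities. For the deformation the factor n a + p b^2 + r equals 2 n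
    rho' + Delta'/Delta. *)
Lemma shift_trace (a p q r : R) (v : 'cV[R]_n) : \tr S = 0 ->
  \sum_k (shift_mx a p q r k *m v) k 0 = (n%:R * a + p * u + r) * (sg *m v) 0 0.
Proof.
move=> trS; pose s := (sg *m v) 0 0; pose c := (w *m v) 0 0.
have E k : (shift_mx a p q r k *m v) k 0 =
  a * (s + sg 0 k * v k 0 - (g *m v) k 0 * sv k 0) +
  p * (c * (sg 0 k * X k 0) + s * (w 0 k * X k 0)) +
  q * c * (w 0 k * sv k 0) + r * (w 0 k * (S *m v) k 0 + c * S k k).
  have sc c1 c2 : (c1 *: (w *m v) + c2 *: (sg *m v)) 0 0 = c1 * c + c2 * s.
    by rewrite mxE [X in X + _]mxE [X in _ + X]mxE.
  rewrite /shift_mx !mulmxDl -!scalemxAl !mulmxDl -!scalemxAl mulNmx !mul_col_dot.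
  rewrite !mulmxDl -!scalemxAl mul1mx sc -/s -/c.
  have -> : (row k g *m v) 0 0 = (g *m v) k 0 by rewrite -row_mul mxE.
  have ck : col k S k 0 = S k k by rewrite mxE.
  move: sv (S *m v) (g *m v) => v1 v2 v3; rewrite -ck; move: (col k S) => v4.
  rewrite !mxE eqxx /=; ring.
under eq_bigr do rewrite E.
have gen (f1 f2 f3 f4 f5 f6 f7 : 'I_n -> R) (l : seq 'I_n) :
  \sum_(k <- l) (a * (s + f1 k - f2 k) + p * (c * f3 k + s * f4 k) + q * c * f5 k
    + r * (f6 k + c * f7 k)) =
  a * ((\sum_(k <- l) 1) * s + \sum_(k <- l) f1 k - \sum_(k <- l) f2 k)
  + p * (c * (\sum_(k <- l) f3 k) + s * (\sum_(k <- l) f4 k))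
  + q * c * (\sum_(k <- l) f5 k) + r * (\sum_(k <- l) f6 k + c * \sum_(k <- l) f7 k).
  elim: l => [|k l IH]; first by rewrite !big_nil; ring.
  by rewrite !big_cons IH; ring.
rewrite gen.
have dot (x : 'rV[R]_n) (z : 'cV[R]_n) : \sum_k x 0 k * z k 0 = (x *m z) 0 0.
  by rewrite mxE.
have -> : \sum_k (g *m v) k 0 * sv k 0 = s.
  transitivity (((g *m v)^T *m sv) 0 0).
    by rewrite mxE; apply: eq_bigr => k _; rewrite [X in _ = X * _]mxE.
  by rewrite trmx_mul g_sym -mulmxA (mulmxA g) gG mul1mx -trmx_mul mxE.
rewrite !dot -/s w_sv sgX wX (mulmxA w) w_S -/s -[\sum_k S k k]/(\tr S) trS.
have -> : (u%:M : 'M[R]_1) 0 0 = u by rewrite mxE eqxx mulr1n.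
have -> : (0 : 'M[R]_1) 0 0 = 0 by rewrite mxE.
rewrite sumr_const card_ord; ring.
Qed.

Lemma shift_dir_sq (a p q r : R) (y : 'cV[R]_n) : \tr S = 0 ->
  let be := (w *m y) 0 0 in let s0 := (sg *m y) 0 0 in
  let al := (y^T *m g *m y) 0 0 in let t0 := (sg *m (S *m y)) 0 0 in
  let t := - (sg *m sv) 0 0 in let N := shift_dir a p q r y in
  \tr (N *m N) = (a * s0) ^+ 2 + (a * s0) ^+ 2 + (p * s0 * u) ^+ 2 + (r * s0) ^+ 2
  + 2 * (- a * t * (q * be ^+ 2 - a * al) + a * t0 * (r * be)
    - (q * be * u - a * be) * (p * be * t)
    + (p * s0 ^+ 2 + p * be * t0) * (r * u))
  + 2 * (a * s0) * (p * s0 * u + r * s0)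
  + 2 * (r * be) * (a * t0 + (a * t0 - q * be * t) + p * be * t + r * t0)
  + (a * s0) ^+ 2 * n%:R + (r * be) ^+ 2 * \tr (S *m S).
Proof.
move=> trS be s0 al t0 t N.
have y_Sl_y : (y^T *m Sl *m y) 0 0 = 0.
  have := congr1 (fun M : 'M[R]_1 => M 0 0) (erefl (y^T *m Sl *m y)^T).
  rewrite /= {1}trmx_mul trmx_mul trmxK Sl_skew mulNmx mulmxN mulmxA.
  rewrite [LHS]mxE [RHS]mxE => /eqP.
  by rewrite eq_sym -subr_eq0 opprK -mulr2n mulrn_eq0 /= => /eqP.
have g_y : (y^T *m g *m y) 0 0 = al by [].
have g_sv : (y^T *m g *m sv) 0 0 = s0.
  by rewrite -mulmxA (mulmxA g) gG mul1mx -trmx_mul mxE.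
have g_X : (y^T *m g *m X) 0 0 = be.
  by rewrite -mulmxA gX -trmx_mul mxE.
have g_Sy : (y^T *m g *m (S *m y)) 0 0 = 0.
  by rewrite -!mulmxA (mulmxA g) gG mul1mx mulmxA y_Sl_y.
have g_Ssv : (y^T *m g *m (S *m sv)) 0 0 = - t0.
  rewrite -!mulmxA (mulmxA g) gG mul1mx /t0.
  have -> : y^T *m (Sl *m (G *m sg^T)) = - (sg *m (G *m Sl *m y))^T.
    by rewrite !trmx_mul Sl_skew trG mulNmx mulmxN mulNmx opprK !mulmxA.
  by rewrite mxE [X in - X]mxE.
have s_sv : (sg *m sv) 0 0 = - t by rewrite opprK.
have s_X : (sg *m X) 0 0 = 0 by rewrite sgX mxE.
have w_sv0 : (w *m sv) 0 0 = 0 by rewrite w_sv mxE.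
have w_X : (w *m X) 0 0 = u by rewrite wX mxE eqxx mulr1n.
have w_Sz (z : 'cV[R]_n) : (w *m (S *m z)) 0 0 = (sg *m z) 0 0.
  by rewrite mulmxA w_S.
(* The scalar products of the rows and columns occurring in [shift_dir]; skewness of s_ij, or the
   relation s_i b^i = 0, is behind the zeros among them. *)
have dots := (g_y, g_sv, g_X, g_Sy, g_Ssv, s_sv, s_X, w_sv0, w_X, w_Sz).
rewrite /N /shift_dir (tr_sq_affine _ _ _ trS) tr_sq_rank4 tr_rank4 tr_mul_rank4.
rewrite S_X !mulmxN.
have dNr (v : 'rV[R]_n) (z : 'cV[R]_n) : (- (v *m z)) 0 0 = - (v *m z) 0 0 by rewrite mxE.
rewrite !(dNr, dotD, dotN, dotZ) !dots -/be -/s0 -/t0.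
move: (\tr _) => TT; ring.
Qed.

End PointAlgebra.

(** * The Ricci tensor of the deformed metric *)

Section Divergence.
Context {R : realType} {n : nat}.
Local Notation V := 'rV[R]_n.
Variables (U : set V) (g : V -> 'M[R]_n) (x : V).
Hypotheses (oU : open U) (Ux : U x).
Implicit Types Z : V -> 'cV[R]_n.

Lemma div_eq Z1 Z2 : {in U, Z1 =1 Z2} -> div g Z1 x = div g Z2 x.
Proof.
move=> Z12; rewrite div.unlock; apply: eq_bigr => k _.
by rewrite (dmx_eq oU k Ux Z12) (Z12 x (mem_set Ux)).
Qed.

Lemma divD Z1 Z2 : smooth_mx U Z1 -> smooth_mx U Z2 ->
  div g (fun z => Z1 z + Z2 z) x = div g Z1 x + div g Z2 x.
Proof.
move=> s1 s2; rewrite div.unlock -big_split; apply: eq_bigr => k _ /=.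
by rewrite (dmxD k Ux s1 s2) mulmxDr addrACA mxE.
Qed.

Lemma divN Z : smooth_mx U Z -> div g (fun z => - Z z) x = - div g Z x.
Proof.
move=> s; rewrite div.unlock -sumrN; apply: eq_bigr => k _ /=.
by rewrite (dmxN k Ux s) mulmxN -opprD mxE.
Qed.

Lemma divZ (f : V -> R) Z : smooth_on U f -> smooth_mx U Z ->
  div g (fun z => f z *: Z z) x = (grad f x *m Z x) 0 0 + f x * div g Z x.
Proof.
move=> sf sZ; rewrite div.unlock mulr_sumr [X in X + _]mxE -big_split.
apply: eq_bigr => k _ /=; rewrite (dmxZ k Ux sf sZ) -scalemxAr -addrA -scalerDr.
by rewrite mxE [X in X + _]mxE [X in _ + X]mxE.
Qed.

End Divergence.

Section ShiftedRicci.
Context {R : realType} {n : nat}.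
Local Notation V := 'rV[R]_n.
Variables (U : set V) (g h : V -> 'M[R]_n) (w : V -> 'rV[R]_n).
Hypotheses (oU : open U) (sg : smooth_mx U g).
Hypothesis g_sym : forall x, U x -> (g x)^T = g x.
Hypothesis g_unit : forall x, U x -> g x \in unitmx.
Hypothesis h_sym : forall x, U x -> (h x)^T = h x.
Hypothesis sw : smooth_mx U w.
Hypothesis killing : forall x i j, U x -> covd g w i j x + covd g w j i x = 0.

Local Notation X := (dual_vec g w).
Local Notation Sl := (nabla g w).
Local Notation G := (ginv g).
Local Notation sf := (sform g w).
Local Notation u := (normb2 g w).
Let sX : smooth_mx U X := smooth_vec oU sg g_unit sw.
Let sSl : smooth_mx U Sl := smooth_nabla oU sg g_unit sw.
Let sG : smooth_mx U G := smooth_ginv oU sg g_unit.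
Let ssf : smooth_mx U sf := smooth_sform oU sg g_unit sw killing.
Let su : smooth_on U u := smooth_normb2 oU sg g_unit sw.

Lemma gGx x : U x -> g x *m G x = 1%:M.
Proof. by move=> /g_unit; exact: mulmxV. Qed.

Lemma wXx x : U x -> w x *m X x = (u x)%:M.
Proof. by move=> Ux; rewrite [LHS]mx11_scalar -normb2E. Qed.

Variables (fa fp fq fr : R -> R).
Hypotheses (sfa : smooth_on U (fun x => fa (u x))) (sfp : smooth_on U (fun x => fp (u x))).
Hypotheses (sfq : smooth_on U (fun x => fq (u x))) (sfr : smooth_on U (fun x => fr (u x))).

Definition shift (l : 'I_n) (x : V) : 'M[R]_n :=
  shift_mx (g x) (G x) (Sl x) (X x) (w x) (sf x)
    (fa (u x)) (fp (u x)) (fq (u x)) (fr (u x)) l.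

Lemma smooth_shift l : smooth_mx U (shift l).
Proof.
have sc A : smooth_mx U A -> smooth_mx U (fun x => col l (A x) : 'cV[R]_n).
  by move=> sA; exact: smooth_col.
have sr : smooth_mx U (fun x => row l (g x)).
  by move=> i j; apply: smooth_eq (sg l j) => // x _; rewrite mxE.
have sS : smooth_mx U (fun x => G x *m Sl x) by exact: smooth_mxM.
have ssv : smooth_mx U (fun x => G x *m (sf x)^T).
  by apply: smooth_mxM => //; exact: smooth_mx_tr.
rewrite /shift /shift_mx.
apply: smooth_mxD => //; first apply: smooth_mxD => //; first apply: smooth_mxD => //.
- apply: smooth_mxZ => //.
  apply: smooth_mxB => //; last exact: smooth_mxM.
  apply: smooth_mxD => //; first by apply: smooth_mxM => //; exact: smooth_mx_cst.
  by apply: smooth_mxZ => //; exact: smooth_mx_cst.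
- apply: smooth_mxZ => //.
  by apply: smooth_mxM => //; apply: smooth_mxD => //; exact: smooth_mxZ.
- apply: smooth_mxZ => //; last exact: smooth_mxM.
  exact: smoothM.
- apply: smooth_mxZ => //.
  apply: smooth_mxD => //; first exact: smooth_mxZ.
  by apply: smooth_mxM => //; exact: sc.
Qed.

Hypothesis chr_shift : forall l x, U x -> chr h l x = chr g l x + shift l x.
Variables (x0 : V) (y : 'cV[R]_n) (lam : R).
Hypothesis Ux0 : U x0.
Hypothesis einstein : ricci g x0 = lam *: g x0.

Local Notation Y := (parallel g x0 y).
Let sY : smooth_mx U Y := smooth_parallel g x0 y oU.
Let Y0 : Y x0 = y := parallel_at g x0 y.

Lemma grad_form_parallel (v : V -> 'rV[R]_n) : smooth_mx U v ->
  grad (fun z => (v z *m Y z) 0 0) x0 = y^T *m nabla g v x0.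
Proof.
move=> sv; apply/rowP => k; rewrite grad_entry (dmxM k Ux0 sv sY).
rewrite (dmx_form oU g_sym v k Ux0) (dmx_parallel g y oU Ux0) Y0 mulmxDl mulmxN mulmxA addrK.
by rewrite !mxE; apply: eq_bigr => j _; rewrite mxE [X in X * _]mxE [X in _ = X * _]mxE mulrC.
Qed.

Lemma grad_metric_parallel :
  grad (fun z => ((Y z)^T *m g z *m Y z) 0 0) x0 = 0.
Proof.
have sYt : smooth_mx U (fun z => (Y z)^T) by exact: smooth_mx_tr.
have sYg : smooth_mx U (fun z => (Y z)^T *m g z) by exact: smooth_mxM.
apply/rowP => k; rewrite grad_entry (dmxM k Ux0 sYg sY) (dmxM k Ux0 sYt sg).
rewrite dmx_tr (dmx_parallel g y oU Ux0) Y0 (dmx_metric oU g_sym g_unit k Ux0).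
rewrite raddfN /= !(trmx_mul (chr _ _ _)) !(trmx_mul (g x0)) g_sym//.
have gen (a b c : 'rV[R]_n) (C : 'M[R]_n) (z : 'cV[R]_n) : a = b ->
  ((- a + (c *m C + b)) *m z + c *m (- (C *m z))) 0 0 = 0.
  move=> ->; rewrite addrC -[- b + _]addrC addrK mulmxN mulmxA addNr.
  by rewrite mxE.
rewrite [RHS]mxE mulNmx mulmxDr [y^T *m (_ *m _)]mulmxA [y^T *m (_^T *m _)]mulmxA.
exact: gen.
Qed.

Local Notation S0 := (G x0 *m Sl x0).
Local Notation s0 := ((sf x0 *m y) 0 0).
Local Notation be := ((w x0 *m y) 0 0).
Local Notation al := ((y^T *m g x0 *m y) 0 0).
Local Notation t0 := ((sf x0 *m (S0 *m y)) 0 0).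
Local Notation t := (- (sf x0 *m (G x0 *m (sf x0)^T)) 0 0).
Local Notation tr := (\tr (S0 *m S0)).
Local Notation t00 := ((y^T *m Sl x0 *m (S0 *m y)) 0 0).
Local Notation s00 := ((y^T *m nabla g sf x0 *m y) 0 0).
Local Notation u0 := (u x0).

Lemma div_parallel : div g Y x0 = 0.
Proof.
rewrite div.unlock big1// => k _.
by rewrite (cov_parallel g y oU Ux0) mxE.
Qed.

Lemma div_vec : div g X x0 = 0.
Proof.
rewrite div.unlock -[RHS](tr_skew g_sym killing Ux0).
apply: eq_bigr => k _; rewrite (cov_vec oU sg g_sym g_unit sw k Ux0).
by rewrite colE mulmxA -colE mxE.
Qed.

(** Since s^i = - s^i_j b^j, [div_skew] applies with [Z] the dual field: the Ricci term gives [lam]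
    b^2, and the derivative of b^j, being again s^i_j, gives the trace of the square. *)
Lemma div_sv : div g (fun x => G x *m (sf x)^T) x0 = - (lam * u0 + tr).
Proof.
have E : {in U, (fun x => G x *m (sf x)^T) =1 (fun x => - (G x *m Sl x *m X x))}.
  move=> x /set_mem Ux; rewrite -mulmxA (vec_skew killing Ux).
  by rewrite mulmxN opprK.
have sSX : smooth_mx U (fun x => G x *m Sl x *m X x).
  by apply: smooth_mxM => //; exact: smooth_mxM.
rewrite (div_eq g oU Ux0 E) (divN g Ux0 sSX); congr (- _).
rewrite (div_skew oU sg g_sym g_unit sw killing Ux0 sX) einstein; congr (_ + _).
  rewrite -scalemxAr -scalemxAl mxE; congr (_ * _).
  by rewrite (Xg (g_sym Ux0) (metric_vec w g_unit Ux0)) normb2E.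
apply: eq_bigr => k _; rewrite (cov_vec oU sg g_sym g_unit sw k Ux0).
by rewrite colE (mulmxA (G x0)) (mulmxA (G x0 *m _)) -colE [LHS]mxE.
Qed.

Lemma div_SY : div g (fun x => G x *m Sl x *m Y x) x0 = lam * be.
Proof.
rewrite (div_skew oU sg g_sym g_unit sw killing Ux0 sY) einstein.
rewrite [X in _ + X]big1 => [|k _].
  rewrite Y0 addr0 -scalemxAr -scalemxAl mxE; congr (_ * _).
  by rewrite (Xg (g_sym Ux0) (metric_vec w g_unit Ux0)).
by rewrite (cov_parallel g y oU Ux0) mulmx0 mxE.
Qed.

Let gu : grad u x0 = 2 *: sf x0 := grad_normb2 oU sg g_sym g_unit sw killing Ux0.

Lemma grad_fun_u (phi : R -> R) : derivable phi u0 1 ->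
  grad (fun x => phi (u x)) x0 = (2 * derive1 phi u0) *: sf x0.
Proof.
by move=> dphi; rewrite (grad_comp Ux0 dphi su) gu scalerA mulrC.
Qed.

Hypotheses (dfa : derivable fa u0 1) (dfp : derivable fp u0 1).
Hypotheses (dfq : derivable fq u0 1) (dfr : derivable fr u0 1).

Local Notation fA := (fun x => (sf x *m Y x) 0 0).
Local Notation fB := (fun x => (w x *m Y x) 0 0).
Local Notation fC := (fun x => ((Y x)^T *m g x *m Y x) 0 0).

Let sA : smooth_on U fA. Proof. exact: (smooth_mxM oU ssf sY). Qed.
Let sB : smooth_on U fB. Proof. exact: (smooth_mxM oU sw sY). Qed.
Let sC : smooth_on U fC.
Proof.
apply: (smooth_mxM oU _ sY); apply: smooth_mxM => //; exact: smooth_mx_tr.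
Qed.
Let gA : grad fA x0 = y^T *m nabla g sf x0 := grad_form_parallel ssf.
Let gB : grad fB x0 = y^T *m Sl x0 := grad_form_parallel sw.

Let dot_gA_vec : (y^T *m nabla g sf x0 *m X x0) 0 0 = - t0.
Proof.
have E : (nabla g sf x0)^T *m X x0 = - (sf x0 *m S0)^T.
  apply/row_matrixP => l; rewrite row_mul -tr_col (hess_vec oU sg g_sym g_unit sw killing l Ux0).
  by apply/rowP => i; rewrite !ord1 [RHS]mxE [RHS]mxE [in RHS]mxE colE !mulmxA -colE !mxE.
have hs : (nabla g sf x0)^T = nabla g sf x0.
  by apply/matrixP => i j; rewrite mxE (hess_sym oU sg g_sym g_unit sw killing _ _ Ux0).
rewrite -mulmxA -{1}hs E mulmxN -trmx_mul.
by rewrite [LHS]mxE [X in - X]mxE !mulmxA.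
Qed.

Let dot_gB_sv : (y^T *m Sl x0 *m (G x0 *m (sf x0)^T)) 0 0 = - t0.
Proof.
have -> : y^T *m Sl x0 *m (G x0 *m (sf x0)^T) = - (sf x0 *m (S0 *m y))^T.
  by rewrite !trmx_mul (nabla_tr killing Ux0) (ginv_sym g_sym Ux0) mulNmx mulmxN mulNmx
    opprK !mulmxA.
by rewrite [LHS]mxE [X in - X]mxE.
Qed.

Let dot_gB_vec : (y^T *m Sl x0 *m X x0) 0 0 = - s0.
Proof.
rewrite -mulmxA (vec_skew killing Ux0) mulmxN -trmx_mul.
by rewrite [LHS]mxE [X in - X]mxE.
Qed.

(** By [shift_contract] the field P(Y, Y) combines [Y], s^i, b^i and s^i_j Y^j with scalar
    coefficients. Its divergence consists of the derivatives of these coefficients along the four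
    fields and of the four divergences 0, -([lam] b^2 + [tr]), 0 and [lam] beta. The terms are left
    uncollected, because the coefficient functions are still arbitrary. *)
Lemma ricci_shifted :
  let a0 := fa u0 in let a1 : R := derive1 fa u0 in
  let p0 := fp u0 in let p1 : R := derive1 fp u0 in
  let q0 := fq u0 in let q1 : R := derive1 fq u0 in
  let r0 := fr u0 in let r1 : R := derive1 fr u0 in
  let f0 := n%:R * a0 + p0 * u0 + r0 in
  let f1 : R := n%:R * a1 + (p1 * u0 + p0) + r1 in
  (y^T *m ricci h x0 *m y) 0 0 = lam * al
  + 2 * (2 * a1 * s0 ^+ 2 + a0 * s00)
  + (- t) * (2 * q1 * be ^+ 2 - 2 * a1 * al) + 2 * q0 * be * (- t0)
  - (q0 * be ^+ 2 - a0 * al) * (lam * u0 + tr)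
  + 2 * p0 * (be * - t0 + s0 * - s0)
  + 2 * (2 * r1 * be * t0 + r0 * t00) + 2 * r0 * be * (lam * be)
  - (2 * f1 * s0 ^+ 2 + f0 * s00)
  + f0 * (2 * a0 * s0 ^+ 2 - (q0 * be ^+ 2 - a0 * al) * t + 2 * r0 * be * t0)
  - ((a0 * s0) ^+ 2 + (a0 * s0) ^+ 2 + (p0 * s0 * u0) ^+ 2 + (r0 * s0) ^+ 2
  + 2 * (- a0 * t * (q0 * be ^+ 2 - a0 * al) + a0 * t0 * (r0 * be)
    - (q0 * be * u0 - a0 * be) * (p0 * be * t)
    + (p0 * s0 ^+ 2 + p0 * be * t0) * (r0 * u0))
  + 2 * (a0 * s0) * (p0 * s0 * u0 + r0 * s0)
  + 2 * (r0 * be) * (a0 * t0 + (a0 * t0 - q0 * be * t) + p0 * be * t + r0 * t0)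
  + (a0 * s0) ^+ 2 * n%:R + (r0 * be) ^+ 2 * tr).
Proof.
move=> a0 a1 p0 p1 q0 q1 r0 r1 f0 f1.
rewrite (ricci_shift oU sg g_sym h_sym g_unit smooth_shift chr_shift y Ux0) einstein.
have Eal : (y^T *m (lam *: g x0) *m y) 0 0 = lam * al.
  by rewrite -scalemxAr -scalemxAl mxE.
rewrite Eal.
have gGx0 := gGx Ux0; have gs0 := g_sym Ux0; have skx := nabla_tr killing Ux0.
have gX0 := metric_vec w g_unit Ux0; have sE0 := sformE killing Ux0.
have wX0 := wXx Ux0; have sX0 := sform_vec killing Ux0.
have trS := tr_skew g_sym killing Ux0.
have Sdir (x : V) (z : 'cV[R]_n) : \sum_j z j 0 *: shift j x =
    shift_dir (g x) (G x) (Sl x) (X x) (w x) (sf x) (fa (u x)) (fp (u x)) (fq (u x)) (fr (u x)) z.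
  exact: shift_dirE.
rewrite Sdir (shift_dir_sq gGx0 gs0 skx gX0 sE0 wX0 sX0 _ _ _ _ _ trS) shift_contract.
rewrite (shift_trace gGx0 gs0 gX0 sE0 wX0 sX0 _ _ _ _ _ trS).
rewrite -/a0 -/p0 -/q0 -/r0.
have ssv : smooth_mx U (fun x => G x *m (sf x)^T).
  by apply: smooth_mxM => //; exact: smooth_mx_tr.
have sSY : smooth_mx U (fun x => G x *m Sl x *m Y x).
  by apply: smooth_mxM => //; exact: smooth_mxM.
have s2 := smooth_cst U (2 : R).
have s2a := smoothM oU s2 sfa; have s2p := smoothM oU s2 sfp.
have s2r := smoothM oU s2 sfr.
have s1 := smoothM oU s2a sA.
have sqB := smoothM oU sfq (smoothM oU sB sB).
have saC := smoothM oU sfa sC.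
have s22 := smoothB oU sqB saC.
have s2pA := smoothM oU s2p sA.
have s3 := smoothM oU s2pA sB.
have s4 := smoothM oU s2r sB.
have EV : {in U, (fun x => \sum_j Y x j 0 *: (shift j x *m Y x)) =1 (fun x =>
    (2 * fa (u x) * fA x) *: Y x
    + (fq (u x) * (fB x * fB x) - fa (u x) * fC x) *: (G x *m (sf x)^T)
    + (2 * fp (u x) * fA x * fB x) *: X x + (2 * fr (u x) * fB x) *: (G x *m Sl x *m Y x))}.
  move=> x _; under eq_bigr do rewrite scalemxAl.
  by rewrite -mulmx_suml Sdir shift_contract expr2.
rewrite (div_eq g oU Ux0 EV).
rewrite (divD g Ux0 (smooth_mxD oU (smooth_mxD oU (smooth_mxZ oU s1 sY)
  (smooth_mxZ oU s22 ssv)) (smooth_mxZ oU s3 sX)) (smooth_mxZ oU s4 sSY)).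
rewrite (divD g Ux0 (smooth_mxD oU (smooth_mxZ oU s1 sY)
  (smooth_mxZ oU s22 ssv)) (smooth_mxZ oU s3 sX)).
rewrite (divD g Ux0 (smooth_mxZ oU s1 sY) (smooth_mxZ oU s22 ssv)).
rewrite (divZ g Ux0 s1 sY) (divZ g Ux0 s22 ssv) (divZ g Ux0 s3 sX) (divZ g Ux0 s4 sSY).
rewrite div_parallel div_vec div_sv div_SY.
(* The trace of P(Y) is [F] times s_i Y^i, so its derivative along [y] produces [f1] from [F] and
   s_{0|0} from the second factor. *)
pose F x := n%:R * fa (u x) + fp (u x) * u x + fr (u x).
have sna := smoothM oU (smooth_cst U (n%:R : R)) sfa.
have spu := smoothM oU sfp su.
have snp := smoothD oU sna spu.
have sF : smooth_on U F := smoothD oU snp sfr.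
have ET : {in U, (fun x => \sum_k (shift k x *m Y x) k 0) =1 (fun x => F x * fA x)}.
  move=> x /set_mem Ux; have trSx := tr_skew g_sym killing Ux.
  exact: (shift_trace (gGx Ux) (g_sym Ux) (metric_vec w g_unit Ux)
    (sformE killing Ux) (wXx Ux) (sform_vec killing Ux) _ _ _ _ _ trSx).
rewrite (grad_eq oU Ux0 ET) (gradM Ux0 sF sA).
have gF : grad F x0 = (2 * f1) *: sf x0.
  rewrite /F (gradD Ux0 snp sfr) (gradD Ux0 sna spu).
  rewrite (gradM Ux0 (smooth_cst U (n%:R : R)) sfa) (gradM Ux0 sfp su) gu.
  rewrite grad_cst scaler0 add0r (grad_fun_u dfa) (grad_fun_u dfp) (grad_fun_u dfr).
  rewrite /f1 -/a1 -/p1 -/r1 -/p0; move: (sf x0) => v.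
  by apply/rowP => k; rewrite !mxE; ring.
have g2 (phi : R -> R) : smooth_on U (fun x => phi (u x)) -> derivable phi u0 1 ->
    grad (fun x => 2 * phi (u x)) x0 = (4 * derive1 phi u0) *: sf x0.
  move=> sphi dphi; rewrite (gradM Ux0 s2 sphi) (grad_fun_u dphi).
  by rewrite grad_cst scaler0 add0r scalerA; congr (_ *: _); ring.
have e1 : grad (fun x => 2 * fa (u x) * fA x) x0 =
    (4 * a1 * s0) *: sf x0 + (2 * a0) *: (y^T *m nabla g sf x0).
  rewrite (gradM Ux0 s2a sA) (g2 _ sfa dfa) gA Y0 scalerA; congr (_ *: _ + _).
  by rewrite mulrC.
have e2 : grad (fun x => fq (u x) * (fB x * fB x) - fa (u x) * fC x) x0 =
    (2 * q1 * be ^+ 2 - 2 * a1 * al) *: sf x0 + (2 * q0 * be) *: (y^T *m Sl x0).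
  rewrite (gradB Ux0 sqB saC) (gradM Ux0 sfq (smoothM oU sB sB)) (gradM Ux0 sB sB).
  rewrite (gradM Ux0 sfa sC) grad_metric_parallel scaler0 addr0.
  rewrite (grad_fun_u dfa) (grad_fun_u dfq) gB Y0 -/q0 -/q1 -/a1.
  move: (sf x0) (y^T *m Sl x0) be al => v1 v2 c1 c2.
  by apply/rowP => k; rewrite !mxE; ring.
have e3 : grad (fun x => 2 * fp (u x) * fA x * fB x) x0 =
    (4 * p1 * s0 * be) *: sf x0 + (2 * p0 * be) *: (y^T *m nabla g sf x0)
    + (2 * p0 * s0) *: (y^T *m Sl x0).
  rewrite (gradM Ux0 s2pA sB) (gradM Ux0 s2p sA) (g2 _ sfp dfp) gA gB Y0 -/p0 -/p1.
  move: (sf x0 *m y) be => c1 c2; move: (sf x0) (y^T *m Sl x0) (y^T *m nabla g sf x0).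
  by move=> v1 v2 v3; apply/rowP => k; rewrite !mxE; ring.
have e4 : grad (fun x => 2 * fr (u x) * fB x) x0 =
    (4 * r1 * be) *: sf x0 + (2 * r0) *: (y^T *m Sl x0).
  rewrite (gradM Ux0 s2r sB) (g2 _ sfr dfr) gB Y0 scalerA; congr (_ *: _ + _).
  by rewrite mulrC.
have s_vec : (sf x0 *m X x0) 0 0 = 0 by rewrite sX0 mxE.
have eQ c1 c2 c3 c4 : (sf x0 *m (c1 *: y + c2 *: (G x0 *m (sf x0)^T) + c3 *: X x0
    + c4 *: (S0 *m y))) 0 0 = c1 * s0 + c2 * (- t) + c4 * t0.
  have gen (A1 A2 A3 A4 : 'M[R]_1) : (c1 *: A1 + c2 *: A2 + c3 *: A3 + c4 *: A4) 0 0 =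
    c1 * A1 0 0 + c2 * A2 0 0 + c3 * A3 0 0 + c4 * A4 0 0 by rewrite !mxE.
  rewrite !mulmxDr -!scalemxAr gen s_vec; ring.
rewrite e1 e2 e3 e4 gF gA eQ !Y0 !(dotD, dotN, dotZ) s_vec dot_gA_vec dot_gB_vec dot_gB_sv.
rewrite -/a0 -/p0 -/q0 -/r0 -/f0 /F -/a0 -/p0 -/r0 -/f0.
move: (s0) (be) (al) (t0) (tr) (t00) (s00) => ss bb aa tt0 ttr tt00 ss00.
move: (sf x0 *m _) => m; move: (m 0 0) (f0) (f1) (a0) (a1) (p0) (p1).
by move: (q0) (q1) (r0) (r1) => e5 e6 e7 e8 tt b1 b2 b3 b4 b5 b6; ring.
Qed.

End ShiftedRicci.

(** * The scalar identity that collects the coefficients E_1, ..., E_6 *)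

Section FinalAlgebra.
Context {R : realType}.

(* At a point, with [u] = b^2, [al] = alpha^2, [e] = e^(2 rho) and [r1], [r2], [k], [k1], [k2]
   for rho', rho'', kappa, kappa', kappa''. *)
Lemma einstein_identity (n mu mubar u al be s0 t0 t tr t00 s00 r1 r2 k k1 k2 e : R) :
  u != 0 -> 1 - u * k != 0 ->
  let lam := (n - 1) * mu in
  let D := 1 - u * k in let D' := - (k + u * k1) in let D'' := - (2 * k1 + u * k2) in
  let a0 := 2 * r1 in let a1 := 2 * r2 in
  let p0 := (- k1 - k ^+ 2) / D in
  let p1 := (- k2 - 2 * k * k1) / D - (- k1 - k ^+ 2) * D' / D ^+ 2 in
  let q0 := k1 + k * (2 * r1) in let q1 := k2 + k1 * (2 * r1) + k * (2 * r2) in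
  let r0 := - k in let r1' := - k1 in
  let f0 := n * a0 + p0 * u + r0 in
  let f1 := n * a1 + (p1 * u + p0) + r1' in
  lam * al
  + 2 * (2 * a1 * s0 ^+ 2 + a0 * s00)
  + (- t) * (2 * q1 * be ^+ 2 - 2 * a1 * al) + 2 * q0 * be * (- t0)
  - (q0 * be ^+ 2 - a0 * al) * (lam * u + tr)
  + 2 * p0 * (be * - t0 + s0 * - s0)
  + 2 * (2 * r1' * be * t0 + r0 * t00) + 2 * r0 * be * (lam * be)
  - (2 * f1 * s0 ^+ 2 + f0 * s00)
  + f0 * (2 * a0 * s0 ^+ 2 - (q0 * be ^+ 2 - a0 * al) * t + 2 * r0 * be * t0)
  - ((a0 * s0) ^+ 2 + (a0 * s0) ^+ 2 + (p0 * s0 * u) ^+ 2 + (r0 * s0) ^+ 2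
  + 2 * (- a0 * t * (q0 * be ^+ 2 - a0 * al) + a0 * t0 * (r0 * be)
    - (q0 * be * u - a0 * be) * (p0 * be * t)
    + (p0 * s0 ^+ 2 + p0 * be * t0) * (r0 * u))
  + 2 * (a0 * s0) * (p0 * s0 * u + r0 * s0)
  + 2 * (r0 * be) * (a0 * t0 + (a0 * t0 - q0 * be * t) + p0 * be * t + r0 * t0)
  + (a0 * s0) ^+ 2 * n + (r0 * be) ^+ 2 * tr)
  - (n - 1) * mubar * (e * (al - k * be ^+ 2)) =
  (2 * r1 * tr
   + 2 * (D' / D * r1 + 2 * (n - 2) * r1 ^+ 2 + 2 * r2) * t
   + (n - 1) * mu * (1 + 2 * u * r1)
   - (n - 1) * mubar * e) * al
  + (- (1 / u ^+ 2)
    * (D ^+ 2 - 1 - u * D' - (D - 1) * (1 + 2 * u * r1)) * tr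
  + 1 / (u ^+ 3 * D)
    * (2 * D * (D ^+ 2 - 1) - u * (5 * D - 1) * D' - u ^+ 2 * D' ^+ 2
       + 2 * u ^+ 2 * D * D'' - 2 * (n - 2) * u * D * (D - 1) * r1
       + 2 * u ^+ 2 * ((n - 1) * D - 1) * D' * r1
       + 4 * (n - 2) * u ^+ 2 * D * (D - 1) * r1 ^+ 2
       + 4 * u ^+ 2 * D * (D - 1) * r2) * t
  + (n - 1) / u * mu * (u * D' + (D - 1) * (1 + 2 * u * r1))
  - (n - 1) / u * mubar * (D - 1) * e) * be ^+ 2
  + (2 / u ^+ 2 * (D - 1) - 2 * D' / (u * D) + D' ^+ 2 / D ^+ 2 - 2 / D * D''
  + 4 * (n - 2) * (r1 ^+ 2 - r2)) * s0 ^+ 2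
  + (2 / u * (D - 1)) * t00
  + (- (4 / u ^+ 2) * (D - 1) + 2 / (u * D) * (3 * D - 1) * D'
  + 4 / u * (n - 2) * (D - 1) * r1) * be * t0
  + (- (D' / D) - 2 * (n - 2) * r1) * s00.
Proof.
move=> u0 D0 lam D D' D'' a0 a1 p0 p1 q0 q1 r0 r1' f0 f1.
rewrite /f1 /f0 /p0 /p1 /q0 /q1 /a0 /a1 /r0 /r1' /lam /D' /D'' /D.
(* The scalars [al], [be], [s0], [t0], [t], [tr], [t00], [s00] are free, so this compares
   coefficient by coefficient. As D - 1 = - u k, the negative powers of [u] in the E_i all cancel
   once [D] is expanded; the coefficients on the left have only [D] in the denominator. *)
field.
by rewrite u0 D0.
Qed.

End FinalAlgebra.

(** * Connection and Einstein defect of the deformed metric over an open set of coordinates *)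

Section Deformation.
Context {R : realType} {n : nat}.
Local Notation V := 'rV[R]_n.
Variables (U : set V) (g : V -> 'M[R]_n) (w : V -> 'rV[R]_n).
Hypotheses (oU : open U) (sg : smooth_mx U g).
Hypothesis g_sym : forall x, U x -> (g x)^T = g x.
Hypothesis g_unit : forall x, U x -> g x \in unitmx.
Hypothesis sw : smooth_mx U w.
Local Notation u := (normb2 g w).
Local Notation Sl := (nabla g w).
Local Notation sf := (sform g w).
Variables (D : set R) (rho kappa : R -> R).
Hypotheses (oD : open D) (uD : forall x, U x -> D (u x)).
Hypotheses (rho_smooth : smooth1_on D rho) (kappa_smooth : smooth1_on D kappa).
Hypothesis Delta_neq0 : forall x, U x -> Delta kappa (u x) != 0.

Definition deformed (x : V) : 'M[R]_n :=
  expR (rho (u x)) ^+ 2 *: (g x - kappa (u x) *: ((w x)^T *m w x)).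

Let su : smooth_on U u := smooth_normb2 oU sg g_unit sw.

Lemma smooth_fun_u (phi : R -> R) : smooth1_on D phi ->
  smooth_on U (fun x => phi (u x)).
Proof. by move=> sphi; exact: smooth_comp oU oD sphi uD su. Qed.

Lemma smooth1_derive (phi : R -> R) : smooth1_on D phi -> smooth1_on D (derive1 phi).
Proof. by move=> s k v Dv; rewrite -derive1Sn; exact: s. Qed.

Lemma smooth1_expR : smooth1_on setT (@expR R).
Proof.
have dE : derive1 (@expR R) = expR.
  by apply/funext => v; rewrite derive1E; exact: derive_val.
have dnE k : derive1n k (@expR R) = expR by elim: k => // k IH; rewrite derive1nS IH.
by move=> k v _; rewrite dnE; exact: derivable_expR.
Qed.

Let sr := smooth_fun_u rho_smooth.
Let sk := smooth_fun_u kappa_smooth.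
Let sr1 := smooth_fun_u (smooth1_derive rho_smooth).
Let sk1 := smooth_fun_u (smooth1_derive kappa_smooth).

Lemma smooth_scale : smooth_on U (fun x => expR (rho (u x)) ^+ 2).
Proof.
by apply: smoothX => //; exact: smooth_comp oU openT smooth1_expR (fun _ _ => I) sr.
Qed.

Lemma smooth_Delta : smooth_on U (fun x => Delta kappa (u x)).
Proof. by apply: smoothB => //; [exact: smooth_cst|exact: smoothM]. Qed.

Lemma smooth_deformed : smooth_mx U deformed.
Proof.
apply: smooth_mxZ => //; first exact: smooth_scale.
apply: smooth_mxB => //; apply: smooth_mxZ => //.
by apply: smooth_mxM => //; exact: smooth_mx_tr.
Qed.

Lemma deformed_sym x : U x -> (deformed x)^T = deformed x.
Proof.
move=> Ux; rewrite /deformed linearZ /= raddfB /= linearZ /= trmx_mul trmxK.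
by rewrite g_sym.
Qed.

(* The coefficients, in [shift_mx], of the difference of the two Levi-Civita connections;
   [shift_compat] determines them. *)
Definition cf_a (v : R) : R := 2 * derive1 rho v.
Definition cf_r (v : R) : R := - kappa v.
Definition cf_p (v : R) : R := (- derive1 kappa v - kappa v ^+ 2) * (Delta kappa v)^-1.
Definition cf_q (v : R) : R := derive1 kappa v + kappa v * (2 * derive1 rho v).

Section Values.
Variables (v : R).
Hypotheses (Dv : D v) (Dn0 : Delta kappa v != 0).

Let ir : is_derive v (1 : R) rho (derive1 rho v).
Proof. by rewrite derive1E; apply: derivableP; exact: (@rho_smooth 0%N v Dv). Qed.
Let ir1 : is_derive v (1 : R) (derive1 rho) (derive1n 2 rho v).
Proof. by rewrite derive1nS derive1E; apply: derivableP; exact: (@rho_smooth 1%N v Dv). Qed.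
Let ik : is_derive v (1 : R) kappa (derive1 kappa v).
Proof. by rewrite derive1E; apply: derivableP; exact: (@kappa_smooth 0%N v Dv). Qed.
Let ik1 : is_derive v (1 : R) (derive1 kappa) (derive1n 2 kappa v).
Proof. by rewrite derive1nS derive1E; apply: derivableP; exact: (@kappa_smooth 1%N v Dv). Qed.

Let idM (f h : R -> R) a b : is_derive v (1 : R) f a -> is_derive v (1 : R) h b ->
  is_derive v (1 : R) (fun z => f z * h z) (a * h v + f v * b).
Proof.
move=> df dh; apply: is_derive_eq (is_deriveM df dh) _.
by rewrite addrC; congr (_ + _); exact: mulrC.
Qed.

Let idD (f h : R -> R) a b : is_derive v (1 : R) f a -> is_derive v (1 : R) h b ->
  is_derive v (1 : R) (fun z => f z + h z) (a + b).
Proof. by move=> df dh; exact: is_deriveD. Qed.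

Lemma is_derive_cf_a : is_derive v (1 : R) cf_a (2 * derive1n 2 rho v).
Proof.
by apply: is_derive_eq (idM (is_derive_cst (2 : R) v 1) ir1) _; rewrite mul0r add0r.
Qed.

Lemma is_derive_cf_r : is_derive v (1 : R) cf_r (- derive1 kappa v).
Proof. exact: is_deriveN. Qed.

Lemma is_derive_Delta :
  is_derive v (1 : R) (Delta kappa) (- (kappa v + v * derive1 kappa v)).
Proof.
apply: is_derive_eq (is_deriveB (is_derive_cst (1 : R) v 1) (idM (is_derive_id v 1) ik)) _.
by rewrite sub0r mul1r.
Qed.

Lemma is_derive_cf_p : is_derive v (1 : R) cf_p
  ((- derive1n 2 kappa v - 2 * kappa v * derive1 kappa v) / Delta kappa v
   - (- derive1 kappa v - kappa v ^+ 2) * (- (kappa v + v * derive1 kappa v))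
     / Delta kappa v ^+ 2).
Proof.
have num : is_derive v (1 : R) (fun z => - derive1 kappa z - kappa z * kappa z)
    (- derive1n 2 kappa v - 2 * kappa v * derive1 kappa v).
  apply: is_derive_eq (is_deriveB (is_deriveN ik1) (idM ik ik)) _; ring.
have dD := is_derive_Delta.
apply: is_derive_eq (idM num (is_deriveV Dn0 dD)) _.
rewrite -[_ *: _]/(_ * _) -exprVn expr2; field.
exact: Dn0.
Qed.

Lemma is_derive_cf_q : is_derive v (1 : R) cf_q
  (derive1n 2 kappa v + derive1 kappa v * (2 * derive1 rho v)
   + kappa v * (2 * derive1n 2 rho v)).
Proof.
apply: is_derive_eq (idD ik1 (idM ik is_derive_cf_a)) _.
by rewrite /cf_a addrA.
Qed.

Lemma derive1_Delta : derive1 (Delta kappa) v = - (kappa v + v * derive1 kappa v).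
Proof. by rewrite derive1E; have [_ ->] := is_derive_Delta. Qed.

Lemma is_derive_scale : is_derive v (1 : R) (fun z => expR (rho z) ^+ 2)
  (cf_a v * expR (rho v) ^+ 2).
Proof.
have ie : is_derive v (1 : R) (fun z => expR (rho z)) (expR (rho v) * derive1 rho v).
  exact: (is_derive1_comp (is_derive_expR (rho v)) ir).
by apply: is_derive_eq (idM ie ie) _; rewrite /cf_a; ring.
Qed.

Lemma is_derive_deltap : is_derive v (1 : R) (fun z => - (kappa z + z * derive1 kappa z))
  (- (2 * derive1 kappa v + v * derive1n 2 kappa v)).
Proof.
apply: is_derive_eq (is_deriveN (idD ik (idM (is_derive_id v 1) ik1))) _.
by rewrite mul1r addrA -mulr2n mulr_natl.
Qed.

End Values.

Lemma derive1n2_Delta v : D v -> derive1n 2 (Delta kappa) v =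
  - (2 * derive1 kappa v + v * derive1n 2 kappa v).
Proof.
move=> Dv; rewrite derive1nS derive1E -[RHS](@derive_val _ _ _ _ _ _ _ (is_derive_deltap Dv)).
apply: near_eq_derive; have := open_nbhs_nbhs (conj oD Dv).
by apply: filter_app; near=> z => Dz; exact: (derive1_Delta Dz).
Unshelve. all: by end_near. Qed.

Local Notation X := (dual_vec g w).
Local Notation G := (ginv g).
Hypothesis killing : forall x i j, U x -> covd g w i j x + covd g w j i x = 0.
Hypothesis h_unit : forall x, U x -> deformed x \in unitmx.

Local Notation shift := (shift g w cf_a cf_p cf_q cf_r).

(** By [chr_unique] only symmetry and compatibility have to be checked. In the derivative of the
    deformed metric the terms with [chr g] occur on both sides; what is left is the derivative of
    the conformal factor, of kappa(b^2) and of beta, which is [shift_compat]. *)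
Lemma chr_deformed l x : U x -> chr deformed l x = chr g l x + shift l x.
Proof.
move=> Ux; apply: (chr_unique h_unit Ux (C := fun l => chr g l x + shift l x)).
  move=> i k m; rewrite [LHS]mxE [RHS]mxE (chrC oU g_sym i k m Ux); congr (_ + _).
  exact: shift_mx_sym (g_sym Ux) _ _ _ _ _ _ _.
move=> {}l; pose E := expR (rho (u x)) ^+ 2; pose q := (w x)^T *m w x.
pose B := g x + cf_r (u x) *: q.
have hE : deformed x = E *: B by rewrite /deformed /B scaleNr.
have sq : smooth_mx U (fun z => (w z)^T *m w z).
  by apply: smooth_mxM => //; exact: smooth_mx_tr.
have skq := smooth_mxZ oU sk sq.
have gu := grad_normb2 oU sg g_sym g_unit sw killing Ux.
have ge : grad (fun z => expR (rho (u z)) ^+ 2) x = (2 * cf_a (u x) * E) *: sf x.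
  have dE := is_derive_scale (uD Ux).
  rewrite (grad_comp (phi := fun v => expR (rho v) ^+ 2) Ux _ su) //.
  by rewrite derive1E (@derive_val _ _ _ _ _ _ _ dE) -/E gu scalerA; congr (_ *: _); ring.
have gk : grad (fun z => kappa (u z)) x = (2 * derive1 kappa (u x)) *: sf x.
  rewrite (grad_comp Ux _ su); last exact: (@kappa_smooth 0%N _ (uD Ux)).
  by rewrite gu scalerA mulrC.
have dh : dmx l deformed x = (2 * cf_a (u x) * E * sf x 0 l) *: B
   + E *: (dmx l g x - ((2 * derive1 kappa (u x) * sf x 0 l) *: q + kappa (u x) *:
      (((col l (Sl x))^T + w x *m chr g l x)^T *m w x
       + (w x)^T *m ((col l (Sl x))^T + w x *m chr g l x)))).
  rewrite /deformed (dmxZ l Ux smooth_scale (smooth_mxB oU sg skq)) ge.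
  rewrite (dmxB oU l Ux sg skq) (dmxZ l Ux sk sq) gk.
  rewrite (dmxM l Ux (smooth_mx_tr oU sw) sw) dmx_tr (dmx_form oU g_sym w l Ux).
  by rewrite ![(_ *: sf x) 0 l]mxE -/E /B /cf_r scaleNr.
have comp := shift_compat (gGx g_unit Ux) (g_sym Ux) (nabla_tr killing Ux)
  (metric_vec w g_unit Ux) (sformE killing Ux) (wXx g w Ux) (sform_vec killing Ux)
  (a := cf_a (u x)) (p := cf_p (u x)) (q := cf_q (u x)) (r := cf_r (u x))
  (r' := - derive1 kappa (u x)) l.
have pE : cf_p (u x) * (1 + cf_r (u x) * u x) =
    - derive1 kappa (u x) - cf_r (u x) ^+ 2.
  rewrite (_ : 1 + _ = Delta kappa (u x)); last by rewrite /cf_r /Delta; ring.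
  by rewrite /cf_p mulfVK ?Delta_neq0// /cf_r sqrrN.
have qE : cf_q (u x) = - (- derive1 kappa (u x) + cf_r (u x) * cf_a (u x)).
  by rewrite /cf_q /cf_r /cf_a; ring.
have {}comp := comp pE qE; rewrite /= -/q -/B -[shift_mx _ _ _ _ _ _ _ _ _ _ _]/(shift l x) in comp.
have gen (e a s k1 k : R) (b gC gCt q' sw' wst c1 c2 M Mt : 'M[R]_n) :
    M + Mt = (2 * a * s) *: b + (2 * - k1 * s) *: q' + (- k) *: (sw' + wst) ->
    (2 * a * e * s) *: b
      + e *: (gC + gCt - ((2 * k1 * s) *: q' + k *: (sw' + c2 + (wst + c1)))) =
    e *: (gC + (- k) *: c1 + M + (gCt + (- k) *: c2 + Mt)).
  move=> /(canRL (addKr _)) ->; apply/matrixP => i j; rewrite !mxE; ring.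
rewrite dh (dmx_metric oU g_sym g_unit l Ux) hE -!scalemxAl linearZ /= -scalerDr.
rewrite (mulmxDr B) [(B *m _ + B *m _)^T]raddfD /=.
have BC : B *m chr g l x = g x *m chr g l x + cf_r (u x) *: ((w x)^T *m (w x *m chr g l x)).
  by rewrite mulmxDl -scalemxAl -mulmxA.
rewrite {1 2}BC [(g x *m _ + _)^T]raddfD /= [(cf_r _ *: _)^T]linearZ /=.
rewrite (trmx_mul (w x)^T) trmxK [(_ + _)^T]raddfD /= trmxK (mulmxDl (col l _)) (mulmxDr (w x)^T).
exact: gen comp.
Qed.

Lemma quad_deformed x (y : 'cV[R]_n) : (y^T *m deformed x *m y) 0 0 =
  expR (rho (u x)) ^+ 2 * ((y^T *m g x *m y) 0 0 - kappa (u x) * (w x *m y) 0 0 ^+ 2).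
Proof.
rewrite /deformed -scalemxAr -scalemxAl mxE; congr (_ * _).
rewrite mulmxBr mulmxBl mxE [X in _ + X]mxE; congr (_ - _).
rewrite -scalemxAr -scalemxAl mxE; congr (_ * _).
have -> : y^T *m ((w x)^T *m w x) *m y = (w x *m y)^T *m (w x *m y).
  by rewrite trmx_mul !mulmxA.
by rewrite mxE big_ord1 mxE expr2.
Qed.

Lemma ricci_deformed (mu mubar : R) (x0 : V) (y : 'cV[R]_n) : U x0 -> u x0 != 0 ->
  ricci g x0 = ((n%:R - 1) * mu) *: g x0 ->
  let S0 := G x0 *m Sl x0 in
  let tr := \tr (S0 *m S0) in
  let t := - (sf x0 *m (G x0 *m (sf x0)^T)) 0 0 in
  (y^T *m ricci deformed x0 *m y) 0 0
    - (n%:R - 1) * mubar * (y^T *m deformed x0 *m y) 0 0 =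
  E1 n mu mubar rho kappa (u x0) tr t * (y^T *m g x0 *m y) 0 0
  + E2 n mu mubar rho kappa (u x0) tr t * (w x0 *m y) 0 0 ^+ 2
  + E3 n rho kappa (u x0) * (sf x0 *m y) 0 0 ^+ 2
  + E4 kappa (u x0) * (y^T *m Sl x0 *m (S0 *m y)) 0 0
  + E5 n rho kappa (u x0) * (w x0 *m y) 0 0 * (sf x0 *m (S0 *m y)) 0 0
  + E6 n rho kappa (u x0) * (y^T *m nabla g sf x0 *m y) 0 0.
Proof.
move=> Ux0 u0 ein; have d0 := uD Ux0; have n0 := Delta_neq0 Ux0.
have scp : smooth_on U (fun x => cf_p (u x)).
  apply: smoothM => //; last by apply: smoothV => //; exact: smooth_Delta.
  by apply: smoothB => //; [exact: smoothN|exact: smoothX].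
have sca : smooth_on U (fun x => cf_a (u x)) by apply: smoothM => //; exact: smooth_cst.
have scq : smooth_on U (fun x => cf_q (u x)).
  apply: smoothD => //; apply: smoothM => //; apply: smoothM => //; exact: smooth_cst.
have scr : smooth_on U (fun x => cf_r (u x)) by exact: smoothN.
have ia := is_derive_cf_a d0; have ip := is_derive_cf_p d0 n0.
have iq := is_derive_cf_q d0; have ir := is_derive_cf_r d0.
have := ricci_shifted oU sg g_sym g_unit deformed_sym sw killing sca scp scq scr chr_deformed
  y Ux0 ein (@ex_derive _ _ _ _ _ _ _ ia) (@ex_derive _ _ _ _ _ _ _ ip)
  (@ex_derive _ _ _ _ _ _ _ iq) (@ex_derive _ _ _ _ _ _ _ ir).
rewrite !derive1E !derive_val quad_deformed => -> S0 tr t.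
rewrite /E1 /E2 /E3 /E4 /E5 /E6 (derive1_Delta d0) (derive1n2_Delta d0).
have -> : expR (2 * rho (u x0)) = expR (rho (u x0)) ^+ 2 by rewrite expRM_natl.
exact: (einstein_identity n%:R mu mubar _ _ _ _ _ _ _ _ (derive1 rho (u x0))
  (derive1n 2 rho (u x0)) (derive1 kappa (u x0)) (derive1n 2 kappa (u x0))
  (expR (rho (u x0)) ^+ 2) u0 n0).
Qed.

End Deformation.

(** * The deformation in a chart and on the manifold *)

Section QuadraticForms.
Context {R : realType} {n : nat}.
Implicit Types (A : 'M[R]_n) (y : 'rV[R]_n).

Lemma bilinE A (y z : 'rV[R]_n) :
  \sum_i \sum_j A i j * y 0 i * z 0 j = (y *m A *m z^T) 0 0.
Proof.
rewrite mxE exchange_big; apply: eq_bigr => j _ /=.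
by rewrite !mxE mulr_suml; apply: eq_bigr => i _; rewrite (mulrC (A i j)).
Qed.

Lemma quadE A y : quad A y = (y *m A *m y^T) 0 0.
Proof. exact: bilinE. Qed.

Lemma posdef_unitmx A : (forall y, y != 0 -> 0 < quad A y) -> A \in unitmx.
Proof.
move=> pos; rewrite -row_free_unit -kermx_eq0; apply/rowV0P => v /sub_kermxP vA.
have [//|/pos] := eqVneq v 0.
by rewrite quadE vA mul0mx mxE ltxx.
Qed.

(** Polarisation, then evaluation on pairs of basis vectors. *)
Lemma sym_quad0 A : A^T = A -> (forall y, quad A y = 0) -> A = 0.
Proof.
move=> As q0; have b0 (y z : 'rV[R]_n) : (y *m A *m z^T) 0 0 = 0.
  have sym : (z *m A *m y^T) 0 0 = (y *m A *m z^T) 0 0.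
    have <- : (z *m A *m y^T)^T = y *m A *m z^T by rewrite !trmx_mul trmxK As mulmxA.
    by rewrite [RHS]mxE.
  have := q0 (y + z); rewrite quadE raddfD /= !(mulmxDl, mulmxDr).
  rewrite [LHS]mxE [X in X + _]mxE [X in _ + X]mxE -!quadE !q0 sym addr0 add0r.
  by rewrite -mulr2n => /eqP; rewrite mulrn_eq0 => /eqP.
apply/matrixP => i j; have := b0 (delta_mx 0 i) (delta_mx 0 j).
by rewrite trmx_delta -rowE -colE !mxE.
Qed.

End QuadraticForms.

Section ChartScalars.
Context {R : realType} {n : nat}.
Local Notation V := 'rV[R]_n.
Variables (U : set V) (g : V -> 'M[R]_n) (w : V -> 'rV[R]_n).
Hypothesis g_sym : forall x, U x -> (g x)^T = g x.
Hypothesis killing : forall x i j, U x -> covd g w i j x + covd g w j i x = 0.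
Local Notation X := (dual_vec g w).
Local Notation Sl := (nabla g w).
Local Notation G := (ginv g).
Local Notation sf := (sform g w).
Local Notation S := (fun x => G x *m Sl x).
Variables (x : V) (y : 'rV[R]_n).
Hypothesis Ux : U x.

Lemma betaE : beta w x y = (w x *m y^T) 0 0.
Proof. by rewrite mxE; apply: eq_bigr => i _; rewrite mxE. Qed.

Lemma s0E : s0 g w x y = (sf x *m y^T) 0 0.
Proof. by rewrite [RHS]mxE; apply: eq_bigr => i _; rewrite [X in _ = _ * X]mxE. Qed.

Lemma s00E : s00 g w x y = (y *m nabla g sf x *m y^T) 0 0.
Proof.
rewrite -bilinE; apply: eq_bigr => i _; apply: eq_bigr => j _.
by rewrite nablaE.
Qed.

Lemma t_lowerE i j : t_lower g w i j x = (Sl x *m S x) i j.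
Proof.
rewrite mxE; apply: eq_bigr => m _; rewrite (s_lowerE killing)//.
congr (_ * _); rewrite mxE; apply: eq_bigr => l _.
by rewrite (s_lowerE killing).
Qed.

Lemma t00E : t00 g w x y = (y *m Sl x *m (S x *m y^T)) 0 0.
Proof.
rewrite !mulmxA -(mulmxA y) -(mulmxA y) -(mulmxA (Sl x)) -bilinE.
by apply: eq_bigr => i _; apply: eq_bigr => j _; rewrite t_lowerE.
Qed.

Lemma t0E : t0 g w x y = (sf x *m (S x *m y^T)) 0 0.
Proof.
rewrite (sformE killing Ux) !mulmxA -(mulmxA (X x)^T) -(mulmxA (X x)^T) -(mulmxA (Sl x)) -bilinE.
apply: eq_bigr => i _; apply: eq_bigr => j _.
by rewrite t_lowerE (upE) [X in _ = _ * X * _]mxE (mulrC (X x i 0)).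
Qed.

(** So t is minus the squared norm of s_i: one contraction of s_ij with b^i gives s_j, the other one
    - s_i. *)
Lemma tbbE : tbb g w x = - (sf x *m (G x *m (sf x)^T)) 0 0.
Proof.
have -> : - (sf x *m (G x *m (sf x)^T)) 0 0 = (sf x *m (S x *m (X x)^T^T)) 0 0.
  by rewrite trmxK -(mulmxA (G x)) (vec_skew killing Ux) !mulmxN [RHS]mxE.
rewrite (sformE killing Ux) !mulmxA -(mulmxA (X x)^T) -(mulmxA (X x)^T) -(mulmxA (Sl x)) -bilinE.
apply: eq_bigr => i _; apply: eq_bigr => j _.
by rewrite t_lowerE !upE !(mxE _ _ 0).
Qed.

Lemma ttrE : ttr g w x = \tr (S x *m S x).
Proof.
have Tsym i j : (Sl x *m S x) i j = (Sl x *m S x) j i.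
  suff {2}<- : (Sl x *m S x)^T = Sl x *m S x by rewrite [RHS]mxE.
  rewrite !trmx_mul (nabla_tr killing Ux) (ginv_sym g_sym Ux) mulNmx mulmxN mulNmx.
  by rewrite opprK mulmxA.
rewrite -(mulmxA (G x)); apply: eq_bigr => i _; rewrite [RHS]mxE.
by apply: eq_bigr => j _; rewrite t_lowerE Tsym.
Qed.

End ChartScalars.

Section DeformedMetric.
Context {R : realType} {n : nat}.
Local Notation V := 'rV[R]_n.

(** Only kappa > 0 with beta(y) <> 0 needs an argument; it is Cauchy-Schwarz, in the form that y - c
    X has nonnegative square for every c. *)
Lemma deformed_posdef (g : V -> 'M[R]_n) (w : V -> 'rV[R]_n) (rho kappa : R -> R) x :
  (g x)^T = g x -> (forall y, y != 0 -> 0 < quad (g x) y) ->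
  0 < Delta kappa (normb2 g w x) ->
  forall y, y != 0 -> 0 < quad (deformed g w rho kappa x) y.
Proof.
move=> g_sym pos D0 y y0; set u := normb2 g w x in D0; set k := kappa u in D0.
have g_unit := posdef_unitmx pos.
have := quad_deformed g w rho kappa x y^T; rewrite trmxK -!quadE -/u -/k => ->.
apply: mulr_gt0; first by rewrite exprn_gt0// expR_gt0.
set be := (w x *m y^T) 0 0.
have gX : g x *m dual_vec g w x = (w x)^T by rewrite dual_vec.unlock mulKVmx.
have CS c : 0 <= quad (g x) y - 2 * c * be + c ^+ 2 * u.
  have -> : quad (g x) y - 2 * c * be + c ^+ 2 * u = quad (g x) (y - c *: (dual_vec g w x)^T).
    set X := dual_vec g w x in gX *.
    have Xg : X^T *m g x = w x by rewrite -[RHS]trmxK -gX trmx_mul g_sym.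
    have yX : (y *m g x *m X) 0 0 = be.
      have <- : (w x *m y^T)^T = y *m g x *m X by rewrite trmx_mul trmxK -mulmxA gX.
      by rewrite [LHS]mxE.
    have XX : (w x *m X) 0 0 = u by rewrite /u normb2E.
    rewrite !quadE [(_ - _)^T]raddfB /= [(_ *: _)^T]linearZ /= trmxK.
    rewrite !(mulmxBl, mulmxBr) -!scalemxAl -!scalemxAr Xg.
    have gen (p q r s : 'M[R]_1) : (p - q - (r - s)) 0 0 = p 0 0 - q 0 0 - (r 0 0 - s 0 0).
      by rewrite !mxE.
    have eZ (p : 'M[R]_1) : (c *: p) 0 0 = c * p 0 0 by rewrite mxE.
    by rewrite gen !eZ yX XX -/be; ring.
  have [->|/pos/ltW//] := eqVneq (y - c *: (dual_vec g w x)^T) 0.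
  by rewrite quadE mul0mx mul0mx mxE.
have q0 := pos _ y0.
have [k0|k0] := lerP k 0.
  by rewrite subr_gt0 (le_lt_trans _ q0)// mulr_le0_ge0// sqr_ge0.
have [be0|be0] := eqVneq be 0; first by rewrite be0 expr0n /= mulr0 subr0.
have be2 : 0 < be ^+ 2 by rewrite lt_neqAle sqr_ge0 eq_sym sqrf_eq0 be0.
(* The choice c = kappa beta turns [CS] into alpha^2 - kappa beta^2 >= kappa beta^2 Delta, whose
   right side is positive. *)
have := CS (k * be); rewrite -subr_ge0 => {}CS; rewrite subr_gt0.
have : 0 < k * be ^+ 2 * Delta kappa u by apply: mulr_gt0 => //; exact: mulr_gt0.
move: CS; rewrite /Delta -/k; move: (quad _ _) => q; nra.
Qed.

Variables (M : smooth_manifold R n) (a : form2 M) (b : form1 M).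
Hypotheses (a_riem : is_riemannian a) (b_form : is_one_form b).

Lemma chart_image_open (c : chart M) : open (chart_image c).
Proof. exact: image_open. Qed.

Lemma smooth_metric (c : chart M) : smooth_mx (chart_image c) (a c).
Proof. by case: a_riem => s _ _ _ i j; exact: s. Qed.

Lemma metric_sym (c : chart M) x : chart_image c x -> (a c x)^T = a c x.
Proof. by case: a_riem => _ _ s _; exact: s. Qed.

Lemma metric_pos (c : chart M) x : chart_image c x ->
  forall y, y != 0 -> 0 < quad (a c x) y.
Proof. by case: a_riem => _ _ _ s cx y; exact: s. Qed.

Lemma metric_unit (c : chart M) x : chart_image c x -> a c x \in unitmx.
Proof. by move=> /metric_pos; exact: posdef_unitmx. Qed.

Lemma smooth_form (c : chart M) : smooth_mx (chart_image c) (b c).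
Proof. by case: b_form => s _ i j; rewrite ord1; exact: s. Qed.

Lemma overlap_chart (c d : chart M) x : overlap c d x ->
  chart_image c x /\ chart_image d (transition c d x).
Proof.
move=> [p [pc pd] <-]; split; first by exists p.
by exists p => //; rewrite /transition coordK.
Qed.

(** Read off from the transformation law of the metric: the left side is invertible and the Jacobian
    is one of its factors. *)
Lemma jacobian_unit (c d : chart M) x : overlap c d x ->
  'J (transition c d) x \in unitmx.
Proof.
move=> cdx; have [cx _] := overlap_chart cdx; have := metric_unit cx.
case: a_riem => _ tr _ _; rewrite (tr _ _ _ cdx) -mulmxA unitmx_mul.
by case/andP.
Qed.

Lemma normb2_chart (c d : chart M) x : overlap c d x ->
  normb2 (a c) (b c) x = normb2 (a d) (b d) (transition c d x).
Proof.
move=> cdx; have [cx dx] := overlap_chart cdx; have uJ := jacobian_unit cdx.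
rewrite !normb2E; set J := 'J _ _ in uJ *.
have bt : b c x = b d (transition c d x) *m J^T by case: b_form => _; exact.
have at_ : a c x = J *m a d (transition c d x) *m J^T by case: a_riem => _ + _ _; exact.
have Xt : dual_vec (a d) (b d) (transition c d x) = J^T *m dual_vec (a c) (b c) x.
  apply: (can_inj (mulKmx (metric_unit dx))); apply: (can_inj (mulKmx uJ)).
  rewrite [in RHS]mulmxA [RHS]mulmxA mulmxA -at_.
  rewrite [in RHS]dual_vec.unlock mulKVmx ?metric_unit//.
  rewrite -mulmxA [in LHS]dual_vec.unlock mulKVmx ?metric_unit//.
  by rewrite bt trmx_mul trmxK.
by rewrite bt Xt mulmxA.
Qed.

Lemma deformE (rho kappa : R -> R) (c : chart M) :
  deform rho kappa a b c = deformed (a c) (b c) rho kappa.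
Proof.
apply/funext => x; apply/matrixP => i j; rewrite !mxE big_ord1 !mxE.
by rewrite mulrA.
Qed.

Variables (rho kappa : R -> R) (D : set R).
Hypotheses (oD : open D) (uD : forall c x, chart_image c x -> D (normb2 (a c) (b c) x)).
Hypotheses (rho_smooth : smooth1_on D rho) (kappa_smooth : smooth1_on D kappa).
Hypothesis Delta_gt0 : forall c x, chart_image c x ->
  0 < Delta kappa (normb2 (a c) (b c) x).

Lemma deform_posdef (c : chart M) x : chart_image c x ->
  forall y, y != 0 -> 0 < quad (deform rho kappa a b c x) y.
Proof.
move=> cx; rewrite deformE.
exact: deformed_posdef (metric_sym cx) (metric_pos cx) (Delta_gt0 cx).
Qed.

Lemma deform_unit (c : chart M) x : chart_image c x ->
  deformed (a c) (b c) rho kappa x \in unitmx.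
Proof. by move=> /deform_posdef; rewrite deformE; exact: posdef_unitmx. Qed.

Lemma smooth_deform (c : chart M) : smooth_mx (chart_image c) (deformed (a c) (b c) rho kappa).
Proof.
exact: (smooth_deformed (@chart_image_open c) (@smooth_metric c) (@metric_unit c)
  (@smooth_form c) oD (@uD c) rho_smooth kappa_smooth).
Qed.

Lemma deform_riemannian : is_riemannian (deform rho kappa a b).
Proof.
split.
- by move=> c i j; rewrite deformE; exact: smooth_deform.
- move=> c d x cdx; rewrite !deformE /deformed (normb2_chart cdx).
  set J := 'J _ _; set x' := transition c d x.
  have bt : b c x = b d x' *m J^T by case: b_form => _; exact.
  have at_ : a c x = J *m a d x' *m J^T by case: a_riem => _ + _ _; exact.
  rewrite -scalemxAr -scalemxAl mulmxBr mulmxBl -at_ -scalemxAr -scalemxAl.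
  by rewrite bt trmx_mul trmxK !mulmxA.
- by move=> c x cx; rewrite deformE; exact: (deformed_sym _ (@metric_sym c) _ _ cx).
- by move=> c x y cx; exact: deform_posdef.
Qed.

End DeformedMetric.

(** * Zeros of Killing forms *)

Section Gronwall.
Context {R : realType}.

Lemma within_bounded (f : R -> R) : (forall s : R, 0 <= s <= 1 -> derivable f s 1) ->
  exists2 B, 0 <= B & forall s : R, 0 <= s <= 1 -> `|f s| <= B.
Proof.
move=> df; have cf : {within `[0, 1], continuous f}.
  by apply: derivable_within_continuous => s; rewrite in_itv /=; exact: df.
have [c c01 mx] := EVT_max ler01 cf; have [d d01 mn] := EVT_min ler01 cf.
exists (`|f c| + `|f d|) => [|s s01]; first exact: addr_ge0.
have s01' : s \in `[0, 1]%R by rewrite in_itv.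
rewrite ler_norml; apply/andP; split.
  rewrite lerNl; apply: le_trans (_ : - f d <= _); first by rewrite lerN2 mn.
  by apply: le_trans (_ : `|f d| <= _); [rewrite -normrN ler_norm|rewrite lerDr].
by apply: le_trans (mx _ s01') _; apply: le_trans (ler_norm _) _; rewrite lerDl.
Qed.

Lemma family_bounded (J : finType) (f : J -> R -> R) :
  (forall j (s : R), 0 <= s <= 1 -> derivable (f j) s 1) ->
  exists2 B, 0 <= B & forall j (s : R), 0 <= s <= 1 -> `|f j s| <= B.
Proof.
move=> df; have /fin_all_exists2[B B0 fB] := fun j => within_bounded (df j).
exists (\sum_j B j); first exact: sumr_ge0.
move=> j s s01; apply: le_trans (fB j s s01) _.
by rewrite (bigD1 j)//= lerDl sumr_ge0.
Qed.

(* Gronwall: [N = sum phi_j^2] satisfies [N' <= C N], so [N e^(-C s)] does not increase. *)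
Lemma linear_growth_eq0 (J : finType) (phi dphi : J -> R -> R) (B : R) : 0 <= B ->
  (forall j (s : R), 0 <= s <= 1 -> is_derive s (1 : R) (phi j) (dphi j s)) ->
  (forall j (s : R), 0 <= s <= 1 -> `|dphi j s| <= B * \sum_k `|phi k s|) ->
  (forall j, phi j 0 = 0) -> forall j, phi j 1 = 0.
Proof.
move=> B0 dP bP P0 j0.
pose N s := \sum_j phi j s ^+ 2; pose dN s := \sum_j 2 * phi j s * dphi j s.
(* The inequality 2 |phi_j| |phi_k| <= phi_j^2 + phi_k^2, summed over all pairs, contributes the
   factor 2 #|J|. *)
pose C : R := 2 * B * #|J|%:R.
have iN (s : R) : 0 <= s <= 1 -> is_derive s (1 : R) N (dN s).
  move=> s01; rewrite /N /dN; elim: (index_enum J) => [|j l IH].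
    rewrite big_nil (_ : (fun _ => _) = cst 0); first exact: is_derive_cst.
    by apply/funext => r; rewrite big_nil.
  rewrite big_cons (_ : (fun _ => _) = fun r => phi j r * phi j r
    + \sum_(k <- l) phi k r ^+ 2); last by apply/funext => r; rewrite big_cons expr2.
  have ij := dP j s s01.
  apply: is_derive_eq (is_deriveD (is_deriveM ij ij) IH) _.
  by congr (_ + _); rewrite -mulrA mulr_natl mulr2n.
have NC (s : R) : 0 <= s <= 1 -> dN s <= C * N s.
  move=> s01; have le1 j : 2 * phi j s * dphi j s <=
      \sum_k B * (phi j s ^+ 2 + phi k s ^+ 2).
    apply: le_trans (_ : 2 * `|phi j s| * (B * \sum_k `|phi k s|) <= _).
      apply: le_trans (ler_norm _) _; rewrite !normrM ger0_norm//.
      by apply: ler_wpM2l; [rewrite mulr_ge0|exact: bP].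
    rewrite mulrCA !mulr_sumr; apply: ler_sum => k _.
    rewrite ler_wpM2l// -subr_ge0 -mulrA.
    have -> : phi j s ^+ 2 + phi k s ^+ 2 - 2 * (`|phi j s| * `|phi k s|)
        = (`|phi j s| - `|phi k s|) ^+ 2.
      by rewrite sqrrB !real_normK ?num_real//; ring.
    exact: sqr_ge0.
  apply: le_trans (ler_sum _ (fun j _ => le1 j)) _.
  rewrite le_eqVlt; apply/orP; left; apply/eqP.
  under eq_bigr do rewrite -mulr_sumr big_split /=.
  rewrite -mulr_sumr big_split /= exchange_big /= -/(N s) sumr_const.
  by rewrite /C -mulr_natl; ring.
pose h s := N s * expR (- C * s).
have ih (s : R) : 0 <= s <= 1 -> is_derive s (1 : R) h ((dN s - C * N s) * expR (- C * s)).
  move=> s01; have iNs := iN s s01.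
  have il : is_derive s (1 : R) (fun r : R => - C * r) (- C).
    by apply: is_derive_eq; rewrite ?scaler0 ?addr0 ?add0r -[LHS]/(_ * 1) mulr1.
  have ie := is_derive1_comp (is_derive_expR (- C * s)) il.
  apply: is_derive_eq (is_deriveM iNs ie) _.
  rewrite -[_ *: _]/(_ * _) -[X in _ + X]/(expR (- C * s) * dN s); ring.
have h01 : h 1 <= h 0.
  have dh (s : R) : s \in `]0, 1[%R -> derivable h s 1.
    by rewrite in_itv /= => /andP[s0 s1]; have [] := ih s (introT andP (conj (ltW s0) (ltW s1))).
  apply: (@ler0_derive1_nincr R h 0 1) => //.
  - move=> s s01; rewrite derive1E; have := s01; rewrite in_itv /= => /andP[s0 s1].
    have s01' : 0 <= s <= 1 by rewrite !ltW.
    have [_ ->] := ih s s01'; rewrite mulr_le0_ge0 ?expR_ge0// subr_le0.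
    exact: NC.
  - apply: derivable_within_continuous => s; rewrite in_itv /= => s01.
    by have [] := ih s s01.
have N0 : N 0 = 0 by rewrite /N big1// => j _; rewrite P0 expr0n.
have Nge0 : 0 <= N 1 by apply: sumr_ge0 => j _; exact: sqr_ge0.
have : N 1 = 0.
  apply/eqP; rewrite eq_le Nge0 andbT.
  by move: h01; rewrite /h N0 mul0r pmulr_lle0// expR_gt0.
move=> /eqP; rewrite psumr_eq0 => [/allP/(_ j0)|j _]; last exact: sqr_ge0.
by rewrite mem_index_enum sqrf_eq0 => /(_ isT)/eqP.
Qed.

End Gronwall.

(** * The linear first-order system of a Killing form along a segment *)

Section KillingGrowth.
Context {R : realType} {n : nat}.
Local Notation V := 'rV[R]_n.

Lemma derive_sum_partial (f : V -> R) (x v : V) : differentiable f x ->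
  'D_v f x = \sum_k v 0 k * partial k f x.
Proof.
move=> df; rewrite deriveE// [in LHS](matrix_sum_delta v) big_ord1 linear_sum.
apply: eq_bigr => k _; rewrite linearZ /=.
by rewrite /partial deriveE.
Qed.

Lemma is_derive_along (U : set V) (f : V -> R) (p v : V) s : smooth_on U f ->
  U (p + s *: v) ->
  is_derive s (1 : R) (fun r : R => f (p + r *: v))
    (\sum_k v 0 k * partial k f (p + s *: v)).
Proof.
move=> sf Us; have df := smooth_diff sf Us.
by rewrite -(derive_sum_partial v df); apply: is_derive_line; exact: diff_derivable.
Qed.

Variables (U : set V) (g : V -> 'M[R]_n) (w : V -> 'rV[R]_n).
Hypotheses (oU : open U) (sg : smooth_mx U g).
Hypothesis g_sym : forall x, U x -> (g x)^T = g x.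
Hypothesis g_unit : forall x, U x -> g x \in unitmx.
Hypothesis sw : smooth_mx U w.
Hypothesis killing : forall x i j, U x -> covd g w i j x + covd g w j i x = 0.

Local Notation W a b c := (partial a (partial b (fun z => w z 0 c))).

Lemma killing_partial b c x : U x ->
  partial b (fun z => w z 0 c) x + partial c (fun z => w z 0 b) x =
  2 * \sum_m chr g b x m c * w x 0 m.
Proof.
move=> Ux; have := killing c b Ux; rewrite /covd => /eqP.
have E i j : \sum_k christoffel g k i j x * w x 0 k = \sum_m chr g i x m j * w x 0 m.
  by apply: eq_bigr => k _; rewrite chrE.
have Ebc : \sum_m chr g c x m b * w x 0 m = \sum_m chr g b x m c * w x 0 m.
  by apply: eq_bigr => m _; rewrite (chrC oU g_sym c m b Ux).
rewrite !E Ebc; set p := partial b _ x; set q := partial c _ x; set t := \sum_m _.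
by rewrite addrACA -opprD subr_eq0 -mulr2n => /eqP ->; rewrite mulr_natl.
Qed.

(** Derivative of the Killing equation written in coordinates: the symmetrised second partials are
    linear in the form and its first partials. *)
Lemma killing_second a b c x : U x ->
  W a b c x + W a c b x =
  2 * \sum_m (dmx a (chr g b) x m c * w x 0 m + chr g b x m c * partial a (fun z => w z 0 m) x).
Proof.
move=> Ux; have sp i j : smooth_on U (partial i (fun z => w z 0 j)).
  exact: smooth_partial (sw 0 j).
have sC := smooth_chr oU sg g_unit b.
rewrite -partialD; [|exact: smooth_diff (sp b c) Ux|exact: smooth_diff (sp c b) Ux].
have E := partial_eq_on a oU (f := fun z => partial b (fun z => w z 0 c) z
  + partial c (fun z => w z 0 b) z) (g := fun z => 2 * \sum_m chr g b z m c * w z 0 m).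
rewrite (E _ _ Ux) => [|z /set_mem Uz]; last exact: killing_partial.
have st m : smooth_on U (fun z => chr g b z m c * w z 0 m) by exact: smoothM.
have ss : smooth_on U (fun z => \sum_m chr g b z m c * w z 0 m) by exact: smooth_sum.
rewrite partialM; [|exact: differentiable_cst|exact: smooth_diff ss Ux].
rewrite partial_cst mul0r add0r; congr (_ * _).
rewrite partial_sum => [|m]; last exact: smooth_diff (st m) Ux.
apply: eq_bigr => m _; rewrite partialM ?dmxE//.
  exact: smooth_diff (sC m c) Ux.
exact: smooth_diff (sw 0 m) Ux.
Qed.

(** The permutation trick behind the Christoffel symbols: an array symmetric in its first two
    indices, here by [partialC], is determined by its symmetrisation in the last two. This closes
    the linear system. *)
Lemma killing_hessian a b c x : U x -> 2 * W a b c x =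
  (W a b c x + W a c b x) + (W b a c x + W b c a x) - (W c a b x + W c b a x).
Proof.
move=> Ux; have sym i j k := partialC i j oU (sw 0 k) Ux.
have gen (p q r p' q' r' : R) : p = p' -> q = q' -> r = r' ->
  2 * p = (p + q) + (p' + r) - (q' + r') by move=> -> -> ->; ring.
exact: gen (sym a b c) (sym a c b) (sym b c a).
Qed.

(** A ball is convex, so the segment from [q] to [z] stays in [U]. Along it the state is formed by
    the components of the form and their first partials; its derivative involves second partials,
    which [killing_hessian] bounds by the state itself. *)
Lemma killing_ball (x q z : V) (r : R) : (forall p, ball x r p -> U p) ->
  ball x r q -> ball x r z -> (forall i, w q 0 i = 0) ->
  (forall j i, partial j (fun p => w p 0 i) q = 0) -> forall i, w z 0 i = 0.
Proof.
move=> xU xq xz wq dwq i0; pose v := z - q; pose p (s : R) := q + s *: v.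
have Up s : 0 <= s <= 1 -> U (p s).
  move=> /andP[s0 s1]; apply: xU; move: xq xz; rewrite -ball_normE /= => xq xz.
  have -> : x - p s = (1 - s) *: (x - q) + s *: (x - z).
    by rewrite /p /v; apply/rowP => k; rewrite !mxE; ring.
  (* For s < 1 the strict inequality comes from the term with the positive factor 1 - s; at s = 1
     the point is [z] itself. *)
  have [s10|s1n] := eqVneq s 1; first by rewrite s10 subrr scale0r add0r scale1r.
  have t0 : 0 < 1 - s by rewrite subr_gt0 lt_neqAle s1n.
  apply: le_lt_trans (ler_normD _ _) _; rewrite !normrZ (ger0_norm s0) (gtr0_norm t0).
  apply: (@lt_le_trans _ _ ((1 - s) * r + s * r)); last by rewrite -mulrDl subrK mul1r.
  by apply: ltr_leD; [rewrite ltr_pM2l|rewrite ler_wpM2l// ltW].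
have sp j i : smooth_on U (partial j (fun p => w p 0 i)) by exact: smooth_partial (sw 0 i).
have bd (f : V -> R) (s : R) : smooth_on U f -> 0 <= s <= 1 ->
    derivable (fun r : R => f (p r)) s 1.
  by move=> sf s01; have [] := is_derive_along sf (Up s s01).
pose J : finType := ('I_n + 'I_n * 'I_n)%type.
pose phi (j : J) (s : R) := match j with
  | inl i => w (p s) 0 i
  | inr bc => partial bc.1 (fun p => w p 0 bc.2) (p s) end.
pose dphi (j : J) (s : R) := match j with
  | inl i => \sum_k v 0 k * partial k (fun p => w p 0 i) (p s)
  | inr bc => \sum_k v 0 k * W k bc.1 bc.2 (p s) end.
have sC b := smooth_chr oU sg g_unit b.
have [B1 B10 bB1] := @family_bounded R ('I_n * 'I_n * ('I_n * 'I_n))%type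
  (fun j s => dmx j.1.1 (chr g j.1.2) (p s) j.2.1 j.2.2)
  (fun j s s01 => bd _ s (smooth_dmx oU j.1.1 (sC j.1.2) j.2.1 j.2.2) s01).
have [B2 B20 bB2] := @family_bounded R ('I_n * ('I_n * 'I_n))%type
  (fun j s => chr g j.1 (p s) j.2.1 j.2.2)
  (fun j s s01 => bd _ s (sC j.1 j.2.1 j.2.2) s01).
pose Q s := \sum_j `|phi j s|.
have Q0 s : 0 <= Q s by exact: sumr_ge0.
have leQ j s : `|phi j s| <= Q s by rewrite /Q (bigD1 j)//= lerDl sumr_ge0.
(* Each symmetrised pair of second partials is bounded by 2 T Q, and twice a second partial is a
   combination of three such pairs, whence the factor 3 T in [bW]. [N] is the l^1 norm of the
   direction. *)
pose T := n%:R * (B1 + B2); pose N := \sum_k `|v 0 k|.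
have T0 : 0 <= T by rewrite mulr_ge0// addr_ge0.
have N0 : 0 <= N by exact: sumr_ge0.
have lin (F : 'I_n -> R) c s : (forall k, `|F k| <= c * Q s) ->
    `|\sum_k v 0 k * F k| <= N * (c * Q s).
  move=> Fc; apply: le_trans (ler_norm_sum _ _ _) _; rewrite /N mulr_suml.
  by apply: ler_sum => k _; rewrite normrM ler_wpM2l.
have bW a b c s : 0 <= s <= 1 -> `|W a b c (p s)| <= 3 * T * Q s.
  move=> s01; have Us := Up s s01.
  have bS a' b' c' : `|W a' b' c' (p s) + W a' c' b' (p s)| <= 2 * (T * Q s).
    rewrite (killing_second a' b' c' Us) normrM ger0_norm// ler_wpM2l//.
    apply: le_trans (ler_norm_sum _ _ _) _.
    apply: (@le_trans _ _ (\sum_(m < n) (B1 + B2) * Q s)).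
      apply: ler_sum => m _; apply: le_trans (ler_normD _ _) _; rewrite mulrDl.
      apply: lerD; rewrite normrM; apply: ler_pM => //.
      - exact: (bB1 (a', b', (m, c'))).
      - exact: (leQ (inl m)).
      - exact: (bB2 (b', (m, c'))).
      - exact: (leQ (inr (a', m))).
    by rewrite sumr_const card_ord -mulr_natl mulrA.
  have fin (w0 S1 S2 S3 e : R) : 2 * w0 = S1 + S2 - S3 -> `|S1| <= 2 * e ->
      `|S2| <= 2 * e -> `|S3| <= 2 * e -> `|w0| <= 3 * e.
    move=> E; rewrite !ler_norml => /andP[? ?] /andP[? ?] /andP[? ?].
    by apply/andP; split; lra.
  rewrite -mulrA.
  exact: fin (killing_hessian a b c Us) (bS a b c) (bS b a c) (bS c a b).
(* The summand 1 serves the components of the form, whose derivatives are part of the state, and 3 T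
   serves the first partials. *)
have main := @linear_growth_eq0 R J phi dphi (N * (1 + 3 * T)).
have : forall j, phi j 1 = 0.
  apply: main => //.
  - by rewrite mulr_ge0// addr_ge0// mulr_ge0.
  - move=> [i|[b c]] s s01; exact: (is_derive_along _ (Up s s01)).
  - move=> [i|[b c]] s s01; rewrite -/(Q s) -mulrA.
    + apply: le_trans (lin _ 1 s _) _ => [k|]; first by rewrite mul1r (leQ (inr (k, i))).
      by rewrite ler_wpM2l// ler_wpM2r// lerDl mulr_ge0.
    + apply: le_trans (lin _ (3 * T) s _) _ => [k|]; first exact: bW.
      by rewrite ler_wpM2l// ler_wpM2r// lerDr.
  - by move=> [i|[b c]]; rewrite /phi /p scale0r addr0.
by move=> /(_ (inl i0)); rewrite /phi /p scale1r /v addrC subrK.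
Qed.

End KillingGrowth.

(** * Density of the set where a nonzero Killing form does not vanish *)

Section Density.
Context {R : realType} {n : nat}.
Local Notation V := 'rV[R]_n.
Variables (M : smooth_manifold R n) (a : form2 M) (b : form1 M).
Hypothesis M_connected : connected [set: M].
Hypotheses (a_riem : is_riemannian a) (b_form : is_one_form b) (b_killing : is_killing a b).

Definition form_zeros : set M :=
  [set p | forall c, chart_dom c p -> b c (chart_coord c p) = 0].

(** The transformation law is linear, so vanishing in one chart entails vanishing in all of them. *)
Lemma form_zeros_chart (c : chart M) p : chart_dom c p ->
  b c (chart_coord c p) = 0 -> form_zeros p.
Proof.
move=> cp b0 d dp; have dc : overlap d c (chart_coord d p) by exists p.
case: b_form => _ /(_ d c _ dc) ->.
by rewrite /transition coordK// b0 mul0mx.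
Qed.

Lemma near_coord (c : chart M) p (P : V -> Prop) : chart_dom c p ->
  (\forall z \near chart_coord c p, P z) ->
  \forall q \near p, chart_dom c q /\ P (chart_coord c q).
Proof.
move=> cp Pz; have od := @dom_open _ _ M c.
have cc : {for p, continuous (chart_coord c)}.
  have := @chart_coord_continuous _ _ M c; rewrite continuous_open_subspace// => /(_ p).
  by apply; rewrite inE.
have : \forall q \near p, P (chart_coord c q) by exact: cc.
have : \forall q \near p, chart_dom c q by exact: open_nbhs_nbhs.
by apply: filter_app2; near=> q.
Unshelve. all: by end_near. Qed.

Lemma near_inv (c : chart M) x (P : M -> Prop) : chart_image c x ->
  (\forall p \near chart_inv c x, P p) ->
  \forall z \near x, chart_image c z /\ P (chart_inv c z).
Proof.
move=> cx Pp; have od := @chart_image_open _ _ M c.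
have cc : {for x, continuous (chart_inv c)}.
  have := @chart_inv_continuous _ _ M c; rewrite continuous_open_subspace// => /(_ x).
  by apply; rewrite inE.
have : \forall z \near x, P (chart_inv c z) by exact: cc.
have : \forall z \near x, chart_image c z by exact: open_nbhs_nbhs.
by apply: filter_app2; near=> z.
Unshelve. all: by end_near. Qed.

(** Charts are homeomorphisms between open sets, so neighbourhoods can be carried both ways; this
    lets the analytic statement on balls act on the manifold. *)
Lemma interior_zerosP (c : chart M) p : chart_dom c p ->
  interior form_zeros p <-> \forall z \near chart_coord c p, b c z = 0.
Proof.
move=> cp; split=> [Zp|bz].
  have cx : chart_image c (chart_coord c p) by exists p.
  have : \forall q \near chart_inv c (chart_coord c p), form_zeros q by rewrite coordK.
  move=> /(near_inv cx); apply: filter_app; near=> z => -[[q cq <-]].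
  by rewrite coordK//; exact.
have := near_coord cp bz; apply: filter_app; near=> q => -[cq].
exact: form_zeros_chart.
Unshelve. all: by end_near. Qed.

(** A chart ball around a limit point contains a point near which the form vanishes, so that its
    first partials vanish there too; [killing_ball] carries this over the whole ball, centre
    included. *)
Lemma interior_zeros_closed : closed (interior form_zeros).
Proof.
move=> p clp; have [c cp] := dom_cover p.
have cx : chart_image c (chart_coord c p) by exists p.
have oc := @chart_image_open _ _ M c.
have /nbhs_ballP[r /= r0 xr] := open_nbhs_nbhs (conj oc cx).
have bx : \forall z \near chart_coord c p, ball (chart_coord c p) r z by exact: nbhsx_ballx.
have [q [Zq [cq xq]]] := clp _ (near_coord cp bx).
have bq := (interior_zerosP cq).1 Zq.
apply/(interior_zerosP cp); move: bx; apply: filter_app; near=> z => xz.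
apply/rowP => i; rewrite [RHS]mxE.
apply: (killing_ball oc (@smooth_metric _ _ M a a_riem c) (@metric_sym _ _ _ _ a_riem c)
  (@metric_unit _ _ _ _ a_riem c) (@smooth_form _ _ M b b_form c)
  (fun x i j cx => b_killing i j cx) xr xq xz).
- by move=> j; rewrite (nbhs_singleton bq) mxE.
- move=> j k; rewrite -[RHS](partial_cst j (0 : R) (chart_coord c q)).
  by apply: partial_near; move: bq; apply: filter_app; near=> y => ->; rewrite mxE.
Unshelve. all: by end_near. Qed.

Lemma killing_support_dense (c : chart M) x :
  (exists c x, chart_image c x /\ b c x != 0) -> chart_image c x ->
  ~ \forall z \near x, b c z = 0.
Proof.
move=> [d [y [dy by0]]] [p cp <-] /(interior_zerosP cp) Zp.
have : interior form_zeros = [set: M].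
  apply: M_connected; first by exists p.
  - by exists (interior form_zeros); [exact: open_interior|rewrite setTI].
  - by exists (interior form_zeros); [exact: interior_zeros_closed|rewrite setTI].
move=> ZT; case: dy by0 => q dq <- /eqP; apply.
have : interior form_zeros q by rewrite ZT.
by move=> /interior_subset; exact.
Qed.

End Density.

(** * Einstein deformations *)

Section EinsteinDeformation.
Context {R : realType} {n : nat}.
Local Notation V := 'rV[R]_n.
Variables (M : smooth_manifold R n) (a : form2 M) (b : form1 M) (mu mubar : R).
Variables (rho kappa : R -> R) (D : set R).
Hypotheses (a_einstein : is_einstein mu a) (b_form : is_one_form b).
Hypotheses (b_killing : is_killing a b) (oD : open D).
Hypothesis uD : forall c x, chart_image c x -> D (normb2 (a c) (b c) x).
Hypotheses (rho_smooth : smooth1_on D rho) (kappa_smooth : smooth1_on D kappa).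
Hypothesis Delta_gt0 : forall c x, chart_image c x ->
  0 < Delta kappa (normb2 (a c) (b c) x).
Let a_riem : is_riemannian a := proj1 a_einstein.

Lemma normb2_neq0 (c : chart M) x : chart_image c x -> b c x != 0 ->
  normb2 (a c) (b c) x != 0.
Proof.
move=> cx; apply: contra => /eqP u0; apply/eqP.
set X := dual_vec (a c) (b c) x.
have gX : a c x *m X = (b c x)^T.
  by rewrite /X dual_vec.unlock mulKVmx// (metric_unit a_riem cx).
have qX : quad (a c x) X^T = 0.
  by rewrite quadE trmxK -mulmxA gX -trmx_mul mxE -normb2E.
have X0 : X^T = 0.
  by apply/eqP/negP => /negP /(metric_pos a_riem cx); rewrite qX ltxx.
by rewrite -[LHS]trmxK -gX -[X]trmxK X0 !trmx0 mulmx0 trmx0.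
Qed.

(** The definition gives only equality of quadratic forms; since both matrices are symmetric, it
    polarises to the matrix equation used in the divergence lemmas. *)
Lemma ricci_einstein (c : chart M) x : chart_image c x ->
  ricci (a c) x = ((n%:R - 1) * mu) *: a c x.
Proof.
move=> cx; apply/eqP; rewrite -subr_eq0; apply/eqP; apply: sym_quad0 => [|y].
  rewrite raddfB /= linearZ /= (metric_sym a_riem cx); congr (_ - _).
  apply/matrixP => i j; rewrite mxE.
  exact: (ricci_sym (@chart_image_open _ _ M c) (@smooth_metric _ _ M a a_riem c)
    (@metric_sym _ _ _ _ a_riem c) (@metric_unit _ _ _ _ a_riem c) j i cx).
have := proj2 a_einstein c x y cx; rewrite !quadE => e.
have eB (p q : 'M[R]_1) : (p - q) 0 0 = p 0 0 - q 0 0 by rewrite !mxE.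
have eZ s (p : 'M[R]_1) : (s *: p) 0 0 = s * p 0 0 by rewrite mxE.
by rewrite mulmxBr mulmxBl -scalemxAr -scalemxAl eB eZ e subrr.
Qed.

(** An identity valid for every [mubar], whether or not the deformed metric is Einstein, so both
    directions of the theorem can be read off from it. *)
Lemma einstein_defect (c : chart M) (x y : V) : chart_image c x -> b c x != 0 ->
  let u := normb2 (a c) (b c) x in
  let tr := ttr (a c) (b c) x in
  let t := tbb (a c) (b c) x in
  quad (ricci (deform rho kappa a b c) x) y
    - (n%:R - 1) * mubar * quad (deform rho kappa a b c x) y =
  E1 n mu mubar rho kappa u tr t * alpha (a c) x y ^+ 2
  + E2 n mu mubar rho kappa u tr t * beta (b c) x y ^+ 2
  + E3 n rho kappa u * s0 (a c) (b c) x y ^+ 2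
  + E4 kappa u * t00 (a c) (b c) x y
  + E5 n rho kappa u * beta (b c) x y * t0 (a c) (b c) x y
  + E6 n rho kappa u * s00 (a c) (b c) x y.
Proof.
move=> cx bx u tr t; rewrite deformE.
have kill : forall z i j, chart_image c z ->
  covd (a c) (b c) i j z + covd (a c) (b c) j i z = 0.
  by move=> z i j; exact: b_killing.
have gs := @metric_sym _ _ _ _ a_riem c; have gu := @metric_unit _ _ _ _ a_riem c.
have D0 : forall z, chart_image c z -> Delta kappa (normb2 (a c) (b c) z) != 0.
  by move=> z cz; rewrite gt_eqF// Delta_gt0.
have alphaE : alpha (a c) x y ^+ 2 = (y *m a c x *m y^T) 0 0.
  rewrite /alpha sqr_sqrtr ?quadE//; have [->|/(metric_pos a_riem cx)/ltW] := eqVneq y 0.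
    by rewrite mul0mx mul0mx mxE.
  by rewrite quadE.
have := ricci_deformed (@chart_image_open _ _ M c) (@smooth_metric _ _ M a a_riem c)
  gs gu (@smooth_form _ _ M b b_form c) oD (@uD c) rho_smooth kappa_smooth D0 kill
  (deform_unit a_riem rho Delta_gt0 (c := c)) mubar y^T cx (normb2_neq0 cx bx)
  (ricci_einstein cx).
rewrite trmxK => e; rewrite [quad _ y]quadE [quad (deformed _ _ _ _ _) y]quadE; apply: (etrans e).
by rewrite alphaE betaE s0E s00E (t00E kill _ cx) (t0E kill _ cx) /tr /t
  (tbbE kill cx) (ttrE gs kill cx).
Qed.

End EinsteinDeformation.

Unset Implicit Arguments.
Set Strict Implicit.
Set Printing Implicit Defensive.

Theorem theorem4p2 (R : realType) (n : nat) (M : smooth_manifold R n)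
    (M_connected : connected [set: M])
    (a : form2 M) (b : form1 M) (mu mubar : R)
    (rho kappa : R -> R) (I : set R)
    (a_einstein : is_einstein mu a)
    (b_form : is_one_form b) (b_killing : is_killing a b)
    (b_neq0 : exists c x, chart_image c x /\ b c x != 0)
    (I_open : open I)
    (b2_in_I : forall c x, chart_image c x -> I (normb2 (a c) (b c) x))
    (rho_smooth : smooth1_on I rho) (kappa_smooth : smooth1_on I kappa)
    (Delta_gt0 : forall c x, chart_image c x ->
       0 < Delta kappa (normb2 (a c) (b c) x)) :
  is_einstein mubar (deform rho kappa a b) <->
  (forall (c : chart M) (x y : 'rV[R]_n), chart_image c x -> b c x != 0 ->
     let u := normb2 (a c) (b c) x in
     let tr := ttr (a c) (b c) x in
     let t := tbb (a c) (b c) x in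
     E1 n mu mubar rho kappa u tr t * alpha (a c) x y ^+ 2
     + E2 n mu mubar rho kappa u tr t * beta (b c) x y ^+ 2
     + E3 n rho kappa u * s0 (a c) (b c) x y ^+ 2
     + E4 kappa u * t00 (a c) (b c) x y
     + E5 n rho kappa u * beta (b c) x y * t0 (a c) (b c) x y
     + E6 n rho kappa u * s00 (a c) (b c) x y = 0).
Proof.
have a_riem := proj1 a_einstein.
have defect c x y := einstein_defect mubar a_einstein b_form b_killing I_open b2_in_I
  rho_smooth kappa_smooth Delta_gt0 (c := c) (x := x) y.
split=> [[_ ein] c x y cx bx u tr t|E0].
  by rewrite -(defect c x y cx bx) (ein c x y cx) subrr.
have hr := deform_riemannian a_riem b_form I_open b2_in_I rho_smooth kappa_smooth Delta_gt0.
split=> [|c x y cx]; first exact: hr.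
pose h := deform rho kappa a b c; pose U := chart_image c.
have oU : open U := @chart_image_open _ _ M c.
have sh : smooth_mx U h.
  rewrite /h deformE.
  exact (smooth_deform a_riem b_form I_open b2_in_I rho_smooth kappa_smooth c).
have sq (A : 'rV[R]_n -> 'M[R]_n) : smooth_mx U A -> smooth_on U (fun z => quad (A z) y).
  move=> sA; apply: smooth_sum => // i; apply: smooth_sum => // j.
  by apply: smoothM => //; [apply: smoothM => //|]; exact: smooth_cst.
have sric : smooth_mx U (ricci h).
  exact: smooth_ricci oU sh (@metric_sym _ _ _ _ hr c) (@metric_unit _ _ _ _ hr c).
(* The Einstein defect for a fixed [y]. It is smooth across the zeros of beta, unlike the expression
   in the E_i, which equals it only away from them. *)
pose F z := quad (ricci h z) y - (n%:R - 1) * mubar * quad (h z) y.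
have sF : smooth_on U F.
  by apply: smoothB => //; [|apply: smoothM => //; first exact: smooth_cst]; exact: sq.
apply/eqP; rewrite -subr_eq0 -/(F x); apply/negP => /negP F0.
have cF : {for x, continuous F}.
  by apply: differentiable_continuous; exact: smooth_diff sF cx.
apply: (killing_support_dense M_connected a_riem b_form b_killing b_neq0 cx).
(* A nonzero value of [F] persists near [x]. Where beta does not vanish, [F] is 0 by the hypothesis;
   so beta would vanish on a neighbourhood of [x], against density. *)
have : \forall z \near x, F z != 0.
  have e0 : 0 < `|F x| by rewrite normr_gt0.
  move/cvgrPdist_lt: cF => /(_ _ e0); apply: filterS => z.
  by apply: contraTneq => ->; rewrite subr0 ltxx.
have : \forall z \near x, U z by exact: open_nbhs_nbhs.
apply: filter_app2; near=> z => Uz; apply: contraNeq => bz; apply/eqP.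
by rewrite /F (defect c z y Uz bz) E0.
Unshelve. all: by end_near.
Qed.
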